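(* Let $n\ge 1$ be an integer, let $\alpha>0$ be a real number, and let $\Sigma\subset\mathbb{R}^{n+1}$ be a smooth, complete, connected, embedded $\alpha$-stationary hypersurface passing through the origin. Then $\Sigma$ is a linear hyperplane, i.e. an $n$-dimensional linear subspace of $\mathbb{R}^{n+1}$.
   Context: For a hypersurface $\Sigma\subset\mathbb{R}^{n+1}$ and $\alpha\in\mathbb{R}$, the Euler-Dierkes-Huisken functional is $\mathcal{E}_\alpha(\Sigma)=\int_\Sigma |X|^\alpha\,d\mathcal{H}^n$, where $X$ is the position vector in $\mathbb{R}^{n+1}$ and $\mathcal{H}^n$ is the $n$-dimensional Hausdorff measure. Its Euler-Lagrange equation is $$H=\alpha\,|X|^{-2}\langle X,\nu\rangle, \qquad ( * )$$ where $\nu$ is a unit normal vector field of $\Sigma$ and $H$ is the (scalar) mean curvature of $\Sigma$, with the sign convention $H=\langle \vec H,\nu\rangle$, $\vec H$ being the mean curvature vector (the trace of the second fundamental form). With this convention, for a graph $\{(x,u(x))\}$ of a smooth function $u$ of $x\in\mathbb{R}^n$, equation $( * )$ reads $$\operatorname{div}\Big(\frac{\nabla u}{\sqrt{1+|\nabla u|^2}}\Big)=\alpha\,\frac{u-\langle x,\nabla u\rangle}{(|x|^2+u^2)\sqrt{1+|\nabla u|^2}}.$$ A hypersurface is called $\alpha$-stationary if it satisfies $( * )$ in $\mathbb{R}^{n+1}\setminus\{0\}$. An $\alpha$-stationary hypersurface $\Sigma$ is said to pass through the origin if $0\in\Sigma$ and $\Sigma\setminus\{0\}$ satisfies $( *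 )$. The smoothness of $\Sigma$ is assumed everywhere, including at the origin. *)

(* Defs.v *)
From HB Require Import structures.
From mathcomp Require Import all_boot all_order all_algebra.
From mathcomp Require Import all_classical all_reals all_analysis.

Set Implicit Arguments.
Unset Strict Implicit.
Unset Printing Implicit Defensive.

Import Order.TTheory GRing.Theory Num.Theory.
Import numFieldNormedType.Exports.

Local Open Scope classical_set_scope.
Local Open Scope ring_scope.

(* The library's norm on 'rV[R]_n is the max norm. It induces the Euclidean
   topology, so it is used for continuity and differentiability only; every
   metric quantity below uses [dot] and [enorm]. *)
Definition dot {R : realType} {m : nat} (u v : 'rV[R]_m) : R :=
  \sum_(i < m) u 0 i * v 0 i.

Definition enorm {R : realType} {m : nat} (u : 'rV[R]_m) : R :=
  Num.sqrt (dot u u).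

Definition partial {R : realType} {n m : nat} (i : 'I_n)
    (f : 'rV[R]_n -> 'rV[R]_m) (x : 'rV[R]_n) : 'rV[R]_m :=
  'D_(delta_mx 0 i) f x.

(* Class C^k on a set V, meant for V open. *)
Fixpoint class_C {R : realType} {n m : nat} (k : nat) (V : set 'rV[R]_n)
    (f : 'rV[R]_n -> 'rV[R]_m) : Prop :=
  match k with
  | 0%N => forall x, V x -> {for x, continuous f}
  | k'.+1 => (forall x, V x -> differentiable f x) /\
             (forall i : 'I_n, class_C k' V (partial i f))
  end.

Definition smooth_on {R : realType} {n m : nat} (V : set 'rV[R]_n)
    (f : 'rV[R]_n -> 'rV[R]_m) : Prop :=
  forall k, class_C k V f.

(* phi : V -> Sigma `&` U is a smooth immersion and a homeomorphism onto the
   relatively open piece Sigma `&` U for the subspace topology. With the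
   row-vector convention, row i of 'J phi x is the i-th partial derivative. *)
Definition local_param {R : realType} {n : nat} (Sigma : set 'rV[R]_n.+1)
    (U : set 'rV[R]_n.+1) (V : set 'rV[R]_n)
    (phi : 'rV[R]_n -> 'rV[R]_n.+1) : Prop :=
  [/\ open U /\ open V,
      smooth_on V phi,
      phi @` V = Sigma `&` U,
      forall x, V x -> row_free ('J phi x) &
      exists psi : 'rV[R]_n.+1 -> 'rV[R]_n,
        {within Sigma `&` U, continuous psi} /\
        (forall x, V x -> psi (phi x) = x)].

Definition embedded_hypersurface {R : realType} {n : nat}
    (Sigma : set 'rV[R]_n.+1) : Prop :=
  forall p, Sigma p -> exists U V phi, U p /\ local_param Sigma U V phi.

Definition first_ff {R : realType} {n : nat} (phi : 'rV[R]_n -> 'rV[R]_n.+1)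
    (x : 'rV[R]_n) : 'M[R]_n :=
  \matrix_(i, j) dot (partial i phi x) (partial j phi x).

(* w minus its orthogonal projection onto the span of the rows of 'J phi x,
   i.e. onto the tangent space. *)
Definition normal_part {R : realType} {n : nat}
    (phi : 'rV[R]_n -> 'rV[R]_n.+1) (x : 'rV[R]_n) (w : 'rV[R]_n.+1) :
    'rV[R]_n.+1 :=
  w - w *m ('J phi x)^T *m invmx (first_ff phi x) *m 'J phi x.

(* A(d_i, d_j): normal part of the ambient second derivative. *)
Definition second_ff {R : realType} {n : nat} (phi : 'rV[R]_n -> 'rV[R]_n.+1)
    (x : 'rV[R]_n) (i j : 'I_n) : 'rV[R]_n.+1 :=
  normal_part phi x (partial i (partial j phi) x).

Definition mean_curvature_vector {R : realType} {n : nat}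
    (phi : 'rV[R]_n -> 'rV[R]_n.+1) (x : 'rV[R]_n) : 'rV[R]_n.+1 :=
  \sum_(i < n) \sum_(j < n) invmx (first_ff phi x) i j *: second_ff phi x i j.

Definition unit_normal {R : realType} {n : nat}
    (phi : 'rV[R]_n -> 'rV[R]_n.+1) (x : 'rV[R]_n) (nu : 'rV[R]_n.+1) : Prop :=
  enorm nu = 1 /\ forall i : 'I_n, dot (partial i phi x) nu = 0.

Definition mean_curvature {R : realType} {n : nat}
    (phi : 'rV[R]_n -> 'rV[R]_n.+1) (x : 'rV[R]_n) (nu : 'rV[R]_n.+1) : R :=
  dot (mean_curvature_vector phi x) nu.

(* H = alpha |X|^-2 <X, nu> at every point of Sigma other than the origin.
   The mean curvature vector does not depend on the parametrization, and both
   sides change sign with nu, so the quantification over phi and over both unit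
   normals is only a way to make sense of the equation pointwise. *)
Definition stationary {R : realType} {n : nat} (alpha : R)
    (Sigma : set 'rV[R]_n.+1) : Prop :=
  forall U V phi, local_param Sigma U V phi ->
  forall x, V x -> phi x != 0 ->
  forall nu, unit_normal phi x nu ->
    mean_curvature phi x nu = alpha * enorm (phi x) ^- 2 * dot (phi x) nu.

(* Only the restriction of gamma to [0, 1] matters: every C^1 curve on [0, 1]
   extends to a C^1 curve on R. *)
Definition C1_curve_in {R : realType} {m : nat} (Sigma : set 'rV[R]_m)
    (p q : 'rV[R]_m) (gamma : R -> 'rV[R]_m) : Prop :=
  [/\ forall t, derivable gamma t 1,
      continuous (derive1 gamma),
      forall t, 0 <= t <= 1 -> Sigma (gamma t),
      gamma 0 = p &
      gamma 1 = q].

Definition curve_length {R : realType} {m : nat} (gamma : R -> 'rV[R]_m) :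
    \bar R :=
  (\int[lebesgue_measure]_(t in `[0%R, 1%R]) (enorm (derive1 gamma t))%:E)%E.

Definition intrinsic_dist {R : realType} {m : nat} (Sigma : set 'rV[R]_m)
    (p q : 'rV[R]_m) : \bar R :=
  ereal_inf [set curve_length gamma | gamma in C1_curve_in Sigma p q].

(* Completeness for the Riemannian distance of the induced metric; this does
   not presuppose that Sigma is closed in the ambient space. *)
Definition complete_hypersurface {R : realType} {m : nat}
    (Sigma : set 'rV[R]_m) : Prop :=
  forall u : nat -> 'rV[R]_m,
    (forall k, Sigma (u k)) ->
    (forall eps : R, 0 < eps -> exists N, forall k l, (N <= k)%N -> (N <= l)%N ->
       (intrinsic_dist Sigma (u k) (u l) < eps%:E)%E) ->
    exists p, Sigma p /\
      forall eps : R, 0 < eps -> exists N, forall k, (N <= k)%N ->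
        (intrinsic_dist Sigma (u k) p < eps%:E)%E.

Definition linear_hyperplane {R : realType} {n : nat}
    (Sigma : set 'rV[R]_n.+1) : Prop :=
  exists W : {vspace 'rV[R]_n.+1}, \dim W = n /\ Sigma = [set x | x \in W].

(* Main.v *)
Require Import Defs.
From HB Require Import structures.
From mathcomp Require Import all_boot all_order all_algebra perm.
From mathcomp Require Import all_classical all_reals all_analysis.
From mathcomp Require Import ring lra zify.

(** Let [e] be a unit normal of [Sigma] at the origin and [P] the hyperplane
orthogonal to [e]. Near 0, [Sigma] is the graph over [P] of a smooth function u
that vanishes to second order at 0 ([graph_chart]), and stationarity reads
([graph_pde])

  (|x|^2 + u^2) ((1 + |grad u|^2) Lap u - D^2u (grad u, grad u))
     = alpha (1 + |grad u|^2) (u - x . grad u).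

This equation degenerates at the origin: its leading part there is
r^2 Lap u + alpha (E u - u) with r = |x| and E = x . grad, an operator that
preserves the degree of homogeneous polynomials. Suppose that the Taylor expansion
of u starts with a homogeneous polynomial h of degree k >= 2. Then
r^2 Lap h + alpha (k - 1) h = 0, and since alpha > 0 this forces h = 0: applying
Lap produces an equation of the same kind for Lap h, of lower degree and with a
larger constant ([Oh_improve]). Hence u vanishes to infinite order at 0
([flat_of_pde]).

The second ingredient is strong unique continuation for this degenerate operator
([strong_unique_continuation]): if beta >= 0, |r^2 Lap u + beta (E u - u)| is at
most C r (r |grad u| + |u|), and u vanishes to infinite order at 0, then u = 0 near 0.
It follows from a Carleman inequality ([carleman]) with the weight
((1 + r^2) / r^2)^k for large k. The inequality is a pointwise identity plus a
divergence, so of the integral one uses only that it kills the derivatives of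
compactly supported functions; limits of Riemann sums over regular grids have
this property ([null_pd]).

So [Sigma] coincides with [P] near 0 ([plane_at_origin]). The points near which
[Sigma] lies in [P] form an open part of [Sigma], which is also closed: at a limit
point p != 0 the equation is regular, and unique continuation with beta = 0, from
a point near p, reaches p ([propagate]). As [Sigma] is connected, it lies in [P],
and then it is open in [P]. Finally, the points of a ray of [P] from the origin are,
as long as the ray stays in [Sigma], at an intrinsic distance equal to the Euclidean
one, so completeness prevents the ray from leaving [Sigma] ([ray_fill]), and
[Sigma] = [P]. *)

Set Implicit Arguments.
Unset Strict Implicit.
Unset Printing Implicit Defensive.

Import Order.TTheory GRing.Theory Num.Theory.
Import numFieldNormedType.Exports.

Local Open Scope classical_set_scope.
Local Open Scope ring_scope.

(** * Partial derivatives and functions of class C^k *)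

Definition pd {R : realType} {n : nat} (i : 'I_n) (f : 'rV[R]_n -> R) :
    'rV[R]_n -> R := fun x => 'D_(delta_mx 0 i) f x.

Section pd_rules.
Context {R : realType} {n : nat}.
Implicit Types (f g : 'rV[R]_n -> R) (x : 'rV[R]_n) (i j : 'I_n).

Lemma pd_cst c i x : pd i (fun=> c) x = 0.
Proof. exact: derive_cst. Qed.

Lemma pd_add f g i x : differentiable f x -> differentiable g x ->
  pd i (fun y => f y + g y) x = pd i f x + pd i g x.
Proof. by move=> df dg; apply: deriveD; exact: diff_derivable. Qed.

Lemma pd_sub f g i x : differentiable f x -> differentiable g x ->
  pd i (fun y => f y - g y) x = pd i f x - pd i g x.
Proof. by move=> df dg; apply: deriveB; exact: diff_derivable. Qed.

Lemma pd_mul f g i x : differentiable f x -> differentiable g x ->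
  pd i (fun y => f y * g y) x = pd i f x * g x + f x * pd i g x.
Proof.
move=> df dg; rewrite /pd [LHS]deriveM; [|exact: diff_derivable..].
by rewrite /GRing.scale /= addrC (mulrC (g x)).
Qed.

Lemma pd_scale c f i x : differentiable f x ->
  pd i (fun y => c * f y) x = c * pd i f x.
Proof. by move=> df; apply: deriveZ; exact: diff_derivable. Qed.

Lemma diff_sum (I : Type) (r : seq I) (P : pred I) (F : I -> 'rV[R]_n -> R) x :
  (forall k, P k -> differentiable (F k) x) ->
  differentiable (fun y => \sum_(k <- r | P k) F k y) x.
Proof.
move=> dF; elim: r => [|a r IH].
  rewrite (_ : (fun _ => _) = cst 0); first exact: differentiable_cst.
  by apply/funext => y; rewrite big_nil.
have [Pa|Pa] := boolP (P a); last first.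
  by rewrite (_ : (fun _ => _) = (fun y => \sum_(k <- r | P k) F k y))//;
    apply/funext => y; rewrite big_cons (negbTE Pa).
rewrite (_ : (fun _ => _) = (F a) + (fun y => \sum_(k <- r | P k) F k y)).
  by apply: differentiableD => //; exact: dF.
by apply/funext => y; rewrite big_cons Pa.
Qed.

Lemma pd_sum (I : Type) (r : seq I) (P : pred I) (F : I -> 'rV[R]_n -> R) i x :
  (forall k, P k -> differentiable (F k) x) ->
  pd i (fun y => \sum_(k <- r | P k) F k y) x = \sum_(k <- r | P k) pd i (F k) x.
Proof.
move=> dF; elim: r => [|a r IH].
  rewrite big_nil (_ : (fun _ => _) = cst 0) ?pd_cst //.
  by apply/funext => y; rewrite big_nil.
rewrite big_cons; have [Pa|Pa] := boolP (P a); last first.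
  by rewrite -IH; congr (pd i _ x); apply/funext => y; rewrite big_cons (negbTE Pa).
rewrite -IH -pd_add; [|exact: dF|exact: diff_sum].
by congr (pd i _ x); apply/funext => y; rewrite big_cons Pa.
Qed.

Lemma diff_coord i x : differentiable (fun y : 'rV[R]_n => y 0 i) x.
Proof. exact: differentiable_coord. Qed.

Lemma pd_coord i j x : pd i (fun y : 'rV[R]_n => y 0 j) x = (i == j)%:R.
Proof.
rewrite /pd; have := @derive_mx _ _ _ _ id x (delta_mx 0 i) (@derivable_id _ _ _ _).
by rewrite derive_id => /matrixP /(_ 0 j); rewrite !mxE eqxx eq_sym => <-.
Qed.

Lemma diff_inv f x : f x != 0 -> differentiable f x ->
  differentiable (fun y => (f y)^-1) x.
Proof. by move=> f0 df; apply: differentiableV. Qed.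

Lemma pd_inv f i x : f x != 0 -> differentiable f x ->
  pd i (fun y => (f y)^-1) x = - (f x ^- 2 * pd i f x).
Proof.
by move=> f0 df; rewrite /pd [LHS]deriveV // ?scaleNr //; exact: diff_derivable.
Qed.

Lemma pd_near f g i x : (\forall y \near x, f y = g y) -> pd i f x = pd i g x.
Proof. exact: near_eq_derive. Qed.

Lemma pd_open (V : set 'rV[R]_n) f g i x : open V -> V x ->
  (forall y, V y -> f y = g y) -> pd i f x = pd i g x.
Proof.
move=> oV Vx fg; apply: pd_near; near=> y; apply: fg.
by near: y; exact: open_nbhs_nbhs.
Unshelve. all: by end_near. Qed.

End pd_rules.

Section diff_criteria.
Context {R : realType} {V W : normedModType R}.

Lemma diff_epsP (f : V -> W) x : differentiable f x ->
  forall eps, 0 < eps ->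
  \forall h \near (0 : V), `|f (h + x) - f x - 'd f x h| <= eps * `|h|.
Proof.
move=> /diff_locallyP[_ /eqaddoP H] eps e0.
apply: filterS (H eps e0) => h; by rewrite !fctE /= opprD addrA.
Qed.

(** Recognises the differential from an epsilon estimate, at the points where no
closure rule applies: a zero of a positive part, the singular origin, a value
of an inverse map. *)
Lemma diff_eps (f : V -> W) x (df : {linear V -> W}) : continuous df ->
  (forall eps, 0 < eps ->
    \forall h \near (0 : V), `|f (h + x) - f x - df h| <= eps * `|h|) ->
  differentiable f x /\ 'd f x = df :> (V -> W).
Proof.
move=> cdf H.
have E : f \o shift x = cst (f x) + df +o_ 0 id.
  apply/eqaddoP => eps e0; apply: filterS (H eps e0) => h.
  by rewrite /= !fctE /= opprD addrA.
have dE := diff_unique cdf E; split => //.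
by apply/diff_locallyP; rewrite dE.
Qed.

Lemma diff_near (f g : V -> W) x : (\forall y \near x, f y = g y) ->
  differentiable f x -> differentiable g x.
Proof.
move=> fg df; apply: (proj1 (@diff_eps g x ('d f x) _ _)) => [|eps e0].
  exact: diff_continuous.
have fg' : \forall h \near 0, f (h + x) = g (h + x).
  have c : (fun h => h + x) @ (0 : V) --> x.
    by rewrite -{2}(add0r x); apply: cvgD; [exact: cvg_id|exact: cvg_cst].
  exact: (c _ fg).
near=> h; have -> : g (h + x) = f (h + x) by apply/esym; near: h.
by rewrite -(nbhs_singleton fg); near: h; exact: diff_epsP.
Unshelve. all: by end_near. Qed.

End diff_criteria.

Section lines.
Context {R : realType} {n : nat}.
Implicit Types (f g : 'rV[R]_n -> R) (x v : 'rV[R]_n) (i j : 'I_n).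

Lemma diff_pd f x v : differentiable f x ->
  'd f x v = \sum_i v 0 i * pd i f x.
Proof.
move=> df; rewrite {1}(row_sum_delta v) linear_sum; apply: eq_bigr => i _.
by rewrite linearZ /= /pd deriveE.
Qed.

Lemma is_derive_line f x v (t : R) : differentiable f (x + t *: v) ->
  is_derive t (1 : R) (fun s => f (x + s *: v)) (\sum_i v 0 i * pd i f (x + t *: v)).
Proof.
move=> df; pose l : R -> 'rV[R]_n := fun s => x + s *: v.
have dl : is_diff t l ( *:%R^~ v).
  have h := is_diffD (is_diff_cst x t) (is_diff_scalel t v).
  by rewrite add0r in h.
have dlt : differentiable l t by case: dl.
have dfl : differentiable (f \o l) t by exact: differentiable_comp.
apply: DeriveDef; first exact/derivable1_diffP.
rewrite (@deriveE _ _ _ (f \o l)) // diff_comp //=.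
have -> : 'd l t = *:%R^~ v :> (R -> _) by case: dl.
by rewrite scale1r diff_pd.
Qed.

Lemma pd_mvt f x v : (forall t, 0 <= t <= 1 -> differentiable f (x + t *: v)) ->
  exists2 t, 0 < t < 1 & f (x + v) - f x = \sum_i v 0 i * pd i f (x + t *: v).
Proof.
move=> df; pose g s := f (x + s *: v).
have [| |t t01] := @MVT R g (fun t => \sum_i v 0 i * pd i f (x + t *: v)) 0 1 ltr01.
- move=> t; rewrite in_itv /= => /andP[t0 t1]; apply: is_derive_line.
  by apply: df; rewrite !ltW.
- apply: derivable_within_continuous => t; rewrite in_itv /= => t01.
  by have [] := is_derive_line (df t t01).
rewrite /g scale1r scale0r addr0 subr0 mulr1 => ->; exists t => //.
Qed.

End lines.

(** Scalar counterpart of [class_C], on which the closure rules are stated;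
[class_CP] transfers them to the coordinates of a vector valued map. *)
Fixpoint Ck {R : realType} {n : nat} (k : nat) (V : set 'rV[R]_n)
    (f : 'rV[R]_n -> R) : Prop :=
  match k with
  | 0%N => forall x, V x -> {for x, continuous f}
  | k'.+1 => (forall x, V x -> differentiable f x) /\
             (forall i : 'I_n, Ck k' V (pd i f))
  end.

Section Ck_rules.
Context {R : realType} {n : nat}.
Implicit Types (f g : 'rV[R]_n -> R) (x v : 'rV[R]_n) (i j : 'I_n)
  (V : set 'rV[R]_n).

Lemma continuous_near f g x : (\forall y \near x, f y = g y) ->
  {for x, continuous f} -> {for x, continuous g}.
Proof.
move=> fg cf; have e : f x = g x := nbhs_singleton fg.
have h : f @ x --> g x by rewrite -e.
exact: (cvg_trans (@near_eq_cvg _ _ (nbhs x) _ _ _ fg) h).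
Qed.

Lemma open_near V x (P : 'rV[R]_n -> Prop) : open V -> V x ->
  (forall y, V y -> P y) -> \forall y \near x, P y.
Proof. by move=> oV Vx VP; apply: filterS VP _; exact: open_nbhs_nbhs. Qed.

Lemma Ck_ext k V f g : open V -> (forall x, V x -> f x = g x) ->
  Ck k V f -> Ck k V g.
Proof.
move=> oV; elim: k f g => [|k IH] f g fg /=.
  by move=> cf x Vx; apply: (continuous_near _ (cf x Vx)); exact: open_near fg.
move=> [df Cf]; split=> [x Vx|i].
  by apply: (diff_near _ (df x Vx)); exact: (open_near oV Vx fg).
by apply: IH (Cf i) => x Vx; exact: (pd_open _ oV).
Qed.

Lemma Ck_diff k V f x : Ck k.+1 V f -> V x -> differentiable f x.
Proof. by case=> df _; exact: df. Qed.

Lemma Ck_pd k V f i : Ck k.+1 V f -> Ck k V (pd i f).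
Proof. by case=> _; exact. Qed.

Lemma CkW k V f : Ck k.+1 V f -> Ck k V f.
Proof.
elim: k f => [|k IH] f [df Cf] /=.
  by move=> x Vx; exact/differentiable_continuous/df.
by split=> // i; exact/IH/Cf.
Qed.

Lemma Ck_le k l V f : (k <= l)%N -> Ck l V f -> Ck k V f.
Proof.
elim: l => [|l IH]; first by rewrite leqn0 => /eqP ->.
by rewrite leq_eqVlt => /predU1P[->//|kl] /CkW; exact: IH.
Qed.

Lemma Ck_cont k V f x : Ck k V f -> V x -> {for x, continuous f}.
Proof. by move/(@Ck_le 0 k V f isT) => /= h /h. Qed.

Lemma Ck_sub k V V' f : V' `<=` V -> Ck k V f -> Ck k V' f.
Proof.
move=> s; elim: k f => [|k IH] f /=; first by move=> h x /s /h.
by move=> [df Cf]; split=> [x /s /df//|i]; exact: IH.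
Qed.

Lemma Ck_cst k V c : Ck k V (fun=> c).
Proof.
elim: k c => [|k IH] c /=; first by move=> x _; exact: cst_continuous.
split=> [x _|i]; first exact: differentiable_cst.
by rewrite (_ : pd i _ = fun=> 0) //; apply/funext => x; rewrite pd_cst.
Qed.

Lemma Ck_coord k V i : Ck k V (fun y => y 0 i).
Proof.
case: k => [|k] /=; first by move=> x _; exact: coord_continuous.
split=> [x _|j]; first exact: diff_coord.
rewrite (_ : pd j _ = fun=> (j == i)%:R); first exact: Ck_cst.
by apply/funext => x; rewrite pd_coord.
Qed.

Lemma Ck_add k V f g : open V -> Ck k V f -> Ck k V g ->
  Ck k V (fun x => f x + g x).
Proof.
move=> oV; elim: k f g => [|k IH] f g /=.
  by move=> cf cg x Vx; exact: continuousD (cf x Vx) (cg x Vx).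
move=> [df Cf] [dg Cg]; split=> [x Vx|i].
  by apply: differentiableD; [exact: df|exact: dg].
apply: Ck_ext (IH _ _ (Cf i) (Cg i)) => // x Vx.
by rewrite pd_add //; [exact: df|exact: dg].
Qed.

Lemma Ck_mul k V f g : open V -> Ck k V f -> Ck k V g ->
  Ck k V (fun x => f x * g x).
Proof.
move=> oV; elim: k f g => [|k IH] f g.
  by move=> /= cf cg x Vx; exact: continuousM (cf x Vx) (cg x Vx).
move=> Cf Cg; have [df Df] := Cf; have [dg Dg] := Cg.
split=> [x Vx|i]; first by apply: differentiableM; [exact: df|exact: dg].
have H : Ck k V (fun x => pd i f x * g x + f x * pd i g x).
  apply: Ck_add => //; [exact: IH (Df i) (CkW Cg)|exact: IH (CkW Cf) (Dg i)].
apply: Ck_ext H => // x Vx.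
by rewrite pd_mul //; [exact: df|exact: dg].
Qed.

Lemma Ck_scale k V c f : open V -> Ck k V f -> Ck k V (fun x => c * f x).
Proof. by move=> oV; apply: Ck_mul => //; exact: Ck_cst. Qed.

Lemma Ck_opp k V f : open V -> Ck k V f -> Ck k V (fun x => - f x).
Proof.
move=> oV Cf; apply: Ck_ext (Ck_scale (-1) oV Cf) => // x _.
by rewrite mulN1r.
Qed.

Lemma Ck_sub2 k V f g : open V -> Ck k V f -> Ck k V g ->
  Ck k V (fun x => f x - g x).
Proof. by move=> oV Cf Cg; apply: Ck_add => //; exact: Ck_opp. Qed.

Lemma Ck_sum k V (I : Type) (r : seq I) (P : pred I) (F : I -> 'rV[R]_n -> R) :
  open V -> (forall a, P a -> Ck k V (F a)) ->
  Ck k V (fun y => \sum_(a <- r | P a) F a y).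
Proof.
move=> oV CF; elim: r => [|a r IH].
  by apply: Ck_ext (Ck_cst k V 0) => // x _; rewrite big_nil.
have [Pa|Pa] := boolP (P a).
  by apply: Ck_ext (Ck_add oV (CF a Pa) IH) => // x _; rewrite big_cons Pa.
by apply: Ck_ext IH => // x _; rewrite big_cons (negbTE Pa).
Qed.

Lemma Ck_prod k V (I : Type) (r : seq I) (P : pred I) (F : I -> 'rV[R]_n -> R) :
  open V -> (forall a, P a -> Ck k V (F a)) ->
  Ck k V (fun y => \prod_(a <- r | P a) F a y).
Proof.
move=> oV CF; elim: r => [|a r IH].
  by apply: Ck_ext (Ck_cst k V 1) => // x _; rewrite big_nil.
have [Pa|Pa] := boolP (P a).
  by apply: Ck_ext (Ck_mul oV (CF a Pa) IH) => // x _; rewrite big_cons Pa.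
by apply: Ck_ext IH => // x _; rewrite big_cons (negbTE Pa).
Qed.

Lemma Ck_exp k V f m : open V -> Ck k V f -> Ck k V (fun x => f x ^+ m).
Proof.
move=> oV Cf; elim: m => [|m IH].
  by apply: Ck_ext (Ck_cst k V 1) => // x _; rewrite expr0.
by apply: Ck_ext (Ck_mul oV Cf IH) => // x _; rewrite exprS.
Qed.

Lemma Ck_inv k V f : open V -> (forall x, V x -> f x != 0) -> Ck k V f ->
  Ck k V (fun x => (f x)^-1).
Proof.
move=> oV f0; elim: k => [|k IH].
  by move=> cf x Vx; apply: continuousV; [exact: f0|exact: cf].
move=> Cf; have [df Df] := Cf; split=> [x Vx|i].
  by apply: diff_inv; [exact: f0|exact: df].
have H : Ck k V (fun x => - ((f x)^-1 ^+ 2 * pd i f x)).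
  apply: Ck_opp => //; apply: Ck_mul => //; last exact: Df.
  by apply: Ck_exp => //; exact: IH (CkW Cf).
apply: Ck_ext H => // x Vx.
by rewrite pd_inv ?exprVn //; [exact: f0|exact: df].
Qed.

End Ck_rules.

Section chain.
Context {R : realType}.

Lemma diff_rV (W : normedModType R) m (G : W -> 'rV[R]_m) x :
  (forall j, differentiable (fun y => G y 0 j) x) <-> differentiable G x.
Proof.
split=> [dG|dG j].
  rewrite (_ : G = \sum_j (fun y => G y 0 j *: delta_mx 0 j)).
    by apply: differentiable_sum => j; exact: differentiableZl.
  by apply/funext => y; rewrite {1}(row_sum_delta (G y)) fct_sumE.
rewrite (_ : (fun _ => _) = (fun v : 'rV[R]_m => v 0 j) \o G) //.
by apply: differentiable_comp => //; exact: differentiable_coord.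
Qed.

Lemma cvg_rV (T : Type) (F : set_system T) (FF : Filter F) m
    (G : T -> 'rV[R]_m) (l : 'rV[R]_m) :
  (forall j, (fun y => G y 0 j) @ F --> l 0 j) -> G @ F --> l.
Proof.
move=> cG; apply/cvg_ballP => e e0.
have : \forall y \near F, forall j, ball (l 0 j) e (G y 0 j).
  by apply: filter_forall => j; have /cvg_ballP := cG j; apply.
by apply: filterS => y H; split => // i j; rewrite (ord1 i); exact: H.
Qed.

Lemma cont_rV (T : topologicalType) m (G : T -> 'rV[R]_m) x :
  (forall j, {for x, continuous (fun y => G y 0 j)}) <-> {for x, continuous G}.
Proof.
split=> [cG|cG j]; first by apply: cvg_rV => j; exact: cG.
apply: (@continuous_comp _ _ _ G (fun v : 'rV[R]_m => v 0 j)) => //.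
exact: coord_continuous.
Qed.

Lemma pd_comp n m (f : 'rV[R]_m -> R) (G : 'rV[R]_n -> 'rV[R]_m) i x :
  differentiable G x -> differentiable f (G x) ->
  pd i (fun y => f (G y)) x = \sum_j pd i (fun y => G y 0 j) x * pd j f (G x).
Proof.
move=> dG df; rewrite /pd deriveE; last exact: differentiable_comp.
rewrite (@diff_comp _ _ _ _ G f) //= diff_pd //; apply: eq_bigr => j _.
congr (_ * _); rewrite -deriveE // derive_mx ?mxE //; exact: diff_derivable.
Qed.

(** By induction on [k], since the partial derivatives of [f \o G] are sums of
products of partial derivatives of [G] with functions [pd j f \o G]. *)
Lemma Ck_comp n m k (V : set 'rV[R]_n) (V' : set 'rV[R]_m)
   (f : 'rV[R]_m -> R) (G : 'rV[R]_n -> 'rV[R]_m) :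
  open V -> (forall x, V x -> V' (G x)) ->
  (forall j, Ck k V (fun y => G y 0 j)) -> Ck k V' f ->
  Ck k V (fun y => f (G y)).
Proof.
move=> oV VV'; elim: k f => [|k IH] f CG Cf.
  move=> x Vx; apply: (@continuous_comp _ _ _ G f).
    by apply/cont_rV => j; exact: CG.
  by apply: Cf; exact: VV'.
have dG x : V x -> differentiable G x.
  by move=> Vx; apply/diff_rV => j; have [h _] := CG j; exact: h.
have [df Df] := Cf; split=> [x Vx|i].
  by apply: (@differentiable_comp _ _ _ _ G f); [exact: dG|exact/df/VV'].
have H : Ck k V (fun x => \sum_j pd i (fun y => G y 0 j) x * pd j f (G x)).
  apply: Ck_sum => // j _; apply: Ck_mul => //; first exact: Ck_pd (CG j).
  by apply: IH (Df j) => j'; exact/CkW/CG.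
apply: Ck_ext H => // x Vx; rewrite pd_comp //; first exact: dG.
exact/df/VV'.
Qed.

End chain.

Section schwarz.
Context {R : realType} {n : nat}.
Implicit Types (f : 'rV[R]_n -> R) (x v : 'rV[R]_n) (i j : 'I_n).

Lemma norm_coord x i : `|x 0 i| <= `|x|.
Proof.
rewrite [leRHS]/Num.norm /= mx_normrE; apply/bigmax_geP; right => /=.
by exists (0, i).
Qed.

Lemma norm_rV_le x (e : R) : 0 <= e -> (forall i, `|x 0 i| <= e) -> `|x| <= e.
Proof.
move=> e0 H; rewrite [leLHS]/Num.norm /= mx_normrE; apply/bigmax_leP; split => //.
by move=> [i j] _; rewrite (ord1 i); exact: H.
Qed.

Lemma norm_delta i : `|(delta_mx 0 i : 'rV[R]_n)| <= 1.
Proof.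
by apply: norm_rV_le => // j; rewrite mxE eqxx; case: (j == i); rewrite ?normr1 ?normr0.
Qed.

Lemma open_ball (V : set 'rV[R]_n) x : open V -> V x ->
  exists2 d : R, 0 < d & forall y, `|y - x| < d -> V y.
Proof.
move=> oV Vx; have /nbhs_ballP[d d0 H] := open_nbhs_nbhs (conj oV Vx).
by exists d => // y yx; apply: H; rewrite -ball_normE /= distrC.
Qed.

Lemma pd_mvt1 f x i (h : R) :
  (forall t, 0 <= t <= 1 -> differentiable f (x + (t * h) *: delta_mx 0 i)) ->
  exists2 t, 0 < t < 1 &
    f (x + h *: delta_mx 0 i) - f x = h * pd i f (x + (t * h) *: delta_mx 0 i).
Proof.
move=> df; have [t t01|t t01 E] := @pd_mvt _ _ f x (h *: delta_mx 0 i).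
  by rewrite scalerA; exact: df.
exists t => //; rewrite E (bigD1 i) //= big1 ?addr0; last first.
  by move=> k /negPf ki; rewrite !mxE eqxx ki mulr0 mul0r.
by rewrite !mxE !eqxx mulr1 scalerA.
Qed.

Lemma pd_shift f v i x : pd i (fun y => f (y + v)) x = pd i f (x + v).
Proof.
have e : (fun y => f (y + v)) \o shift x = f \o shift (x + v).
  by apply/funext => h /=; rewrite addrA.
by rewrite /pd /derive e.
Qed.

#[global] Opaque pd.

(** The mean value theorem applied twice: first to the difference of [f] along
[delta_mx 0 j], as a function along [delta_mx 0 i], then to [pd i f]. *)
Lemma second_difference (V : set 'rV[R]_n) f x i j (d h : R) : Ck 2 V f ->
  (forall y, `|y - x| < d -> V y) -> 0 < h -> h + h < d ->
  exists2 y, `|y - x| <= h + h &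
    f (x + h *: delta_mx 0 i + h *: delta_mx 0 j) - f (x + h *: delta_mx 0 i) -
    (f (x + h *: delta_mx 0 j) - f x) = h * (h * pd j (pd i f) y).
Proof.
move=> Cf dV h0 hd.
have inV t s : 0 <= t <= 1 -> 0 <= s <= 1 ->
    `|x + (t * h) *: delta_mx 0 i + (s * h) *: delta_mx 0 j - x| <= h + h.
  move=> /andP[t0 t1] /andP[s0 s1]; rewrite addrAC [_ + _ - x]addrAC subrr add0r.
  apply: le_trans (ler_normD _ _) _; apply: lerD; rewrite normrZ.
    rewrite -[leRHS]mulr1; apply: ler_pM => //; last exact: norm_delta.
    by rewrite ger0_norm (mulr_ge0 t0 (ltW h0), ler_piMl (ltW h0) t1).
  rewrite -[leRHS]mulr1; apply: ler_pM => //; last exact: norm_delta.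
  by rewrite ger0_norm (mulr_ge0 s0 (ltW h0), ler_piMl (ltW h0) s1).
have z01 : 0 <= (0 : R) <= 1 by rewrite lexx ler01.
have o01 : 0 <= (1 : R) <= 1 by rewrite lexx ler01.
have Vin t s : 0 <= t <= 1 -> 0 <= s <= 1 ->
    V (x + (t * h) *: delta_mx 0 i + (s * h) *: delta_mx 0 j).
  by move=> t01 s01; apply: dV; exact: le_lt_trans (inV t s t01 s01) hd.
pose g y := f (y + h *: delta_mx 0 j) - f y.
have dsh y : differentiable f (y + h *: delta_mx 0 j) ->
    differentiable (fun y => f (y + h *: delta_mx 0 j)) y.
  move=> df.
  apply: (@differentiable_comp _ _ _ _ (fun y => y + h *: delta_mx 0 j) f) => //.
have dgt t : 0 <= t <= 1 -> differentiable g (x + (t * h) *: delta_mx 0 i).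
  move=> t01; apply: differentiableB; first apply: dsh.
    by apply: (Ck_diff Cf); have := Vin t 1 t01 o01; rewrite mul1r.
  by apply: (Ck_diff Cf); have := Vin t 0 t01 z01; rewrite mul0r scale0r addr0.
have [t /andP[t0 t1] E] := pd_mvt1 dgt.
have t01 : 0 <= t <= 1 by rewrite !ltW.
have [s sj|s /andP[s0 s1] E2] := @pd_mvt1 (pd i f) (x + (t * h) *: delta_mx 0 i) j h.
  by apply: (Ck_diff (Ck_pd i Cf)); exact: Vin.
have s01 : 0 <= s <= 1 by rewrite !ltW.
exists (x + (t * h) *: delta_mx 0 i + (s * h) *: delta_mx 0 j); first exact: inV.
rewrite -E2 -/(g (x + h *: delta_mx 0 i)) -/(g x) E; congr (_ * _).
have df1 : differentiable f (x + (t * h) *: delta_mx 0 i + h *: delta_mx 0 j).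
  by apply: (Ck_diff Cf); have := Vin t 1 t01 o01; rewrite mul1r.
have df0 : differentiable f (x + (t * h) *: delta_mx 0 i).
  by apply: (Ck_diff Cf); have := Vin t 0 t01 z01; rewrite mul0r scale0r addr0.
rewrite (pd_sub i (dsh _ df1) df0).
by rewrite pd_shift.
Qed.

(** The second difference of [f] is symmetric in [i] and [j], so by
[second_difference] the two mixed derivatives agree at points arbitrarily close
to [x]; they are continuous. *)
Lemma pdC (V : set 'rV[R]_n) f x i j : open V -> V x -> Ck 2 V f ->
  pd i (pd j f) x = pd j (pd i f) x.
Proof.
move=> oV Vx Cf; apply/eqP; rewrite -subr_eq0 -normr_le0; apply/ler_addgt0Pl => e e0.
rewrite addr0.
have [d d0 dV] := open_ball oV Vx.
have cij k l : {for x, continuous (pd k (pd l f))}.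
  by apply: (Ck_cont (k := 0%N) _ Vx); have [_ /(_ l)[_ /(_ k)]] := Cf.
have e2 : 0 < e / 2 by rewrite divr_gt0.
have nb k l : exists2 r : R, 0 < r &
    forall y, `|y - x| < r -> `|pd k (pd l f) x - pd k (pd l f) y| < e / 2.
  have /cvgrPdist_lt /(_ _ e2) /nbhs_ballP[r r0 H] := cij k l.
  by exists r => // y yx; apply: H; rewrite -ball_normE /= distrC.
have [r1 r10 H1] := nb i j; have [r2 r20 H2] := nb j i.
pose m := Num.min d (Num.min r1 r2); have m0 : 0 < m by rewrite !lt_min d0 r10.
pose h := m / 4; have h0 : 0 < h by rewrite divr_gt0.
have hm : h + h < m by rewrite /h; move: (m) m0 => m' ?; lra.
have [hd hr1 hr2] : [/\ h + h < d, h + h < r1 & h + h < r2].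
  by move: hm; rewrite !lt_min => /andP[-> /andP[-> ->]].
have [y1 y1x E1] := second_difference i j Cf dV h0 hd.
have [y2 y2x E2] := second_difference j i Cf dV h0 hd.
have E : pd j (pd i f) y1 = pd i (pd j f) y2.
  have hn : h != 0 by rewrite gt_eqF.
  suff : h * (h * pd j (pd i f) y1) = h * (h * pd i (pd j f) y2).
    by move=> /(mulfI hn) /(mulfI hn).
  apply: etrans (esym E1) _; apply: etrans _ E2.
  pose vi : 'rV[R]_n := h *: delta_mx 0 i; pose vj : 'rV[R]_n := h *: delta_mx 0 j.
  rewrite -/vi -/vj (addrAC x vj vi).
  move: (f (x + vi + vj)) (f (x + vi)) (f (x + vj)) (f x) => a b c d'; clear; ring.
have a1 : `|pd j (pd i f) x - pd i (pd j f) y2| < e / 2.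
  by rewrite -E; apply: H2; exact: le_lt_trans y1x hr2.
have a2 := H1 y2 (le_lt_trans y2x hr1).
suff tri (A B C : R) : `|B - C| < e / 2 -> `|A - C| < e / 2 -> `|A - B| <= e.
  exact: tri a1 a2.
rewrite !ltr_norml ler_norml => /andP[u1 u2] /andP[u3 u4].
clear -u1 u2 u3 u4; apply/andP; split; lra.
Qed.

End schwarz.

(** * Grid sums in place of integrals *)

Section heine.
Context {R : realType} {n : nat}.

Lemma compact_box (r : R) : compact [set x : 'rV[R]_n | `|x| <= r].
Proof.
have [r0|r0] := leP 0 r; last first.
  rewrite (_ : mkset _ = set0); first exact: compact0.
  apply/seteqP; split => // x /= xr.
  by move: (lt_le_trans r0 (le_trans (normr_ge0 x) xr)); rewrite ltxx.
apply: bounded_closed_compact.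
  by exists r; split => [|y ry x /= xr]; rewrite ?num_real // (le_trans xr) // ltW.
have -> : [set x : 'rV[R]_n | `|x| <= r] =
   (fun x : 'rV[R]_n => `|x|) @^-1` [set y | y <= r] by [].
apply: closed_comp; last exact: closed_le.
by move=> x _; exact: norm_continuous.
Qed.

(** Uniform continuity near a ball; the second point may leave the ball. *)
Lemma heine (g : 'rV[R]_n -> R) (r e : R) : continuous g -> 0 < e ->
  exists2 d, 0 < d & forall x y, `|x| <= r -> `|y - x| < d -> `|g x - g y| <= e.
Proof.
move=> cg e0.
have H := (compact_near_coveringP _).1 (@compact_box r).
pose P (d : R) (x : 'rV[R]_n) := forall y, `|y - x| < d -> `|g x - g y| <= e.
have : \forall d \near 0^'+, [set x : 'rV[R]_n | `|x| <= r] `<=` P d.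
  apply: H => x _.
  have e2 : 0 < e / 2 by rewrite divr_gt0.
  have /cvgrPdist_lt /(_ _ e2) /nbhs_ballP[rho rho0 B] := cg x.
  have r20 : 0 < rho / 2 by rewrite divr_gt0.
  exists (ball x (rho / 2), [set d | d < rho / 2]) => /=.
    split; first exact: nbhsx_ballx.
    exact: nbhs_right_lt.
  move=> [x' d] /= [xx' dr] y yx'.
  have B1 : `|g x - g x'| < e / 2.
    by apply: B; apply: le_ball xx'; lra.
  have B2 : `|g x - g y| < e / 2.
    apply: B; rewrite -ball_normE /=; move: xx'; rewrite -ball_normE /= => xx'.
    have -> : x - y = (x - x') - (y - x') by rewrite opprB addrA subrK.
    apply: le_lt_trans (ler_normB _ _) _.
    move: (`|x - x'|) (`|y - x'|) xx' yx' dr => a b; clear; lra.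
  have -> : g x' - g y = (g x - g y) - (g x - g x') by ring.
  apply: le_trans (ler_normB _ _) _.
  move: (`|g x - g y|) (`|g x - g x'|) B1 B2 => a b; clear; lra.
move=> H1.
have [d [d0 Pd]] : exists d : R, 0 < d /\ [set x : 'rV[R]_n | `|x| <= r] `<=` P d.
  by near (0 : R)^'+ => d; exists d; split; near: d => //; exact: nbhs_right_gt.
by exists d => // x y xr; exact: Pd.
Unshelve. all: by end_near. Qed.

End heine.

Section grid.
Context {R : realType} {n : nat}.
Implicit Types (f g : 'rV[R]_n -> R) (N : nat).

(** The grid has mesh 1/(N+1) and covers the half-open cube [-2, 2[^n. Its index
set is a finite group, so that the shift by one mesh is a permutation. *)
Definition side N := (4 * N).+2.+2.

Definition gridT N : finZmodType := 'rV['I_(side N)]_n.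

Definition grid N (j : gridT N) : 'rV[R]_n :=
  \row_i ((j 0 i : nat)%:R / N.+1%:R - 2).

Definition rsum N f : R := (N.+1%:R ^- n) * \sum_(j : gridT N) f (grid j).

Lemma rsumD N f g : rsum N (fun x => f x + g x) = rsum N f + rsum N g.
Proof. by rewrite /rsum big_split mulrDr. Qed.

Lemma rsumZ N c f : rsum N (fun x => c * f x) = c * rsum N f.
Proof. by rewrite /rsum -mulr_sumr mulrCA. Qed.

Lemma rsumB N f g : rsum N (fun x => f x - g x) = rsum N f - rsum N g.
Proof. by rewrite /rsum big_split mulrDr sumrN mulrN. Qed.

Lemma rsum_le N f g : (forall x, f x <= g x) -> rsum N f <= rsum N g.
Proof.
by move=> fg; rewrite ler_wpM2l ?invr_ge0 ?exprn_ge0 // ler_sum.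
Qed.

Lemma rsum_cst N c : rsum N (fun=> c) = 4 ^+ n * c.
Proof.
rewrite /rsum sumr_const card_mx card_ord mul1n.
rewrite -[c *+ _]mulr_natl mulrA; congr (_ * c).
have -> : ((4 * N).+4 = 4 * N.+1)%N by rewrite mulnS.
by rewrite natrX natrM exprMn mulrCA mulVf ?mulr1 // expf_neq0 // pnatr_eq0.
Qed.

(** The shift permutes the grid cyclically. The points that wrap around lie outside
the unit cube, where [f] vanishes. *)
Lemma rsum_shift N f i : (forall x, 1 <= `|x| -> f x = 0) ->
  rsum N (fun x => f (x + N.+1%:R^-1 *: delta_mx 0 i)) = rsum N f.
Proof.
move=> f0; congr (_ * _).
have inj : injective (fun j : gridT N => j + delta_mx 0 i) by exact: addIr.
rewrite [RHS](reindex_inj inj) /=; apply: eq_bigr => j _.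
have N0 : N.+1%:R != 0 :> R by rewrite pnatr_eq0.
have [jlt|jge] := ltnP (j 0 i).+1 (side N).
  congr f; apply/rowP => k; rewrite !mxE eqxx /=.
  have [->|ki] := eqVneq k i.
    rewrite /= mulr1 addn1 modn_small // -[(j 0 i).+1]addn1 natrD mulrDl mul1r; ring.
  by rewrite /= mulr0 addr0 addn0 modn_small // ltn_ord.
have ji : (j 0 i).+1 = side N.
  by apply/eqP; rewrite eqn_leq jge andbT; exact: ltn_ord.
have sE : (side N)%:R = 4 * N.+1%:R :> R by rewrite -natrM /side mulnS.
rewrite !f0 //.
  apply: le_trans (norm_coord _ i); rewrite !mxE !eqxx /= addn1 ji modnn.
  rewrite mul0r sub0r normrN ger0_norm //; clear; lra.
apply: le_trans (norm_coord _ i); rewrite !mxE !eqxx /= mulr1.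
have -> : (j 0 i)%:R / N.+1%:R - 2 + N.+1%:R^-1 = 2 :> R.
  have -> : (j 0 i)%:R = (side N)%:R - 1 :> R by rewrite -ji -[(j 0 i).+1]addn1 natrD addrK.
  by rewrite sE; move: N0; move: (N.+1%:R : R) => q q0; field.
rewrite ger0_norm //; clear; lra.
Qed.

Lemma grid_norm N (j : gridT N) : `|(grid j : 'rV[R]_n)| <= 2.
Proof.
apply: norm_rV_le => // i; rewrite mxE ler_norml.
have Np : 0 < N.+1%:R :> R by rewrite ltr0n.
have sE : (side N)%:R = 4 * N.+1%:R :> R by rewrite -natrM /side mulnS.
have h1 : 0 <= (j 0 i)%:R / N.+1%:R :> R by rewrite divr_ge0.
have h2 : (j 0 i)%:R / N.+1%:R <= 4 :> R.
  by rewrite ler_pdivrMr // -sE ler_nat ltnW // ltn_ord.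
move: h1 h2; clear; move: (_ / _) => a *; apply/andP; split; lra.
Qed.

(** Stands for the vanishing of the integral of [f]. *)
Definition null f := (rsum N f @[N --> \oo] --> (0 : R)).

(** The integral of a derivative of a compactly supported function vanishes: the
derivative is uniformly close to a difference quotient, whose grid sum is 0 by
[rsum_shift]. *)
Lemma null_pd f i : Ck 1 setT f -> (forall x, 1 <= `|x| -> f x = 0) ->
  null (pd i f).
Proof.
move=> Cf f0; apply/cvgrPdist_le => e e0.
have cg : continuous (pd i f) by move=> x; exact: (Ck_cont (Ck_pd i Cf)).
have e4 : 0 < e / 4 ^+ n by rewrite divr_gt0 // exprn_gt0.
have [d d0 H] := heine 2 cg e4.
near=> N.
have hd : N.+1%:R^-1 < d by near: N; exact: near_infty_natSinv_lt (PosNum d0).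
pose h : R := N.+1%:R^-1; have h0 : 0 < h by rewrite invr_gt0 ltr0n.
have E : rsum N (pd i f) =
    rsum N (fun x => pd i f x - h^-1 * (f (x + h *: delta_mx 0 i) - f x)).
  by rewrite rsumB rsumZ rsumB (rsum_shift N i f0) subrr mulr0 subr0.
rewrite sub0r normrN E /rsum normrM ger0_norm; last first.
  by rewrite invr_ge0 exprn_ge0.
have -> : e = rsum N (fun=> e / 4 ^+ n).
  by rewrite rsum_cst mulrC divfK // expf_neq0.
rewrite /rsum ler_wpM2l ?invr_ge0 ?exprn_ge0 //.
apply: le_trans (ler_norm_sum _ _ _) _; apply: ler_sum => j _.
have [t _|t /andP[t0 t1] ->] := @pd_mvt1 _ _ f (grid j) i h.
  exact: Ck_diff Cf _.
rewrite mulKf ?gt_eqF //; apply: H; first exact: grid_norm.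
rewrite addrAC subrr add0r normrZ; apply: le_lt_trans hd.
rewrite -[leRHS]mulr1; apply: ler_pM => //; last exact: norm_delta.
by rewrite normrM !gtr0_norm // ler_piMl // ltW.
Unshelve. all: by end_near. Qed.

Lemma null_add f g : null f -> null g -> null (fun x => f x + g x).
Proof.
move=> nf ng; rewrite /null -[0]addr0; under eq_fun do rewrite rsumD.
exact: cvgD.
Qed.

Lemma null_sum (I : finType) (F : I -> 'rV[R]_n -> R) :
  (forall i, null (F i)) -> null (fun x => \sum_i F i x).
Proof.
move=> nF; elim: (index_enum I) => [|a r IH].
  under eq_fun do rewrite big_nil.
  by rewrite /null; under eq_fun do rewrite rsum_cst mulr0; exact: cvg_cst.
by under eq_fun do rewrite big_cons; exact: null_add.
Qed.

(** About (d (N+1))^n points of the grid lie in the box of radius [d]. *)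
Lemma rsum_pos f x0 (c d : R) : (forall x, 0 <= f x) -> 0 < d -> 0 <= c ->
  `|x0| + d <= 1 -> (forall x, `|x - x0| <= d -> c <= f x) ->
  \forall N \near \oo, c * (d / 2) ^+ n <= rsum N f.
Proof.
move=> f0 d0 c0 x0d fc; have d20 : 0 < d / 2 by rewrite divr_gt0.
near=> N.
have : N.+1%:R^-1 < d / 2 by near: N; exact: near_infty_natSinv_lt (PosNum d20).
pose h : R := N.+1%:R^-1; have h0 : 0 < h by rewrite invr_gt0 ltr0n.
rewrite -/h => hd.
have N0 : 0 < N.+1%:R :> R by rewrite ltr0n.
(* [a i] is the index of the last grid value below the coordinate [x0 0 i], and
   [K] is the number of meshes in a segment of length [d]. *)
pose K := Num.trunc (d * N.+1%:R).
pose a (i : 'I_n) := Num.trunc ((x0 0 i + 2) * N.+1%:R).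
have x01 i : `|x0 0 i| <= 1 - d.
  by apply: le_trans (norm_coord x0 i) _; move: x0d; clear; move: `|x0| => ? ?; lra.
have aP i : (a i)%:R <= (x0 0 i + 2) * N.+1%:R < (a i)%:R + 1.
  rewrite natr1; apply: truncn_itv; rewrite mulr_ge0 //.
  move: (x01 i); rewrite ler_norml => /andP[+ _]; move: d0; clear; lra.
have KP : K%:R <= d * N.+1%:R < K%:R + 1.
  by rewrite natr1; apply: truncn_itv; rewrite mulr_ge0 // ltW.
have aK i (l : 'I_K) : (a i + l < side N)%N.
  rewrite -(ltr_nat R) natrD.
  have -> : (side N)%:R = 4 * N.+1%:R :> R by rewrite -natrM /side mulnS.
  have lK : l%:R <= K%:R :> R by rewrite ler_nat ltnW // ltn_ord.
  have /andP[a1 _] := aP i; have /andP[k1 _] := KP.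
  move: (x01 i); rewrite ler_norml => /andP[_ xi].
  apply: (@le_lt_trans _ _ ((x0 0 i + 2) * N.+1%:R + d * N.+1%:R)).
    by rewrite lerD // (le_trans lK).
  by rewrite -mulrDl ltr_pM2r //; move: xi; clear; lra.
pose inj (l : 'rV['I_K]_n) : gridT N := \row_i Ordinal (aK i (l 0 i)).
have injP : injective inj.
  move=> l l' /rowP E; apply/rowP => i; apply/val_inj.
  by have := E i; rewrite !mxE => /(congr1 val) /= /addnI.
have S1 : \sum_(l : 'rV['I_K]_n) f (grid (inj l)) <= \sum_(j : gridT N) f (grid j).
  rewrite [leRHS](bigID (mem (inj @: [set: 'rV['I_K]_n]%SET))) /= big_imset /=; last first.
    by move=> ? ? _ _; exact: injP.
  rewrite [X in X + _](eq_bigl xpredT); last by move=> ?; rewrite finset.inE.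
  by rewrite lerDl sumr_ge0.
have S2 : \sum_(l : 'rV['I_K]_n) c <= \sum_(l : 'rV['I_K]_n) f (grid (inj l)).
  apply: ler_sum => l _; apply: fc; apply: norm_rV_le; first exact: ltW.
  move=> i; rewrite !mxE /= natrD mulrDl.
  have lK : (l 0 i)%:R <= d * N.+1%:R.
    have /andP[k1 _] := KP; apply: le_trans k1.
    by rewrite ler_nat ltnW // ltn_ord.
  have l1 : (l 0 i)%:R / N.+1%:R <= d by rewrite ler_pdivrMr.
  have l2 : 0 <= (l 0 i)%:R / N.+1%:R :> R by rewrite divr_ge0.
  have /andP[a1 a2] := aP i.
  have a3 : (a i)%:R / N.+1%:R <= x0 0 i + 2 by rewrite ler_pdivrMr.
  have a4 : x0 0 i + 2 < (a i)%:R / N.+1%:R + h.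
    have -> : (a i)%:R / N.+1%:R + h = ((a i)%:R + 1) / N.+1%:R by rewrite mulrDl mul1r.
    by rewrite ltr_pdivlMr.
  move: l1 l2 a3 a4 hd d0; clear.
  move: ((l 0 i)%:R / N.+1%:R) ((a i)%:R / N.+1%:R) (x0 0 i) (h) => A B C D *.
  rewrite ler_norml; apply/andP; split; lra.
rewrite /rsum -ler_pdivrMl ?invr_gt0 ?exprn_gt0 // invrK.
apply: le_trans (le_trans S2 S1).
rewrite sumr_const card_mx card_ord mul1n -[c *+ _]mulr_natl [leRHS]mulrC.
rewrite mulrCA ler_wpM2l // natrX -exprMn.
apply: lerXn2r; rewrite ?nnegrE ?mulr_ge0 ?divr_ge0 //; try exact: ltW.
have /andP[_ k2] := KP.
have : 1 < (d / 2) * N.+1%:R by rewrite -ltr_pdivrMr // mul1r.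
move: k2; clear; nra.
Unshelve. all: by end_near. Qed.

End grid.

(** * Laplacian, Euler field and divergences *)

Section operators.
Context {R : realType} {n : nat}.
Implicit Types (f g u w : 'rV[R]_n -> R) (x : 'rV[R]_n) (i j : 'I_n).

Definition sq x : R := dot x x.
Definition lap f x : R := \sum_i pd i (pd i f) x.
Definition euler f x : R := \sum_i x 0 i * pd i f x.
Definition grad2 f x : R := \sum_i pd i f x * pd i f x.

Lemma sq_ge0 x : 0 <= sq x.
Proof. by apply: sumr_ge0 => i _; rewrite -expr2 sqr_ge0. Qed.

Lemma grad2_ge0 f x : 0 <= grad2 f x.
Proof. by apply: sumr_ge0 => i _; rewrite -expr2 sqr_ge0. Qed.

Lemma norm_sq x : `|x| ^+ 2 <= sq x.
Proof.
have : `|x| <= Num.sqrt (sq x).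
  apply: norm_rV_le => [|i]; first exact: sqrtr_ge0.
  rewrite -sqrtr_sqr ler_wsqrtr // /sq /dot (bigD1 i) //= expr2 lerDl.
  by apply: sumr_ge0 => j _; rewrite -expr2 sqr_ge0.
move=> h; have := lerXn2r 2 _ _ h; rewrite sqr_sqrtr ?sq_ge0 //; apply.
  exact: normr_ge0.
exact: sqrtr_ge0.
Qed.

Lemma sq_norm x : sq x <= n%:R * `|x| ^+ 2.
Proof.
rewrite /sq /dot; apply: (@le_trans _ _ (\sum_(i < n) `|x| ^+ 2)); last first.
  by rewrite sumr_const card_ord mulr_natl.
apply: ler_sum => i _; rewrite -expr2 -real_normK ?num_real //.
by apply: lerXn2r; rewrite ?nnegrE //; exact: norm_coord.
Qed.

Lemma sq_eq0 x : (sq x == 0) = (x == 0).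
Proof.
apply/eqP/eqP => [x0|->]; last by rewrite /sq /dot big1 // => i _; rewrite mxE mul0r.
apply/eqP; rewrite -normr_eq0 -sqrf_eq0; apply/eqP/le_anti.
by rewrite sqr_ge0 andbT -x0 norm_sq.
Qed.

Lemma sq0 : sq 0 = 0.
Proof. by apply/eqP; rewrite sq_eq0. Qed.

Lemma euler_at0 f : euler f 0 = 0.
Proof. by rewrite /euler big1 // => i _; rewrite mxE mul0r. Qed.

Lemma sq_gt0 x : (0 < sq x) = (x != 0).
Proof. by rewrite lt_neqAle sq_ge0 andbT eq_sym sq_eq0. Qed.

Lemma sq_ge1 x : 1 <= `|x| -> 1 <= sq x.
Proof. by move=> h; apply: le_trans (norm_sq x); rewrite exprn_ege1. Qed.

Lemma Ck_sq k V : open V -> Ck k V sq.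
Proof. by move=> oV; apply: Ck_sum => // i _; apply: Ck_mul => //; exact: Ck_coord. Qed.

Lemma open_sqlt (r : R) : open [set x : 'rV[R]_n | sq x < r].
Proof.
have -> : [set x : 'rV[R]_n | sq x < r] = sq @^-1` [set y | y < r] by [].
apply: open_comp => [x _|]; last exact: open_lt.
exact: Ck_cont (Ck_sq 0 openT) I.
Qed.

Lemma open_sqgt (r : R) : open [set x : 'rV[R]_n | r < sq x].
Proof.
have -> : [set x : 'rV[R]_n | r < sq x] = sq @^-1` [set y | r < y] by [].
apply: open_comp => [x _|]; last exact: open_gt.
exact: Ck_cont (Ck_sq 0 openT) I.
Qed.

Lemma diff_sq x : differentiable sq x.
Proof. exact: (Ck_diff (Ck_sq 1 openT)). Qed.

Lemma pd_sq i x : pd i sq x = 2 * x 0 i.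
Proof.
rewrite pd_sum => [|j _]; last by apply: differentiableM; exact: diff_coord.
rewrite (bigD1 i) //= big1 ?addr0 => [|j ji].
  by rewrite pd_mul ?pd_coord ?eqxx /=; try exact: diff_coord; ring.
rewrite pd_mul ?pd_coord; try exact: diff_coord.
by rewrite eq_sym (negPf ji) /=; ring.
Qed.

Lemma Ck_lap k V f : open V -> Ck k.+2 V f -> Ck k V (lap f).
Proof. by move=> oV Cf; apply: Ck_sum => // i _; exact: Ck_pd i (Ck_pd i Cf). Qed.

Lemma Ck_euler k V f : open V -> Ck k.+1 V f -> Ck k V (euler f).
Proof.
move=> oV Cf; apply: Ck_sum => // i _; apply: Ck_mul => //; first exact: Ck_coord.
exact: Ck_pd i Cf.
Qed.

Lemma Ck_grad2 k V f : open V -> Ck k.+1 V f -> Ck k V (grad2 f).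
Proof. by move=> oV Cf; apply: Ck_sum => // i _; apply: Ck_mul => //; exact: Ck_pd i Cf. Qed.

Lemma pd_euler V f i x : open V -> V x -> Ck 2 V f ->
  pd i (euler f) x = pd i f x + \sum_j x 0 j * pd i (pd j f) x.
Proof.
move=> oV Vx Cf; have dp j : differentiable (pd j f) x by exact: Ck_diff (Ck_pd j Cf) Vx.
rewrite pd_sum => [|j _]; last by apply: differentiableM => //; exact: diff_coord.
under eq_bigr => j _ do rewrite (pd_mul _ (diff_coord j x) (dp j)) pd_coord.
rewrite big_split /=; congr (_ + _).
rewrite (bigD1 i) //= eqxx mul1r big1 ?addr0 // => j ji.
by rewrite eq_sym (negPf ji) mul0r.
Qed.

Lemma pd_grad2 V f i x : V x -> Ck 2 V f ->
  pd i (grad2 f) x = 2 * \sum_j pd j f x * pd i (pd j f) x.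
Proof.
move=> Vx Cf; have dp j : differentiable (pd j f) x by exact: Ck_diff (Ck_pd j Cf) Vx.
rewrite pd_sum => [|j _]; last by exact: differentiableM.
rewrite mulr_sumr; apply: eq_bigr => j _; rewrite pd_mul //; ring.
Qed.

End operators.

Section divergence.
Context {R : realType} {n : nat}.
Implicit Types (f g u w : 'rV[R]_n -> R) (x : 'rV[R]_n) (i j : 'I_n).

(** [g] is a C^1 function of |x|^2 and [gr] is its derivative with respect to
|x|^2. *)
Definition radial g gr := Ck 1 setT g /\ forall x i, pd i g x = 2 * x 0 i * gr x.

(** The divergences of the fields [g f x] and, in [div_grad], [e f grad w]: these
are the two kinds of fields in the Carleman identity. *)
Lemma div_radial g gr f x : radial g gr -> Ck 1 setT f ->
  \sum_i pd i (fun z => g z * (z 0 i * f z)) x =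
  2 * sq x * gr x * f x + n%:R * g x * f x + g x * euler f x.
Proof.
move=> [Cg dg] Cf; have df := Ck_diff Cf I; have dgx := Ck_diff Cg I.
under eq_bigr => i _.
  rewrite pd_mul; [|exact: dgx|by apply: differentiableM; [exact: diff_coord|exact: df]].
  rewrite (pd_mul _ (diff_coord i x) (df x)) pd_coord eqxx mul1r dg.
  rewrite (_ : _ + _ = (2 * gr x * f x) * (x 0 i * x 0 i) + g x * f x + g x * (x 0 i * pd i f x)).
  over.
  by ring.
rewrite !big_split /= -!mulr_sumr sumr_const card_ord -[_ *+ n]mulr_natl.
rewrite -/(dot x x) -/(sq x) -/(euler f x); ring.
Qed.

Lemma div_grad e er f w x : radial e er -> Ck 1 setT f -> Ck 2 setT w ->
  \sum_i pd i (fun z => e z * (f z * pd i w z)) x =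
  2 * er x * f x * euler w x + e x * (\sum_i pd i f x * pd i w x) + e x * (f x * lap w x).
Proof.
move=> [Ce de] Cf Cw; have df := Ck_diff Cf I; have dex := Ck_diff Ce I.
have dw i : differentiable (pd i w) x by exact: Ck_diff (Ck_pd i Cw) I.
under eq_bigr => i _.
  rewrite pd_mul; [|exact: dex|by apply: differentiableM; [exact: df|exact: dw]].
  rewrite (pd_mul _ (df x) (dw i)) de.
  rewrite (_ : _ + _ = (2 * er x * f x) * (x 0 i * pd i w x) +
     e x * (pd i f x * pd i w x) + e x * (f x * pd i (pd i w) x)).
  over.
  by ring.
by rewrite !big_split /= -!mulr_sumr.
Qed.

Lemma null_div (F : 'I_n -> 'rV[R]_n -> R) : (forall i, Ck 1 setT (F i)) ->
  (forall i x, 1 <= `|x| -> F i x = 0) -> null (fun x => \sum_i pd i (F i) x).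
Proof. by move=> CF F0; apply: null_sum => i; apply: null_pd => // x; exact: F0. Qed.

Lemma euler_grad2 w x : Ck 2 setT w ->
  euler (grad2 w) x = 2 * \sum_i \sum_j x 0 i * pd j w x * pd i (pd j w) x.
Proof.
move=> Cw; rewrite /euler mulr_sumr; apply: eq_bigr => i _.
rewrite (pd_grad2 i I Cw) mulrCA; congr (_ * _); rewrite mulr_sumr.
by apply: eq_bigr => j _; ring.
Qed.

(** The symmetry of second derivatives enters the Carleman inequality here. *)
Lemma grad_euler w x : Ck 2 setT w ->
  \sum_i pd i (euler w) x * pd i w x = grad2 w x + euler (grad2 w) x / 2.
Proof.
move=> Cw; rewrite euler_grad2 // mulrAC divff // mul1r.
under eq_bigr => i _ do rewrite (pd_euler i openT I Cw) mulrDl mulr_suml.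
rewrite big_split /=; congr (_ + _); rewrite exchange_big /=.
apply: eq_bigr => i _; apply: eq_bigr => j _.
by rewrite (pdC j i openT I Cw); ring.
Qed.

Lemma eq0_pd (V : set 'rV[R]_n) f : open V -> (forall x, V x -> f x = 0) ->
  forall i x, V x -> pd i f x = 0.
Proof.
by move=> oV f0 i x Vx; rewrite (pd_open i oV Vx (g := fun=> 0)) ?pd_cst.
Qed.

End divergence.

(** * The Carleman inequality *)

Section radial_rules.
Context {R : realType} {n : nat}.
Implicit Types (f g fr gr : 'rV[R]_n -> R) (x : 'rV[R]_n).

Lemma radial_cst c : radial (fun _ : 'rV[R]_n => c) (fun=> 0).
Proof. by split=> [|x i]; [exact: Ck_cst|rewrite pd_cst mulr0]. Qed.

Lemma radial_add f fr g gr : radial f fr -> radial g gr ->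
  radial (fun x => f x + g x) (fun x => fr x + gr x).
Proof.
move=> [Cf df] [Cg dg]; split=> [|x i]; first exact: (Ck_add openT Cf Cg).
by rewrite (pd_add _ (Ck_diff Cf I) (Ck_diff Cg I)) df dg mulrDr.
Qed.

Lemma radial_mul f fr g gr : radial f fr -> radial g gr ->
  radial (fun x => f x * g x) (fun x => fr x * g x + f x * gr x).
Proof.
move=> [Cf df] [Cg dg]; split=> [|x i]; first exact: (Ck_mul openT Cf Cg).
by rewrite (pd_mul _ (Ck_diff Cf I) (Ck_diff Cg I)) df dg; ring.
Qed.

Lemma radial_scale c f fr : radial f fr ->
  radial (fun x => c * f x) (fun x => c * fr x).
Proof.
move=> [Cf df]; split=> [|x i]; first exact: (Ck_scale c openT Cf).
by rewrite (pd_scale c _ (Ck_diff Cf I)) df; ring.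
Qed.

Lemma radial_eq f fr g gr : radial f fr -> (forall x, f x = g x) ->
  (forall x, fr x = gr x) -> radial g gr.
Proof. by move=> + /funext <- /funext <-. Qed.

Lemma radial_sq : radial (@sq R n) (fun=> 1).
Proof. by split=> [|x i]; [exact: Ck_sq openT|rewrite pd_sq mulr1]. Qed.

(** The coefficients of the Carleman identity are polynomials in this function y;
the Euler field E maps it to -2 y (1 - y). *)
Definition inv1sq x : R := (1 + sq x)^-1.

Lemma inv1sq_neq0 x : 1 + sq x != 0.
Proof. by rewrite gt_eqF // ltr_wpDr // sq_ge0. Qed.

Lemma radial_inv1sq : radial inv1sq (fun x => - inv1sq x ^+ 2).
Proof.
have [C1 d1] := radial_add (radial_cst 1) radial_sq.
split=> [|x i]; first by apply: Ck_inv openT _ C1 => x _; exact: inv1sq_neq0.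
rewrite (pd_inv _ (inv1sq_neq0 x) (Ck_diff C1 I)) d1 /inv1sq -exprVn; ring.
Qed.

End radial_rules.

Section carleman.
Context {R : realType}.

Section coefficients.
Variables (n k beta : R).
Implicit Types y : R.

(** Conjugation of r^2 Lap + beta (E - 1) by the weight (1 + 1/r^2)^k gives
r^2 Lap + (b + 2) E + kappa, where b = [cb] and kappa = [ckappa] as functions of
y = 1/(1 + r^2); see [conj_opE]. Here [cb1] = E b and [cb2] = E E b. The operator
applied to w is multiplied by b E w + d w with d = [cd], and [ce] is the derivative
of r^2 d with respect to r^2. In the product, 2 [ca] is the coefficient of w E w
once the square 2 (b E w + (n b + b') w / 2)^2 is split off, where b' = E b, and
[c1] is the coefficient of w^2 left by the integration by parts. *)
Definition cb y := 4 * k * y + (beta - 2).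
Definition cb1 y := - (8 * k) * (y - y * y).
Definition cb2 y := 16 * k * ((1 - 2 * y) * (y - y * y)).
Definition cd y := n / 2 * cb y + cb1 y.
Definition ce y := cd y + (n / 2 * cb1 y + cb2 y) / 2.
Definition ckappa y :=
  cb1 y / 2 + (2 * k * y) * (2 * k * y) + (n - 2 + beta) * (2 * k * y) - beta.
Definition ca y := (cb y + 2) * cd y + ckappa y * cb y - cb y * (n * cb y + cb1 y).

(** Derivatives with respect to y. *)
Definition cb' y := 4 * k + 0 * y.
Definition cb1' y := - (8 * k) * (1 - 2 * y).
Definition cb2' y := 16 * k * ((1 - 2 * y) * (1 - 2 * y) - 2 * (y - y * y)).
Definition cd' y := n / 2 * cb' y + cb1' y.
Definition ce' y := cd' y + (n / 2 * cb1' y + cb2' y) / 2.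
Definition ckappa' y := cb1' y / 2 + 8 * k * k * y + (n - 2 + beta) * (2 * k).
Definition ca' y := cb' y * cd y + (cb y + 2) * cd' y + (ckappa' y * cb y + ckappa y * cb' y)
  - (cb' y * (n * cb y + cb1 y) + cb y * (n * cb' y + cb1' y)).

Definition c1 y := - (cb y * cb y * cb1 y) / 4
  - 32 * k * (((1 - 2 * y) * (1 - 2 * y) - 2 * (y - y * y)) * (y - y * y))
  - cb y * cb2 y / 2 - cb1 y * ((n - 2 + beta) * (n - 2 + beta) / 4 + beta)
  + 3 / 4 * n * n * cb1 y + 3 / 2 * n * cb2 y.

(** The multiplier method at one point, as an identity between real numbers: [rho]
stands for r^2, [Ew] for E w, [gn] for |grad w|^2, [EG] for E |grad w|^2 and [L]
for Lap w. The first four groups on the right are the divergences computed by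
[div_grad] and [div_radial], of the fields 2 h Ew grad w, - h |grad w|^2 x,
2 e w grad w and g w^2 x. *)
Lemma carleman_identity y rho Ew gn EG w L : y != 0 -> rho = (1 - y) / y ->
  let h := rho * cb y in let hr := cb y - rho * (y * y * cb' y) in
  let e := rho * cd y in let er := cd y - rho * (y * y * cd' y) in
  let g := ca y - 2 * ce y in let gr := - (y * y * (ca' y - 2 * ce' y)) in
  2 * (rho * L + (cb y + 2) * Ew + ckappa y * w) * (cb y * Ew + cd y * w) =
  (2 * (2 * hr * Ew * Ew + h * (gn + EG / 2) + h * (Ew * L))
   - (2 * rho * hr * gn + n * h * gn + h * EG)
   + 2 * (2 * er * w * Ew + e * gn + e * (w * L))
   + (2 * rho * gr * (w * w) + n * g * (w * w) + g * (2 * w * Ew)))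
  + 2 * (cb y * Ew + (n * cb y + cb1 y) / 2 * w) ^+ 2
  - 2 * cb1 y * Ew ^+ 2 - cb1 y * rho * gn + c1 y * w ^+ 2.
Proof.
move=> y0 -> /=.
rewrite /c1 /ca' /ckappa' /ce' /cd' /cb2' /cb1' /cb' /ca /ckappa /ce /cd /cb2 /cb1 /cb.
by field.
Qed.

(** The quadratic form left by [carleman_identity] controls the weighted norms of
[w] and of its gradient: - b' is at least 2 k rho, the coefficient [c1] is of
order k^3 rho, and the product of [G] with the multiplier is absorbed by the
squares, at the cost of b'^2 / 2 only, which is of order k^2 rho. *)
Lemma carleman_bound y rho Ew gn w G : 0 <= n -> 0 <= beta -> 8 + 2 * n <= k ->
  0 <= rho <= 1 -> y * (1 + rho) = 1 -> 0 <= gn ->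
  2 * k * rho ^+ 2 * gn + k ^+ 3 / 2 * rho * w ^+ 2 <=
  G ^+ 2 - 2 * G * (cb y * Ew + cd y * w) +
  2 * (cb y * Ew + (n * cb y + cb1 y) / 2 * w) ^+ 2
  - 2 * cb1 y * Ew ^+ 2 - cb1 y * rho * gn + c1 y * w ^+ 2.
Proof.
move=> n0 b0 kn /andP[r0 r1] yr g0.
(* s = rho y^2 is comparable to rho because 1/2 <= y <= 1. *)
pose s := y - y * y.
have y0 : 1 / 2 <= y by nra.
have y1 : y <= 1 by nra.
have sE : s = rho * y ^+ 2 by rewrite /s expr2; nra.
have s4 : rho / 4 <= s.
  rewrite sE; have : 1 / 4 <= y ^+ 2 by rewrite expr2; nra.
  by move=> h; have := ler_wpM2l r0 h; lra.
have s0 : 0 <= s by lra.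
have s14 : s <= 1 / 4 by rewrite /s; nra.
have k8 : 8 <= k by lra.
have b1E : cb1 y = - (8 * k * s) by rewrite /cb1 -/s mulNr.
have cbg : 2 * k - 2 <= cb y by rewrite /cb; nra.
have c1b : 8 * k * s * (k ^+ 2 / 2) <= c1 y.
  have -> : c1 y = 8 * k * s * (cb y ^+ 2 / 4 - 4 * (1 - 2 * y) ^+ 2 + 8 * s
     + cb y * (2 * y - 1) + (n - 2 + beta) ^+ 2 / 4 + beta - 3 / 4 * n ^+ 2
     - 3 * n * (2 * y - 1)).
    by rewrite /c1 b1E /cb2 -/s; field.
  apply: ler_wpM2l; first by rewrite !mulr_ge0 //; lra.
  have t1 : (k - 1) ^+ 2 <= cb y ^+ 2 / 4.
    have : (2 * k - 2) ^+ 2 <= cb y ^+ 2 by apply: lerXn2r; rewrite ?nnegrE; lra.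
    by rewrite (_ : (2 * k - 2) ^+ 2 = 4 * (k - 1) ^+ 2); [lra|ring].
  have t2 : (1 - 2 * y) ^+ 2 <= 1 by nra.
  have t3 : 0 <= cb y * (2 * y - 1) by apply: mulr_ge0; lra.
  have t4 : 0 <= (n - 2 + beta) ^+ 2 by exact: sqr_ge0.
  have t5 : n * (2 * y - 1) <= n by rewrite ler_piMr //; lra.
  have t6 : k ^+ 2 / 2 <= (k - 1) ^+ 2 - 4 - 3 / 4 * n ^+ 2 - 3 * n.
    by move: kn n0; clear -n k beta; nra.
  move: t1 t2 t3 t4 t5 t6 b0 s0; clear -n k beta.
  move: (cb y ^+ 2) ((1 - 2 * y) ^+ 2) (cb y * _) ((n - 2 + beta) ^+ 2) => A B C D.
  rewrite -!mulrA; move: (n * (2 * y - 1)) (n ^+ 2) ((k - 1) ^+ 2) (k ^+ 2) => E F H I; lra.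
(* The multiplier is A + b' w / 2, where A is the expression whose square is the
   third term; the squares of G - 2 A and G - b' w complete the form. *)
have AM : 0 <= G ^+ 2 - 2 * G * (cb y * Ew + cd y * w) +
  2 * (cb y * Ew + (n * cb y + cb1 y) / 2 * w) ^+ 2 + (cb1 y) ^+ 2 / 2 * w ^+ 2.
  have -> : cb y * Ew + cd y * w =
     (cb y * Ew + (n * cb y + cb1 y) / 2 * w) + cb1 y / 2 * w.
    by rewrite /cd; field.
  set A := (cb y * Ew + (_ / 2 * w)); move: A (cb1 y) => A B.
  rewrite (_ : _ + _ = (G - 2 * A) ^+ 2 / 2 + (G - B * w) ^+ 2 / 2); last by field.
  by rewrite addr_ge0 // mulr_ge0 ?sqr_ge0 // invr_ge0.
have E0 : 0 <= - 2 * cb1 y * Ew ^+ 2.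
  rewrite b1E; have : 0 <= k * s * Ew ^+ 2 by apply: mulr_ge0 (mulr_ge0 _ s0) (sqr_ge0 _); lra.
  move=> ?; have -> : - 2 * - (8 * k * s) * Ew ^+ 2 = 16 * (k * s * Ew ^+ 2) by ring.
  by rewrite mulr_ge0.
have G0 : 2 * k * rho ^+ 2 * gn <= - cb1 y * rho * gn.
  rewrite b1E opprK; apply: ler_wpM2r => //.
  have : k * (rho / 4) <= k * s by apply: ler_wpM2l => //; lra.
  by move=> h; have := ler_wpM2r r0 h; rewrite expr2; lra.
have W0 : k ^+ 3 / 2 * rho * w ^+ 2 <= (c1 y - (cb1 y) ^+ 2 / 2) * w ^+ 2.
  apply: ler_wpM2r; first exact: sqr_ge0.
  have q1 : (cb1 y) ^+ 2 / 2 <= 8 * k * s * k.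
    rewrite b1E; have : k * s * (k * s) <= k * s * (k * (1 / 4)).
      by apply: ler_wpM2l; [rewrite mulr_ge0 //; lra|apply: ler_wpM2l => //; lra].
    by rewrite expr2; lra.
  have q2 : 8 * k * s * (k ^+ 2 / 4 + k) <= 8 * k * s * (k ^+ 2 / 2).
    apply: ler_wpM2l; first by rewrite !mulr_ge0 //; lra.
    by move: k8; clear -n k beta; nra.
  have q3 : 2 * k ^+ 3 * (rho / 4) <= 2 * k ^+ 3 * s.
    by apply: ler_wpM2l => //; rewrite mulr_ge0 // exprn_ge0 //; lra.
  have q4 : 8 * k * s * (k ^+ 2 / 4 + k) = 2 * k ^+ 3 * s + 8 * k * s * k by field.
  move: c1b q1 q2 q3 q4; clear -n k beta.
  move: (c1 y) ((cb1 y) ^+ 2) (8 * k * s * (k ^+ 2 / 2)) (8 * k * s * k) (8 * k * s * (k ^+ 2 / 4 + k)).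
  move: (k ^+ 3) => K A B C D E; lra.
move: AM E0 G0 W0; clear -n k beta; rewrite !expr2; lra.
Qed.

End coefficients.
End carleman.

Section radial_y.
Context {R : realType} {n : nat}.
Implicit Types F G : R -> R.

(** [F'] is the derivative of [F]: the chain rule for [F (inv1sq x)]. *)
Definition radial_y F F' := @radial R n (fun x => F (inv1sq x)) (fun x => - (inv1sq x * inv1sq x * F' (inv1sq x))).

Lemma radial_y_id : radial_y id (fun=> 1).
Proof. by apply: radial_eq radial_inv1sq _ _ => // x; rewrite expr2 mulr1. Qed.

Lemma radial_y_cst c : radial_y (fun=> c) (fun=> 0).
Proof. by apply: radial_eq (radial_cst c) _ _ => // x; rewrite mulr0 oppr0. Qed.

Lemma radial_y_add F F' G G' : radial_y F F' -> radial_y G G' ->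
  radial_y (fun y => F y + G y) (fun y => F' y + G' y).
Proof. by move=> rF rG; apply: radial_eq (radial_add rF rG) _ _ => // x; ring. Qed.

Lemma radial_y_mul F F' G G' : radial_y F F' -> radial_y G G' ->
  radial_y (fun y => F y * G y) (fun y => F' y * G y + F y * G' y).
Proof. by move=> rF rG; apply: radial_eq (radial_mul rF rG) _ _ => // x; ring. Qed.

Lemma radial_y_scale c F F' : radial_y F F' ->
  radial_y (fun y => c * F y) (fun y => c * F' y).
Proof. by move=> rF; apply: radial_eq (radial_scale c rF) _ _ => // x; ring. Qed.

Lemma radial_y_eq F F' G G' : radial_y F F' -> (forall y, F y = G y) ->
  (forall y, F' y = G' y) -> radial_y G G'.
Proof. by move=> + /funext <- /funext <-. Qed.

Lemma radial_sq_mul F F' : radial_y F F' ->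
  @radial R n (fun x => sq x * F (inv1sq x)) (fun x => F (inv1sq x) - sq x * (inv1sq x * inv1sq x * F' (inv1sq x))).
Proof. by move=> rF; apply: radial_eq (radial_mul radial_sq rF) _ _ => // x; ring. Qed.

Variables (m k beta : R).
Let q y : R := y - y * y.

Lemma radial_q : radial_y q (fun y => 1 - 2 * y).
Proof.
apply: radial_y_eq (radial_y_add radial_y_id
  (radial_y_scale (-1) (radial_y_mul radial_y_id radial_y_id))) _ _ => y /=; rewrite /q; ring.
Qed.

Lemma radial_cb : radial_y (cb k beta) (cb' k).
Proof.
apply: radial_y_eq (radial_y_add (radial_y_scale (4 * k) radial_y_id)
  (radial_y_cst (beta - 2))) _ _ => y //=; rewrite /cb'; ring.
Qed.

Lemma radial_cb1 : radial_y (cb1 k) (cb1' k).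
Proof. exact: radial_y_scale radial_q. Qed.

Lemma radial_cb2 : radial_y (cb2 k) (cb2' k).
Proof.
apply: radial_y_eq (radial_y_scale (16 * k) (radial_y_mul (radial_y_add (radial_y_cst 1)
  (radial_y_scale (-2) radial_y_id)) radial_q)) _ _ => y; rewrite /cb2 /cb2' /q; ring.
Qed.

Lemma radial_cd : radial_y (cd m k beta) (cd' m k).
Proof. exact: radial_y_add (radial_y_scale _ radial_cb) radial_cb1. Qed.

Lemma radial_ce : radial_y (ce m k beta) (ce' m k).
Proof.
apply: radial_y_eq (radial_y_add radial_cd (radial_y_scale (2^-1)
  (radial_y_add (radial_y_scale (m / 2) radial_cb1) radial_cb2))) _ _ => y;
  by rewrite /ce /ce' mulrC.
Qed.

Lemma radial_ckappa : radial_y (ckappa m k beta) (ckappa' m k beta).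
Proof.
have r2 := radial_y_scale (2 * k) radial_y_id.
apply: radial_y_eq (radial_y_add (radial_y_add (radial_y_add
  (radial_y_scale (2^-1) radial_cb1) (radial_y_mul r2 r2))
  (radial_y_scale (m - 2 + beta) r2)) (radial_y_cst (- beta))) _ _ => y;
  by rewrite /ckappa /ckappa' /=; field.
Qed.

Lemma radial_ca : radial_y (ca m k beta) (ca' m k beta).
Proof.
have rb := radial_cb; have rd := radial_cd; have rk := radial_ckappa.
apply: radial_y_eq (radial_y_add (radial_y_add
    (radial_y_mul (radial_y_add rb (radial_y_cst 2)) rd) (radial_y_mul rk rb))
  (radial_y_scale (-1) (radial_y_mul rb (radial_y_add (radial_y_scale m rb) radial_cb1)))) _ _ => y;
  by rewrite /ca /ca' /=; ring.
Qed.

Lemma radial_cg : radial_y (fun y => ca m k beta y - 2 * ce m k beta y)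
  (fun y => ca' m k beta y - 2 * ce' m k y).
Proof.
apply: radial_y_eq (radial_y_add radial_ca (radial_y_scale (-2) radial_ce)) _ _ => y;
  by rewrite mulNr.
Qed.

End radial_y.

Section carleman.
Context {R : realType} {n : nat}.
Variables (k beta : R) (w : 'rV[R]_n -> R).
Hypothesis Cw : Ck 2 setT w.

(** The operator [model_op beta] conjugated by the k-th power of [weight]. *)
Definition conj_op (k beta : R) (w : 'rV[R]_n -> R) (x : 'rV[R]_n) : R :=
  sq x * lap w x + (cb k beta (inv1sq x) + 2) * euler w x + ckappa n%:R k beta (inv1sq x) * w x.

(** The term [N] is the divergence of a compactly supported field: the inequality is
to be read after integration, when [N] disappears. *)
Lemma carleman (r : R) : 0 <= beta -> 8 + 2 * n%:R <= k -> r < 1 ->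
  (forall x, r <= sq x -> w x = 0) ->
  exists2 N : 'rV[R]_n -> R, null N & forall x,
    2 * k * sq x ^+ 2 * grad2 w x + k ^+ 3 / 2 * sq x * w x ^+ 2 + N x <= conj_op k beta w x ^+ 2.
Proof.
move=> b0 kn r1 w0.
pose y := @inv1sq R n; pose nn : R := n%:R.
pose h x := sq x * cb k beta (y x).
pose e x := sq x * cd nn k beta (y x).
pose g x := ca nn k beta (y x) - 2 * ce nn k beta (y x).
have rh := radial_sq_mul (radial_cb k beta); move: (rh n) => {}rh.
have re := radial_sq_mul (radial_cd nn k beta); move: (re n) => {}re.
have rg := radial_cg nn k beta; move: (rg n) => {}rg.
have Ch := proj1 rh; have Ce := proj1 re; have Cg := proj1 rg.
have C1w : Ck 1 setT w := CkW Cw.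
have Cp i : Ck 1 setT (pd i w) := Ck_pd i Cw.
have Cx i : Ck 1 setT (fun x : 'rV[R]_n => x 0 i) := Ck_coord 1 setT i.
have CE : Ck 1 setT (euler w) := Ck_euler openT Cw.
have CG : Ck 1 setT (grad2 w) := Ck_grad2 openT Cw.
have Cww : Ck 1 setT (fun x => w x * w x) by exact: (Ck_mul openT C1w C1w).
have oV := @open_sqgt R n r.
have wo x : r < sq x -> w x = 0 by move=> rx; exact/w0/ltW.
have po i x : r < sq x -> pd i w x = 0 by exact: (eq0_pd oV wo).
have ppo i x : r < sq x -> pd i (pd i w) x = 0 by exact: (eq0_pd oV (@po i)).
have Eo x : r < sq x -> euler w x = 0.
  by move=> rx; rewrite /euler big1 // => i _; rewrite po ?mulr0.
have Go x : r < sq x -> grad2 w x = 0.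
  by move=> rx; rewrite /grad2 big1 // => i _; rewrite po ?mulr0.
have Lo x : r < sq x -> lap w x = 0.
  by move=> rx; rewrite /lap big1 // => i _; rewrite ppo.
have out x : 1 <= `|x| -> r < sq x by move=> /sq_ge1; exact: lt_le_trans.
(* The sum of the four fields of [carleman_identity]. *)
pose F i x := 2 * (h x * (euler w x * pd i w x)) - h x * (x 0 i * grad2 w x) +
  2 * (e x * (w x * pd i w x)) + g x * (x 0 i * (w x * w x)).
have Ci (a f p : 'rV[R]_n -> R) : Ck 1 setT a -> Ck 1 setT f -> Ck 1 setT p ->
    Ck 1 setT (fun x => a x * (f x * p x)).
  by move=> Ca Cf Cpp; exact: (Ck_mul openT Ca (Ck_mul openT Cf Cpp)).
have CF1 i := Ci _ _ _ Ch CE (Cp i).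
have CF2 i := Ci _ _ _ Ch (Cx i) CG.
have CF3 i := Ci _ _ _ Ce C1w (Cp i).
have CF4 i := Ci _ _ _ Cg (Cx i) Cww.
have C12 i := Ck_sub2 openT (Ck_scale 2 openT (CF1 i)) (CF2 i).
have C123 i := Ck_add openT (C12 i) (Ck_scale 2 openT (CF3 i)).
have CF i : Ck 1 setT (F i) := Ck_add openT (C123 i) (CF4 i).
have F0 i x : 1 <= `|x| -> F i x = 0.
  by move=> /out rx; rewrite /F wo // Eo // Go // !(mul0r, mulr0) subrr !addr0.
exists (fun x => \sum_i pd i (F i) x); first exact: null_div.
have dv x : \sum_i pd i (F i) x =
  2 * (\sum_i pd i (fun z => h z * (euler w z * pd i w z)) x)
  - \sum_i pd i (fun z => h z * (z 0 i * grad2 w z)) x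
  + 2 * (\sum_i pd i (fun z => e z * (w z * pd i w z)) x)
  + \sum_i pd i (fun z => g z * (z 0 i * (w z * w z))) x.
  rewrite !mulr_sumr -sumrB -!big_split /=; apply: eq_bigr => i _.
  have D1 := Ck_diff (CF1 i) (I : setT x); have D2 := Ck_diff (CF2 i) (I : setT x).
  have D3 := Ck_diff (CF3 i) (I : setT x); have D4 := Ck_diff (CF4 i) (I : setT x).
  have S1 := Ck_diff (Ck_scale 2 openT (CF1 i)) (I : setT x).
  have S3 := Ck_diff (Ck_scale 2 openT (CF3 i)) (I : setT x).
  have S12 := Ck_diff (C12 i) (I : setT x); have S123 := Ck_diff (C123 i) (I : setT x).
  by rewrite (pd_add _ S123 D4) (pd_add _ S12 S3) (pd_sub _ S1 D2) !pd_scale.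
have Eww x : euler (fun z => w z * w z) x = 2 * w x * euler w x.
  rewrite /euler mulr_sumr; apply: eq_bigr => i _.
  by rewrite (pd_mul _ (Ck_diff C1w I) (Ck_diff C1w I)); ring.
move=> x; rewrite dv (div_grad x rh CE Cw) (div_radial x rh CG) (div_grad x re C1w Cw).
rewrite (div_radial x rg Cww) grad_euler // Eww.
have -> : \sum_i pd i w x * pd i w x = grad2 w x by [].
have [x1|x1] := leP (sq x) 1; last first.
  have rx : r < sq x := lt_trans r1 x1.
  have EG0 : euler (grad2 w) x = 0.
    by rewrite /euler big1 // => i _; rewrite (eq0_pd oV Go) ?mulr0.
  rewrite EG0 /conj_op wo // Eo // Go // Lo //.
  by rewrite !(mul0r, mulr0, addr0, subr0, expr0n).
have yn : y x != 0 by rewrite invr_eq0 inv1sq_neq0.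
have yr : y x * (1 + sq x) = 1 by rewrite mulVf // inv1sq_neq0.
have rE : sq x = (1 - y x) / y x.
  by rewrite -[X in X - _]yr mulrDr mulr1 addrAC subrr add0r mulrAC divff ?mul1r.
have Id := @carleman_identity R nn k beta (y x) (sq x) (euler w x) (grad2 w x)
  (euler (grad2 w) x) (w x) (lap w x) yn rE.
have Bd := @carleman_bound R nn k beta (y x) (sq x) (euler w x) (grad2 w x) (w x)
  (conj_op k beta w x) (ler0n _ _) b0 kn _ yr (grad2_ge0 w x).
have x01 : 0 <= sq x <= 1 by rewrite sq_ge0.
have fin (L Nf A2 GM q1 q2 q3 q4 : R) : GM = Nf + q1 - q2 - q3 + q4 ->
    L <= A2 - GM + q1 - q2 - q3 + q4 -> L + Nf <= A2.
  by clear; lra.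
exact: fin Id (Bd x01).
Qed.

End carleman.

(** * Functions vanishing to infinite order at the origin *)

Section flat.
Context {R : realType} {n : nat}.
Implicit Types (f g : 'rV[R]_n -> R) (x : 'rV[R]_n) (i : 'I_n) (V : set 'rV[R]_n).

(** Vanishing to infinite order at 0. The estimate is uniform on the part of [V] in
the unit ball, so that flat functions combine on a fixed domain. *)
Definition flat0 V f := forall N : nat, exists2 C : R, 0 <= C &
  forall x, V x -> sq x <= 1 -> `|f x| <= C * sq x ^+ N.

(** Flatness of [f] and of its derivatives up to order [j]. *)
Fixpoint Flat (j : nat) V f : Prop :=
  flat0 V f /\
  match j with
  | 0%N => forall x, V x -> {for x, continuous f}
  | j'.+1 => (forall x, V x -> differentiable f x) /\ (forall i, Flat j' V (pd i f))
  end.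

Lemma Flat_Ck j V f : Flat j V f -> Ck j V f.
Proof.
elim: j f => [|j IH] f /=; first by case.
by move=> [_ [df Ff]]; split => // i; exact: IH (Ff i).
Qed.

Lemma Flat_flat0 j V f : Flat j V f -> flat0 V f.
Proof. by case: j => [|j] []. Qed.

Lemma FlatW j V f : Flat j.+1 V f -> Flat j V f.
Proof.
elim: j f => [|j IH] f [ff [df Ff]]; split => //.
  by move=> x Vx; exact/differentiable_continuous/df.
by split=> // i; exact: IH (Ff i).
Qed.

Lemma flat0_ext V f g : (forall x, V x -> f x = g x) -> flat0 V f -> flat0 V g.
Proof.
by move=> fg ff N; have [C C0 H] := ff N; exists C => // x Vx; rewrite -fg //; exact: H.
Qed.

Lemma Flat_ext j V f g : open V -> (forall x, V x -> f x = g x) ->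
  Flat j V f -> Flat j V g.
Proof.
move=> oV; elim: j f g => [|j IH] f g fg [ff Ff]; split; try exact: flat0_ext ff.
  exact: (@Ck_ext _ _ 0%N V f g).
have [df Df] := Ff; split=> [x Vx|i].
  by apply: (diff_near _ (df x Vx)); exact: (open_near oV Vx fg).
by apply: IH (Df i) => x Vx; exact: (pd_open _ oV).
Qed.

Lemma flat0_add V f g : flat0 V f -> flat0 V g -> flat0 V (fun x => f x + g x).
Proof.
move=> ff fg N; have [C C0 H] := ff N; have [D D0 K] := fg N.
exists (C + D) => [|x Vx x1]; first exact: addr_ge0.
by rewrite mulrDl (le_trans (ler_normD _ _)) // lerD // ?H ?K.
Qed.

Lemma Flat_add j V f g : open V -> Flat j V f -> Flat j V g -> Flat j V (fun x => f x + g x).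
Proof.
move=> oV; elim: j f g => [|j IH] f g [ff Ff] [fg Fg]; split; try exact: flat0_add.
  by move=> x Vx; exact: continuousD (Ff x Vx) (Fg x Vx).
have [df Df] := Ff; have [dg Dg] := Fg; split=> [x Vx|i].
  by apply: differentiableD; [exact: df|exact: dg].
apply: Flat_ext (IH _ _ (Df i) (Dg i)) => // x Vx.
by rewrite pd_add //; [exact: df|exact: dg].
Qed.

Lemma flat0_scale V c f : flat0 V f -> flat0 V (fun x => c * f x).
Proof.
move=> ff N; have [C C0 H] := ff N; exists (`|c| * C) => [|x Vx x1].
  exact: mulr_ge0.
by rewrite normrM -mulrA ler_wpM2l // H.
Qed.

Lemma Flat_scale j V c f : open V -> Flat j V f -> Flat j V (fun x => c * f x).
Proof.
move=> oV; elim: j f => [|j IH] f [ff Ff]; split; try exact: flat0_scale.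
  exact: (@Ck_scale _ _ 0%N V c f).
have [df Df] := Ff; split=> [x Vx|i].
  by apply: differentiableM; [exact: differentiable_cst|exact: df].
apply: Flat_ext (IH _ (Df i)) => // x Vx.
by rewrite pd_scale //; exact: df.
Qed.

Lemma coord_le1 x i : sq x <= 1 -> `|x 0 i| <= 1.
Proof.
move=> x1; apply: le_trans (norm_coord x i) _.
by rewrite -(@ler_pXn2r _ 2) ?nnegrE // expr1n (le_trans (norm_sq x)).
Qed.

Lemma Flat_coord j V f k : open V -> Flat j V f -> Flat j V (fun x => x 0 k * f x).
Proof.
have F0 (g : 'rV[R]_n -> R) : flat0 V g -> flat0 V (fun x => x 0 k * g x).
  move=> ff N; have [C C0 H] := ff N; exists C => // x Vx x1.
  rewrite normrM (le_trans _ (H x Vx x1)) // ler_piMl //; exact: coord_le1.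
move=> oV; elim: j f => [|j IH] f Ff; split; try exact/F0/Flat_flat0/Ff.
  by apply: (@Ck_mul _ _ 0%N V _ f) => //; [exact: Ck_coord|case: Ff].
have [ff [df Df]] := Ff; split=> [x Vx|i].
  by apply: differentiableM; [exact: diff_coord|exact: df].
apply: Flat_ext (Flat_add oV (Flat_scale (i == k)%:R oV (FlatW Ff)) (IH _ (Df i))) => // x Vx.
by rewrite (pd_mul _ (diff_coord k x) (df x Vx)) pd_coord.
Qed.

Lemma flat0_0 V f : V 0 -> flat0 V f -> f 0 = 0.
Proof.
move=> V0 /(_ 1%N) [C C0 /(_ 0 V0)].
rewrite sq0.
by rewrite expr1 mulr0 normr_le0 => /(_ ler01) /eqP.
Qed.

Lemma sq_diff0 g (C : R) : 0 <= C -> (forall x, sq x <= 1 -> `|g x| <= C * sq x) ->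
  differentiable g 0 /\ forall i, pd i g 0 = 0.
Proof.
move=> C0 H.
have s0 := @sq0 R n.
have g0 : g 0 = 0.
  by apply/eqP; rewrite -normr_le0 (le_trans (H 0 _)) // s0 ?mulr0 // ler01.
pose M := C * n%:R + n%:R + 1.
have nn : 0 <= n%:R :> R by [].
have Cn : 0 <= C * n%:R by exact: mulr_ge0.
have M0 : 0 < M by rewrite /M; lra.
have [dg dE] : differentiable g 0 /\ 'd g 0 = (\0 : 'rV[R]_n -> R) :> ('rV[R]_n -> R).
  apply: diff_eps => [|eps e0]; first exact: cst_continuous.
  pose r := Num.min 1 eps / M.
  have r0 : 0 < r by rewrite divr_gt0 // lt_min ltr01.
  apply/nbhs_ballP; exists r => //= h; rewrite -ball_normE /= sub0r normrN => hr.
  rewrite addr0 g0 !subr0.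
  have h0 := normr_ge0 h.
  have rM : `|h| * M <= Num.min 1 eps by rewrite -ler_pdivlMr //; exact: ltW.
  have [rM1 rM2] : `|h| * M <= 1 /\ `|h| * M <= eps.
    by move: rM; rewrite le_min => /andP[].
  have hM1 : `|h| * (n%:R + 1) <= 1.
    by apply: le_trans rM1; apply: ler_wpM2l => //; rewrite /M; lra.
  have hM2 : `|h| * (C * n%:R) <= eps.
    by apply: le_trans rM2; apply: ler_wpM2l => //; rewrite /M; lra.
  have h1 : `|h| <= 1 by apply: le_trans hM1; rewrite ler_peMr //; lra.
  have sh : sq h <= 1.
    apply: le_trans (sq_norm h) _; rewrite expr2 mulrA.
    apply: (@le_trans _ _ (`|h| * (n%:R + 1) * 1)); last by rewrite mulr1.
    have nh : n%:R * `|h| <= `|h| * (n%:R + 1).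
      by rewrite mulrC; apply: ler_wpM2l => //; lra.
    exact: ler_pM (mulr_ge0 nn h0) h0 nh h1.
  apply: le_trans (H h sh) _.
  apply: (@le_trans _ _ (C * (n%:R * `|h| ^+ 2))).
    by apply: ler_wpM2l => //; exact: sq_norm.
  have -> : C * (n%:R * `|h| ^+ 2) = `|h| * (C * n%:R) * `|h| by ring.
  exact: ler_wpM2r.
by split=> // i; transitivity ('d g 0 (delta_mx 0 i)); [rewrite -deriveE|rewrite dE].
Qed.

(** The decay of a flat function removes the singularity of 1/|x|^2 together with
those of its derivatives. *)
Lemma Flat_div j f : Flat j setT f -> Flat j setT (fun x => f x / sq x).
Proof.
have F0 (g : 'rV[R]_n -> R) : flat0 setT g -> flat0 setT (fun x => g x / sq x).
  move=> fg N; have [C C0 H] := fg N.+1; exists C => // x Vx x1.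
  have [->|x0] := eqVneq x 0.
    by rewrite (flat0_0 _ fg) // mul0r normr0 mulr_ge0 // exprn_ge0 // sq_ge0.
  have s0 : 0 < sq x by rewrite sq_gt0.
  rewrite normrM normfV (ger0_norm (sq_ge0 x)) ler_pdivrMr // -mulrA -exprSr.
  exact: H.
have D0 (g : 'rV[R]_n -> R) : flat0 setT g ->
    differentiable (fun x => g x / sq x) 0 /\ forall i, pd i (fun x => g x / sq x) 0 = 0.
  move=> fg; have [C C0 H] := F0 g fg 1%N; apply: sq_diff0 C0 _ => x x1.
  by have := H x I x1; rewrite expr1.
elim: j f => [|j IH] f Ff; split; try exact/F0/Flat_flat0/Ff.
  move=> x _; have [->|x0] := eqVneq x 0.
    by apply: differentiable_continuous; exact: (D0 f (Flat_flat0 Ff)).1.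
  apply: continuousM; first by case: Ff => _; exact.
  apply: continuousV; first by rewrite sq_eq0.
  exact: differentiable_continuous (diff_sq x).
have [ff [df Df]] := Ff; split=> [x _|i].
  have [->|x0] := eqVneq x 0; first exact: (D0 f ff).1.
  apply: differentiableM; first exact: df.
  by apply: diff_inv; [rewrite sq_eq0|exact: diff_sq].
have H := IH _ (IH _ (FlatW Ff)).
apply: (Flat_ext openT _
  (Flat_add openT (IH _ (Df i)) (Flat_scale (-2) openT (Flat_coord i openT H)))).
move=> x _; have [->|x0] := eqVneq x 0.
  by rewrite (D0 f ff).2 mxE mul0r mulr0 addr0 (flat0_0 _ (Flat_flat0 (Df i))) // mul0r.
have s0 : sq x != 0 by rewrite sq_eq0.
have ds := diff_inv s0 (diff_sq x).
rewrite (pd_mul _ (df x I) ds) (pd_inv _ s0 (diff_sq x)) pd_sq.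
by move: (pd i f x) (f x) (x 0 i) (sq x) s0 => a b c s s0; field.
Qed.

Lemma cont_bounded f (r : R) : (forall x, `|x| <= r -> {for x, continuous f}) ->
  exists2 M, 0 <= M & forall x, `|x| <= r -> `|f x| <= M.
Proof.
move=> cf; have [r0|r0] := leP 0 r; last first.
  by exists 0 => // x xr; move: (lt_le_trans r0 (le_trans (normr_ge0 x) xr)); rewrite ltxx.
have [|||c _ H] := @EVT_max_rV R n (fun x => `|f x|) [set x | `|x| <= r].
- by exists 0; rewrite /= normr0.
- exact: compact_box.
- apply: continuous_in_subspaceT => x; rewrite inE => xr.
  apply: (@continuous_comp _ _ _ f (fun t : R => `|t|)); last exact: norm_continuous.
  exact: cf.
by exists `|f c| => // x xr; apply: H; rewrite inE.
Qed.

(** Away from the origin |x|^2 is bounded below, and any bound for [f] is a bound by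
a multiple of a power of |x|^2. *)
Lemma Flat_local j f (r : R) : 0 < r -> Ck j setT f ->
  Flat j [set x | sq x < r] f -> Flat j setT f.
Proof.
move=> r0; have F0 g : Ck 0 setT g -> flat0 [set x | sq x < r] g -> flat0 setT g.
  move=> Cg fg N; have [C C0 H] := fg N.
  have [|M M0 HM] := @cont_bounded g 1; first by move=> x _; exact: Cg.
  have rN : 0 < r ^+ N by exact: exprn_gt0.
  exists (C + M / r ^+ N) => [|x _ x1]; first by rewrite addr_ge0 // divr_ge0 // ltW.
  have sN : 0 <= sq x ^+ N by rewrite exprn_ge0 // sq_ge0.
  rewrite mulrDl; have [xr|xr] := ltP (sq x) r.
    by apply: le_trans (H x xr x1) _; rewrite lerDl mulr_ge0 // divr_ge0 // ltW.
  apply: (@le_trans _ _ M).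
    by apply: HM; rewrite -(@ler_pXn2r _ 2) ?nnegrE // expr1n (le_trans (norm_sq x)).
  apply: (@le_trans _ _ (M / r ^+ N * sq x ^+ N)); last by rewrite lerDr mulr_ge0.
  rewrite mulrAC ler_pdivlMr // ler_wpM2l //.
  by apply: lerXn2r; rewrite ?nnegrE ?sq_ge0 // ltW.
elim: j f => [|j IH] f Cf Ff.
  by split; [exact: F0 Cf (Flat_flat0 Ff)|exact: Cf].
split; first exact: F0 (Ck_le _ Cf) (Flat_flat0 Ff).
have [df Df] := Cf; split => // i; apply: IH; first exact: Df.
by case: Ff => _ [_]; exact.
Qed.

Lemma Ck_union k V W f : Ck k V f -> Ck k W f -> Ck k (V `|` W) f.
Proof.
elim: k f => [|k IH] f.
  by move=> cV cW x [Vx|Wx]; [exact: cV|exact: cW].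
move=> [dV DV] [dW DW]; split=> [x [Vx|Wx]|i]; [exact: dV|exact: dW|].
exact: IH (DV i) (DW i).
Qed.

End flat.

(** * Cutoff and conjugation by the weight *)

Section cutoff.
Context {R : realType} {n : nat}.
Implicit Types (f g : 'rV[R]_n -> R) (x : 'rV[R]_n) (i : 'I_n) (V : set 'rV[R]_n).

Definition pospart (t : R) : R := Num.max 0 t.

Lemma pospart_ge0 t : 0 <= pospart t. Proof. by rewrite le_max lexx. Qed.

Lemma diff_c (c : R) x : differentiable (fun _ : 'rV[R]_n => c) x.
Proof. exact: differentiable_cst. Qed.

Lemma diff_mul f g x : differentiable f x -> differentiable g x ->
  differentiable (fun y => f y * g y) x.
Proof. exact: differentiableM. Qed.

Lemma diff_exp f x m : differentiable f x -> differentiable (fun y => f y ^+ m) x.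
Proof.
move=> df; elim: m => [|m IH].
  by rewrite (_ : (fun y => _) = cst 1); [exact: differentiable_cst|apply/funext => y; rewrite expr0].
rewrite (_ : (fun y => _) = (fun y => f y * f y ^+ m)); first exact: differentiableM.
by apply/funext => y; rewrite exprS.
Qed.

Lemma pd_exp f i x m : differentiable f x ->
  pd i (fun y => f y ^+ m.+1) x = m.+1%:R * f x ^+ m * pd i f x.
Proof.
move=> df; elim: m => [|m IH].
  by rewrite expr0 !mul1r; congr (pd i _ x); apply/funext => y; rewrite expr1.
rewrite (_ : (fun y => f y ^+ m.+2) = (fun y => f y * f y ^+ m.+1)); last first.
  by apply/funext => y; rewrite exprS.
rewrite (pd_mul _ df (diff_exp _ df)) IH -[m.+2]addn1 natrD [f x ^+ m.+1]exprS; ring.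
Qed.

(** At a zero of [f] the power is of second order in [f], hence has derivative 0. *)
Lemma pospart_comp f x m : differentiable f x ->
  differentiable (fun y => pospart (f y) ^+ m.+2) x /\
  forall i, pd i (fun y => pospart (f y) ^+ m.+2) x = m.+2%:R * pospart (f x) ^+ m.+1 * pd i f x.
Proof.
move=> df; have cf := differentiable_continuous df.
have [fx|fx|fx] := ltgtP (f x) 0.
- have nr : \forall y \near x, 0 = pospart (f y) ^+ m.+2.
    have : \forall y \near x, f y < 0 by exact: (cf _ (lt_nbhsl fx)).
    by apply: filterS => y fy; rewrite /pospart max_l ?expr0n // ltW.
  split; first exact: (diff_near nr (differentiable_cst _ _)).
  by move=> i; rewrite -(pd_near i nr) pd_cst /pospart max_l ?ltW // expr0n mulr0 mul0r.
- have nr : \forall y \near x, f y ^+ m.+2 = pospart (f y) ^+ m.+2.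
    have : \forall y \near x, 0 < f y by exact: (cf _ (lt_nbhsr fx)).
    by apply: filterS => y fy; rewrite /pospart max_r // ltW.
  split; first exact: (diff_near nr (diff_exp _ df)).
  by move=> i; rewrite -(pd_near i nr) pd_exp // /pospart max_r // ltW.
have [dp pE] : differentiable (fun t : R => pospart t ^+ m.+2) (f x) /\
    'd (fun t : R => pospart t ^+ m.+2) (f x) = (\0 : R -> R) :> (R -> R).
  rewrite fx; apply: diff_eps => [|eps e0]; first exact: cst_continuous.
  have r0 : 0 < Num.min 1 eps by rewrite lt_min ltr01.
  apply/nbhs_ballP; exists (Num.min 1 eps) => //= h.
  rewrite -ball_normE /= sub0r normrN lt_min => /andP[h1 he].
  rewrite addr0 /pospart maxxx expr0n /= !subr0.
  have ph : 0 <= Num.max 0 h <= `|h|.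
    by rewrite le_max lexx /= ge_max normr_ge0 ler_norm.
  have /andP[p0 p1] := ph.
  rewrite ger0_norm ?exprn_ge0 // exprSr; apply: ler_pM => //; first exact: exprn_ge0.
  rewrite exprS; apply: (@le_trans _ _ (Num.max 0 h)); last exact/(le_trans p1)/ltW.
  by rewrite ler_piMr // exprn_ile1 // (le_trans p1) // ltW.
split; first exact: (@differentiable_comp _ _ _ _ f (fun t : R => pospart t ^+ m.+2)).
move=> i; rewrite fx /pospart maxxx expr0n mulr0 mul0r.
transitivity ('d ((fun t : R => pospart t ^+ m.+2) \o f) x (delta_mx 0 i)).
  by rewrite -deriveE //; exact: differentiable_comp.
by rewrite diff_comp //= pE.
Qed.

Lemma Ck_pospart k m V f : open V -> (k <= m)%N -> Ck k V f ->
  Ck k V (fun x => pospart (f x) ^+ m.+1).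
Proof.
move=> oV; elim: k m f => [|k IH] m f km Cf.
  apply: (@Ck_exp _ _ 0%N V (fun x => pospart (f x))) => // x Vx.
  by apply: continuous_max; [exact: cst_continuous|exact: Cf].
case: m km => // m km; have [df Df] := Cf; split=> [x Vx|i].
  by have [] := pospart_comp m (df x Vx).
have H := Ck_mul oV (Ck_scale m.+2%:R oV (IH m f km (CkW Cf))) (Df i).
by apply: (Ck_ext oV _ H) => x Vx; have [_ ->] := pospart_comp m (df x Vx).
Qed.

(** Equal to 1 for |x|^2 <= r/4 and to 0 for |x|^2 >= r/2. The cube of a positive
part is of class C^2. *)
Definition cutoff (r : R) x : R := pospart (1 - 8 * pospart (2 / r * sq x - 1 / 2) ^+ 3) ^+ 3.

Lemma Ck_cutoff r : Ck 2 setT (cutoff r).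
Proof.
have C1 := Ck_sub2 openT (Ck_scale (2 / r) openT (@Ck_sq R n 2 _ openT)) (Ck_cst 2 setT (1 / 2)).
have C2 := Ck_scale 8 openT (Ck_pospart openT (leqnn 2) C1).
exact: Ck_pospart openT (leqnn 2) (Ck_sub2 openT (Ck_cst 2 setT 1) C2).
Qed.

Lemma cutoff1 r x : 0 < r -> sq x <= r / 4 -> cutoff r x = 1.
Proof.
move=> r0 xr; rewrite /cutoff /pospart [Num.max 0 (_ - 1 / 2)]max_l.
  by rewrite expr0n mulr0 subr0 max_r // expr1n.
by rewrite subr_le0 mulrAC ler_pdivrMr //; lra.
Qed.

Lemma cutoff0 r x : 0 < r -> r / 2 <= sq x -> cutoff r x = 0.
Proof.
move=> r0 xr.
have t1 : 1 / 2 <= 2 / r * sq x - 1 / 2.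
  suff : 1 <= 2 / r * sq x by lra.
  by rewrite mulrAC ler_pdivlMr //; lra.
have t2 : 1 / 2 <= pospart (2 / r * sq x - 1 / 2) by rewrite le_max t1 orbT.
rewrite /cutoff {1}/pospart max_l ?expr0n // subr_le0.
have : (1 / 2) ^+ 3 <= pospart (2 / r * sq x - 1 / 2) ^+ 3.
  by apply: lerXn2r; rewrite ?nnegrE // pospart_ge0.
move: (pospart _ ^+ 3) => q; have -> : (1 / 2) ^+ 3 = 1 / 8 :> R by field.
lra.
Qed.

End cutoff.

Section conjugation.
Context {R : realType} {n : nat}.
Implicit Types (f g u v w : 'rV[R]_n -> R) (x : 'rV[R]_n) (i : 'I_n).

(** The Carleman weight. As it decreases with |x|, its large powers favour a small
ball over the region where the cutoff varies. *)
Definition weight x : R := 1 + (sq x)^-1.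

(** The leading part r^2 Lap + beta (E - 1) of the equation of a graph: [beta] is
[alpha] at the origin, and 0 at the other points. *)
Definition model_op (beta : R) u x : R := sq x * lap u x + beta * (euler u x - u x).

Definition punctured : set 'rV[R]_n := [set x | x != 0].

Lemma open_punctured : open punctured.
Proof.
rewrite (_ : punctured = [set x | 0 < sq x]); first exact: open_sqgt.
by apply/seteqP; split => x /=; rewrite sq_gt0.
Qed.

Lemma Ck_weight k : Ck k punctured weight.
Proof.
apply: (Ck_add open_punctured (Ck_cst _ _ _)); apply: (Ck_inv open_punctured) => [x x0|].
  by rewrite sq_eq0.
exact: Ck_sq open_punctured.
Qed.

(** The gradient of [weight ^+ k] is - [weight ^+ k] times [wslope k x] times x. *)
Definition wslope (k : nat) x : R := 2 * k%:R * inv1sq x / sq x.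

Lemma pd_weight k i x : x != 0 ->
  pd i (fun z => weight z ^+ k) x = - (weight x ^+ k * wslope k x * x 0 i).
Proof.
move=> x0; have s0 : sq x != 0 by rewrite sq_eq0.
have y0 := inv1sq_neq0 x.
have dw : differentiable weight x by exact: Ck_diff (Ck_weight 1) x0.
case: k => [|k].
  rewrite /wslope mulr0 !mul0r mulr0 mul0r oppr0.
  rewrite (_ : (fun z => _) = fun=> 1) ?pd_cst //.
rewrite pd_exp // [in RHS]exprS /weight (pd_add _ (differentiable_cst _ _) (diff_inv s0 (diff_sq x))).
rewrite pd_cst (pd_inv _ s0 (diff_sq x)) pd_sq /wslope /inv1sq.
move: s0 y0; move: (k.+1%:R : R) (x 0 i) => c b.
move: ((1 + (sq x)^-1) ^+ k) (sq x) => a s s0 y0; field.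
by apply/andP.
Qed.

Lemma pd_wslope k i x : x != 0 ->
  differentiable (wslope k) x /\ pd i (wslope k) x = 2 * x 0 i * (- (2 * k%:R) * (inv1sq x ^+ 2 / sq x + inv1sq x / sq x ^+ 2)).
Proof.
move=> x0; have s0 : sq x != 0 by rewrite sq_eq0.
have [Cy dy] := @radial_inv1sq R n; have dyx := Ck_diff Cy (I : setT x).
have ds := diff_inv s0 (diff_sq x).
have dky := diff_mul (diff_c (2 * k%:R) x) dyx.
split; first exact: diff_mul dky ds.
rewrite /wslope (pd_mul _ dky ds) (pd_scale _ _ dyx) dy (pd_inv _ s0 (diff_sq x)) pd_sq.
move: (x 0 i) (sq x) (inv1sq x) (k%:R : R) s0 => a s y c s0. by field.
Qed.

Variables (k : nat) (beta : R) (v : 'rV[R]_n -> R).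
Hypothesis Cv : Ck 2 setT v.
Let w x := weight x ^+ k * v x.

Lemma pd_conj i x : x != 0 -> pd i w x = weight x ^+ k * pd i v x - wslope k x * (x 0 i * w x).
Proof.
move=> x0; have dw : differentiable (fun z => weight z ^+ k) x.
  exact: Ck_diff (Ck_exp k open_punctured (Ck_weight 1)) x0.
rewrite (pd_mul _ dw (Ck_diff Cv (I : setT x))) pd_weight // /w; ring.
Qed.

Lemma euler_conj x : x != 0 ->
  euler w x = weight x ^+ k * euler v x - wslope k x * sq x * w x.
Proof.
move=> x0; rewrite /euler; under eq_bigr => i _.
  rewrite pd_conj // (_ : _ * _ = weight x ^+ k * (x 0 i * pd i v x) -
    wslope k x * w x * (x 0 i * x 0 i)); first over.
  by ring.
by rewrite sumrB -!mulr_sumr -/(dot x x) -/(sq x); ring.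
Qed.

Lemma lap_conj x : x != 0 ->
  lap w x = weight x ^+ k * lap v x - wslope k x * (weight x ^+ k * euler v x) -
   (2 * sq x * (- (2 * k%:R) * (inv1sq x ^+ 2 / sq x + inv1sq x / sq x ^+ 2)) * w x +
    n%:R * wslope k x * w x + wslope k x * euler w x).
Proof.
move=> x0; have op := open_punctured; have s0 : sq x != 0 by rewrite sq_eq0.
have Cw : Ck 2 punctured w.
  apply: (Ck_mul op (Ck_exp k op (Ck_weight 2))).
  exact: Ck_sub _ Cv.
have dwk : differentiable (fun z => weight z ^+ k) x.
  exact: Ck_diff (Ck_exp k op (Ck_weight 1)) x0.
have dwx := Ck_diff Cw x0.
have dv i : differentiable (pd i v) x := Ck_diff (Ck_pd i Cv) (I : setT x).
have E i : pd i (pd i w) x = weight x ^+ k * pd i (pd i v) x -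
    wslope k x * (weight x ^+ k * (x 0 i * pd i v x)) -
   (2 * (- (2 * k%:R) * (inv1sq x ^+ 2 / sq x + inv1sq x / sq x ^+ 2)) * w x * (x 0 i * x 0 i) +
     wslope k x * w x + wslope k x * (x 0 i * pd i w x)).
  have [dc Ec] := pd_wslope k i x0.
  have dxw := diff_mul (diff_coord i x) dwx.
  rewrite (pd_open i op x0 (g := fun x => weight x ^+ k * pd i v x - wslope k x * (x 0 i * w x))).
    rewrite (pd_sub _ (diff_mul dwk (dv i)) (diff_mul dc dxw)).
    rewrite (pd_mul _ dwk (dv i)) pd_weight // (pd_mul _ dc dxw) Ec.
    by rewrite (pd_mul _ (diff_coord i x) dwx) pd_coord eqxx /=; ring.
  by move=> y; exact: pd_conj.
rewrite [LHS](eq_bigr _ (fun i _ => E i)) [lap v x]/lap.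
rewrite !sumrB !big_split /= -!mulr_sumr sumr_const card_ord -[_ *+ n]mulr_natl.
rewrite -/(euler v x) -/(euler w x) -/(dot x x) -/(sq x) /w; ring.
Qed.

Lemma conj_opE x : x != 0 ->
  conj_op k%:R beta w x = weight x ^+ k * model_op beta v x.
Proof.
move=> x0; have s0 : sq x != 0 by rewrite sq_eq0.
rewrite /conj_op lap_conj // euler_conj // /model_op /w /wslope /ckappa /cb /cb1 /inv1sq.
have y0 := inv1sq_neq0 x.
move: (weight x ^+ k) (lap v x) (euler v x) (v x) (sq x) s0 y0 => a b c d s s0 y0.
by field; apply/andP.
Qed.

(** With w = weight^k v, the vector weight^k grad v is grad w + wslope w x, where
|x|^2 wslope <= 2 k. *)
Lemma grad2_conj x : x != 0 ->
  sq x * (weight x ^+ k) ^+ 2 * grad2 v x <= 2 * sq x * grad2 w x + 8 * k%:R ^+ 2 * w x ^+ 2.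
Proof.
move=> x0; have s0 : 0 < sq x by rewrite sq_gt0.
have y0 : 0 <= inv1sq x by rewrite invr_ge0 addr_ge0 // sq_ge0.
have y1 : inv1sq x <= 1 by rewrite invf_le1 ?lerDl ?sq_ge0 // ltr_wpDr // sq_ge0.
have H : (weight x ^+ k) ^+ 2 * grad2 v x <= 2 * grad2 w x + 2 * (wslope k x * w x) ^+ 2 * sq x.
  rewrite /grad2 /sq /dot !mulr_sumr -big_split /=; apply: ler_sum => i _.
  rewrite pd_conj //; move: (weight x ^+ k) (pd i v x) (wslope k x) (w x) (x 0 i).
  move=> W a c b t; rewrite -subr_ge0.
  rewrite (_ : _ - _ = (W * a - 2 * (c * (t * b))) ^+ 2); last by ring.
  exact: sqr_ge0.
have cs : wslope k x * sq x = 2 * k%:R * inv1sq x by rewrite /wslope divfK // gt_eqF.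
rewrite -mulrA; apply: le_trans (ler_wpM2l (ltW s0) H) _.
rewrite mulrDr [sq x * (2 * _)]mulrCA mulrA lerD2l.
have -> : sq x * (2 * (wslope k x * w x) ^+ 2 * sq x) = 2 * (wslope k x * sq x) ^+ 2 * w x ^+ 2 by ring.
rewrite cs; apply: ler_wpM2r; first exact: sqr_ge0.
have -> : 2 * (2 * k%:R * inv1sq x) ^+ 2 = 8 * k%:R ^+ 2 * inv1sq x ^+ 2 by ring.
by rewrite ler_piMr ?exprn_ile1 // mulr_ge0 // sqr_ge0.
Qed.

End conjugation.

(** * Strong unique continuation *)

Section local_operators.
Context {R : realType} {n : nat}.
Implicit Types (f g : 'rV[R]_n -> R) (x : 'rV[R]_n) (V : set 'rV[R]_n).

Lemma euler_open V f g x : open V -> V x -> (forall y, V y -> f y = g y) -> euler f x = euler g x.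
Proof. by move=> oV Vx fg; apply: eq_bigr => i _; rewrite (pd_open i oV Vx fg). Qed.

Lemma grad2_open V f g x : open V -> V x -> (forall y, V y -> f y = g y) -> grad2 f x = grad2 g x.
Proof. by move=> oV Vx fg; apply: eq_bigr => i _; rewrite (pd_open i oV Vx fg). Qed.

Lemma lap_open V f g x : open V -> V x -> (forall y, V y -> f y = g y) -> lap f x = lap g x.
Proof.
move=> oV Vx fg; apply: eq_bigr => i _; apply: (pd_open i oV Vx) => y Vy.
exact: (pd_open i oV Vy fg).
Qed.

Lemma model_op_open beta V f g x : open V -> V x -> (forall y, V y -> f y = g y) ->
  model_op beta f x = model_op beta g x.
Proof.
by move=> oV Vx fg; rewrite /model_op (lap_open oV Vx fg) (euler_open oV Vx fg) fg.
Qed.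

Lemma Flat_sub j V V' f : V' `<=` V -> Flat j V f -> Flat j V' f.
Proof.
move=> s; elim: j f => [|j IH] f /= [ff Ff].
  split=> [N|x /s]; last exact: Ff.
  by have [C C0 H] := ff N; exists C => // x /s; exact: H.
split=> [N|]; first by have [C C0 H] := ff N; exists C => // x /s; exact: H.
by have [df Df] := Ff; split=> [x /s|i]; [exact: df|exact: IH (Df i)].
Qed.

Lemma model_op_bounded beta (r : R) f : 0 < r < 1 -> Ck 2 setT f -> (forall x, r <= sq x -> f x = 0) ->
  exists2 M, 0 <= M & forall x, model_op beta f x ^+ 2 <= M.
Proof.
move=> /andP[r0 r1] Cf f0.
have CP : Ck 0 setT (model_op beta f).
  apply: (Ck_add openT (Ck_mul openT (Ck_sq _ openT) (Ck_lap openT Cf))).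
  apply: (Ck_scale _ openT (Ck_sub2 openT _ (Ck_le _ Cf))) => //.
  exact: Ck_euler openT (CkW Cf).
have [|M M0 HM] := @cont_bounded _ _ (model_op beta f) 1; first by move=> x _; exact: CP.
exists (M ^+ 2) => [|x]; first exact: sqr_ge0.
have [x1|x1] := leP `|x| 1.
  by rewrite -real_normK ?num_real // lerXn2r ?nnegrE // HM.
have rx : r < sq x by apply: lt_le_trans r1 _; exact/sq_ge1/ltW.
rewrite (model_op_open beta (@open_sqgt R n r) rx (g := fun=> 0)) => [|y /ltW]; last exact: f0.
rewrite /model_op /lap /euler big1 => [|i _].
  rewrite big1 => [|i _]; last by rewrite pd_cst mulr0.
  by rewrite subr0 !mulr0 addr0 expr0n sqr_ge0.
by rewrite (_ : pd i (fun=> 0) = fun=> 0) ?pd_cst //; apply/funext => y; rewrite pd_cst.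
Qed.

End local_operators.

Section unique_continuation.
Context {R : realType} {n : nat}.

(** For large [k] the lower bound of the Carleman inequality beats the right-hand
side of the differential inequality: the gradient term needs k >= C, and the
zeroth order term k^3 >= C k^2. *)
Lemma absorb_lower_order (C k s g w N W2 P2 gv v2 : R) : 0 <= C -> 36 * C <= k -> 1 <= k -> 0 <= s -> 0 <= g ->
  P2 <= C * s * (s * gv + v2) -> w ^+ 2 = W2 * v2 -> 0 <= W2 ->
  s * W2 * gv <= 2 * s * g + 8 * k ^+ 2 * w ^+ 2 ->
  2 * k * s ^+ 2 * g + k ^+ 3 / 2 * s * w ^+ 2 + N <= W2 * P2 ->
  k ^+ 3 / 4 * (s * w ^+ 2) + N <= 0.
Proof.
move=> C0 kC k1 s0 g0 HP wE W0 Hg Hc.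
have t1 : W2 * P2 <= C * s * (2 * s * g + (8 * k ^+ 2 + 1) * w ^+ 2).
  apply: le_trans (ler_wpM2l W0 HP) _.
  rewrite (_ : W2 * _ = C * s * (s * W2 * gv + W2 * v2)); last by ring.
  rewrite -wE; apply: ler_wpM2l; first exact: mulr_ge0.
  by move: Hg; clear; lra.
have sg0 : 0 <= s ^+ 2 * g by rewrite mulr_ge0 // sqr_ge0.
have t2 : C * (s ^+ 2 * g) <= k * (s ^+ 2 * g) by apply: ler_wpM2r => //; lra.
have sw0 : 0 <= s * w ^+ 2 by rewrite mulr_ge0 // sqr_ge0.
have t3 : C * (8 * k ^+ 2 + 1) <= k ^+ 3 / 4.
  have k2 : 1 <= k ^+ 2 by rewrite exprn_ege1.
  apply: (@le_trans _ _ (C * (9 * k ^+ 2))); first by apply: ler_wpM2l => //; lra.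
  have := ler_wpM2r (ltW (lt_le_trans ltr01 k2)) kC; rewrite exprSr; lra.
have t4 := ler_wpM2r sw0 t3.
move: t1 t2 t4 Hc; rewrite mulrDr.
move: (W2 * P2) => A.
rewrite (_ : C * s * (2 * s * g) = 2 * (C * (s ^+ 2 * g))); last by ring.
rewrite (_ : C * s * ((8 * k ^+ 2 + 1) * w ^+ 2) = C * (8 * k ^+ 2 + 1) * (s * w ^+ 2)); last by ring.
rewrite (_ : 2 * k * s ^+ 2 * g = 2 * (k * (s ^+ 2 * g))); last by ring.
rewrite (_ : k ^+ 3 / 2 * s * w ^+ 2 = 2 * (k ^+ 3 / 4 * (s * w ^+ 2))); last by field.
move: (C * (s ^+ 2 * g)) (C * (8 * k ^+ 2 + 1) * (s * w ^+ 2)) (k * (s ^+ 2 * g)) (k ^+ 3 / 4 * (s * w ^+ 2)).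
clear; move=> a b c d; lra.
Qed.

(** [weight ^+ k] times [v], written as an iteration so that [Flat_div] applies to
it at the origin. *)
Definition weighted (v : 'rV[R]_n -> R) (k : nat) : 'rV[R]_n -> R :=
  iter k (fun f x => f x / sq x + f x) v.

Lemma weighted_Flat v k : Flat 2 setT v -> Flat 2 setT (weighted v k).
Proof.
move=> Fv; elim: k => [|k IH]; first exact: Fv.
have H1 := Flat_div IH; have H2 := Flat_add openT H1 IH; exact: H2.
Qed.

Lemma weightedE v k x : weighted v k x = weight x ^+ k * v x.
Proof.
elim: k => [|k IH]; first by rewrite mul1r.
rewrite /weighted iterS -/(weighted v k) IH exprS /weight; ring.
Qed.

(** Apply the Carleman inequality to weight^k times a cutoff of [u]. Where the cutoff
is 1 the differential inequality lets the lower order terms be absorbed; elsewhere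
the weight is at most its value w0 at |x|^2 = r/4. After division by w0^(2k), the
mean of |x|^2 u^2 over the small ball is O(k^-3), for every large k. *)
Lemma strong_unique_continuation (u : 'rV[R]_n -> R) (r C beta : R) : 0 < r < 1 -> 0 <= beta -> 0 <= C ->
  Flat 2 [set x | sq x < r] u ->
  (forall x, sq x < r -> model_op beta u x ^+ 2 <= C * sq x * (sq x * grad2 u x + u x ^+ 2)) ->
  forall x, sq x < r / 4 -> u x = 0.
Proof.
move=> /andP[r0 r1] b0 C0 Fu Hu.
have r40 : 0 < r / 4 by rewrite divr_gt0.
pose v x := cutoff r x * u x.
have Cu := Flat_Ck Fu.
have vu x : sq x < r / 4 -> v x = u x by move=> xr; rewrite /v cutoff1 ?mul1r // ltW.
have v0 x : r / 2 <= sq x -> v x = 0 by move=> xr; rewrite /v cutoff0 ?mul0r.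
have Cv : Ck 2 setT v.
  have CV : Ck 2 [set x | sq x < r] v.
    by apply: (Ck_mul (@open_sqlt R n r) _ Cu); apply: Ck_sub (Ck_cutoff _).
  have CW : Ck 2 [set x | r / 2 < sq x] v.
    by apply: (Ck_ext (@open_sqgt R n _) _ (Ck_cst 2 _ 0)) => x /ltW /v0 ->.
  apply: Ck_sub (Ck_union CV CW) => x _ /=; have [|xr] := ltP (sq x) r; first by left.
  by right; apply: lt_le_trans xr; lra.
have Fv : Flat 2 setT v.
  apply: (Flat_local r40 Cv); apply: (Flat_ext (@open_sqlt R n _) (f := u)).
    by move=> x /vu.
  by apply: Flat_sub Fu => x /= xr; apply: lt_trans xr _; lra.
have [M M0 HM] := @model_op_bounded R n beta (r / 2) v ltac:(apply/andP; lra) Cv v0.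
pose f x := if sq x < r / 4 then sq x * u x ^+ 2 else 0.
have f0 x : 0 <= f x.
  by rewrite /f; case: ifP => // _; rewrite mulr_ge0 ?sq_ge0 // sqr_ge0.
(* The value of [weight] on the sphere |x|^2 = r/4. *)
pose w0 : R := 1 + (r / 4)^-1.
have w01 : 1 <= w0 by rewrite lerDl invr_ge0 ltW.
have w0p : 0 <= w0 := le_trans ler01 w01.
pose K0 := 8 + 2 * n%:R + 36 * C.
have main (k : nat) : K0 <= k%:R ->
    \forall N \near \oo, k%:R ^+ 3 / 4 * rsum N f <= 4 ^+ n * M + 1.
  move=> kK; pose kr : R := k%:R.
  have nn : 0 <= n%:R :> R by [].
  have kn : 8 + 2 * n%:R <= kr by rewrite /kr; apply: le_trans kK; rewrite /K0; lra.
  have kC : 36 * C <= kr by rewrite /kr; apply: le_trans kK; rewrite /K0; lra.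
  have k1 : 1 <= kr by lra.
  have kr0 : 0 <= kr by lra.
  have Fw := weighted_Flat k Fv; have Cw := Flat_Ck Fw.
  have wo x : r / 2 <= sq x -> weighted v k x = 0 by move=> xr; rewrite weightedE v0 // mulr0.
  have [N nN HN] := carleman Cw b0 kn (ltac:(lra) : r / 2 < 1) wo.
  pose D := (w0 ^+ k) ^+ 2.
  have D1 : 1 <= D by rewrite /D !exprn_ege1.
  have D0 : 0 < D by exact: lt_le_trans ltr01 D1.
  have pt x : kr ^+ 3 / 4 * D * f x + N x <= D * M.
    have DM : 0 <= D * M by rewrite mulr_ge0 // ltW.
    have wf0 : weighted v k 0 = 0 by exact: flat0_0 (Flat_flat0 Fw).
    have := HN x; rewrite /f.
    have [->|x0] := eqVneq x 0.
      have s0 := @sq0 R n.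
      rewrite /conj_op wf0 s0 r40 !(mul0r, mulr0, expr0n, addr0, add0r).
      rewrite euler_at0 !(mul0r, mulr0, expr0n, addr0, add0r) /= ?mulr0 ?mul0r ?add0r => h.
      exact: le_trans h DM.
    have s0 : 0 < sq x by rewrite sq_gt0.
    have we : weighted v k = fun y => weight y ^+ k * v y by apply/funext => y; exact: weightedE.
    rewrite we conj_opE // (exprMn 2 _ (model_op beta v x)).
    have G0 := grad2_ge0 (fun x => weight x ^+ k * v x) x.
    have Wp : 0 <= weight x by rewrite addr_ge0 // invr_ge0 ltW.
    have [xr|xr] := ltP (sq x) (r / 4) => Hc.
      have gc := grad2_conj k Cv x0.
      have xr' : sq x < r by apply: lt_trans xr _; lra.
      have PE : model_op beta v x = model_op beta u x := model_op_open beta (@open_sqlt R n _) xr vu.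
      have GE : grad2 v x = grad2 u x := grad2_open (@open_sqlt R n _) xr vu.
      have HP := Hu x xr'; rewrite -PE -GE -vu // in HP.
      have Z := absorb_lower_order C0 kC k1 (ltW s0) G0 HP (exprMn 2 _ _) (sqr_ge0 _) gc Hc.
      apply: le_trans DM; apply: le_trans Z; rewrite lerD2r -mulrA.
      apply: ler_wpM2l; first by rewrite divr_ge0 // exprn_ge0 // ler0n.
      rewrite mulrCA; apply: ler_wpM2l; first exact: ltW.
      rewrite exprMn vu //; apply: ler_wpM2r; first exact: sqr_ge0.
      rewrite /D -!exprM; apply: lerXn2r; rewrite ?nnegrE //.
      by rewrite /w0 /weight lerD2l lef_pV2 ?posrE // ltW.
    rewrite mulr0 add0r.
    have le1 : N x <= (weight x ^+ k) ^+ 2 * model_op beta v x ^+ 2.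
      apply: le_trans Hc; rewrite lerDr addr_ge0 //.
        by apply: mulr_ge0 (mulr_ge0 (mulr_ge0 _ kr0) (sqr_ge0 _)) G0.
      by apply: mulr_ge0 (mulr_ge0 (divr_ge0 (exprn_ge0 3 kr0) _) (ltW s0)) (sqr_ge0 _).
    apply: le_trans le1 _; apply: ler_pM; rewrite ?sqr_ge0 // /D -!exprM.
    apply: lerXn2r; rewrite ?nnegrE //.
    by rewrite /w0 /weight lerD2l lef_pV2 ?posrE.
  have /cvgrPdist_le /(_ _ D0) nN' := nN.
  near=> m.
  have rN : `|0 - rsum m N| <= D by near: m.
  have : rsum m (fun x => kr ^+ 3 / 4 * D * f x + N x) <= @rsum R n m (fun=> D * M).
    exact: rsum_le.
  rewrite rsumD rsumZ rsum_cst; move: rN; rewrite sub0r normrN ler_norml => /andP[rN _] h.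
  rewrite -(ler_pM2l D0) -/kr.
  move: rN h; move: (rsum m N) (rsum m f) (kr ^+ 3) (4 ^+ n) => a b c d h1 h2.
  by move: h1 h2; clear; lra.
(* If u x0 were not 0, the means of f would be bounded below, against [main]. *)
move=> x0 xr; apply/eqP/negP => /negP u0.
have x00 : x0 != 0.
  apply: contra u0 => /eqP ->; apply/eqP; apply: flat0_0 (Flat_flat0 Fu).
  have s0 := @sq0 R n.
  by rewrite /= s0.
pose g x := sq x * u x ^+ 2.
have g0 : 0 < g x0 by rewrite mulr_gt0 ?sq_gt0 // exprn_even_gt0.
have cg : {for x0, continuous g}.
  have o := @open_sqlt R n (r / 4).
  apply: (Ck_cont (k := 0) (V := [set x | sq x < r / 4])) => //.
  apply: (Ck_mul o (Ck_sq _ o) (Ck_exp _ o _)); apply: (Ck_le (l := 2)) => //.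
  by apply: Ck_sub Cu => x /= x4; apply: lt_trans x4 _; lra.
have [d d0 Hd] : exists2 d : R, 0 < d & forall x, `|x - x0| < d -> sq x < r / 4 /\ g x0 / 2 <= g x.
  have g2 : 0 < g x0 / 2 by rewrite divr_gt0.
  have /cvgrPdist_lt /(_ _ g2) /nbhs_ballP[d1 d10 H1] := cg.
  have [d2 d20 H2] := open_ball (@open_sqlt R n (r / 4)) xr.
  exists (Num.min d1 d2); first by rewrite lt_min d10.
  move=> x; rewrite lt_min => /andP[x1 x2]; split; first exact: H2.
  have : `|g x0 - g x| < g x0 / 2 by apply: H1; rewrite -ball_normE /= distrC.
  rewrite ltr_norml => /andP[_]; move: (g x0) (g x); clear; move=> a b; lra.
pose dd := Num.min (d / 2) (1 / 2).
have dd0 : 0 < dd by rewrite lt_min !divr_gt0.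
have ddd : dd < d by rewrite gt_min; apply/orP; left; lra.
have x1 : `|x0| + dd <= 1.
  have : `|x0| <= 1 / 2.
    rewrite -(@ler_pXn2r _ 2) ?nnegrE //; apply: le_trans (norm_sq x0) _.
    have -> : (1 / 2) ^+ 2 = 1 / 4 :> R by field.
    by move: xr r1; clear; lra.
  have : dd <= 1 / 2 by rewrite ge_min lexx orbT.
  by clear; lra.
have g20 : 0 <= g x0 / 2 by rewrite divr_ge0 // ltW.
have gf x : `|x - x0| <= dd -> g x0 / 2 <= f x.
  by move=> xd; have [] := Hd x (le_lt_trans xd ddd); rewrite /f => ->.
have low := rsum_pos f0 dd0 g20 x1 gf.
pose c' := g x0 / 2 * (dd / 2) ^+ n.
have c0 : 0 < c' by rewrite mulr_gt0 ?divr_gt0 // exprn_gt0 // divr_gt0.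
(* Beyond L, the lower bound c' of the means makes the left side of [main] exceed
   its right side. *)
pose L := K0 + 1 + 4 * (4 ^+ n * M + 2) / c'.
pose k := Num.bound L.
have K00 : 0 <= K0.
  have nn : 0 <= n%:R :> R by [].
  by rewrite /K0; move: nn C0; clear; move: (n%:R : R) => ? ? ?; lra.
have Mn : 0 <= 4 ^+ n * M by rewrite mulr_ge0 // exprn_ge0.
have q0 : 0 <= 4 * (4 ^+ n * M + 2) / c'.
  apply: divr_ge0; last exact: ltW.
  by move: Mn; move: (4 ^+ n * M) => ? ?; lra.
have kL : L < k%:R by apply: archi_boundP; rewrite /L addr_ge0 // addr_ge0.
have kK : K0 <= k%:R by move: kL q0; rewrite /L; clear; lra.
have := main k kK; have low' := low.
suff contra : forall m, ~ (k%:R ^+ 3 / 4 * rsum m f <= 4 ^+ n * M + 1 /\ c' <= rsum m f).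
  move=> mk; have [m] : exists m, k%:R ^+ 3 / 4 * rsum m f <= 4 ^+ n * M + 1 /\ c' <= rsum m f.
    by near \oo => m; exists m; split; near: m.
  exact: contra.
move=> m [h1 h2].
have k1 : 1 <= k%:R :> R by move: kL K00 q0; rewrite /L; clear; lra.
have k3 : k%:R <= k%:R ^+ 3 :> R.
  by rewrite -[leLHS]expr1; apply: ler_weXn2l.
have kc : 4 * (4 ^+ n * M + 2) <= k%:R * c'.
  rewrite -ler_pdivrMr //; move: kL K00; rewrite /L; clear; lra.
have : k%:R / 4 * c' <= k%:R ^+ 3 / 4 * rsum m f.
  apply: ler_pM; rewrite ?divr_ge0 //; first exact: ltW.
  by rewrite ler_pM2r // invr_gt0.
rewrite (_ : k%:R / 4 * c' = k%:R * c' / 4); last by rewrite mulrAC.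
move: h1 kc; move: (_ ^+ 3 / 4 * _) (4 ^+ n * M) (k%:R * c') => a b c; clear.
move=> h1 h2 h3; lra.
Unshelve. all: by end_near. Qed.

End unique_continuation.

(** * Order of vanishing at the singular point *)

Section vanishing_order.
Context {R : realType} {n : nat}.
Variable V : set 'rV[R]_n.
Hypotheses (oV : open V) (V0 : V 0).
Implicit Types (f g u : 'rV[R]_n -> R) (x : 'rV[R]_n) (i : 'I_n).

Definition smooth f := forall k, Ck k V f.

(** [f] is smooth and its derivatives of order less than [k] vanish at 0, i.e. its
Taylor expansion starts in degree [k] at least. *)
Fixpoint Oh (k : nat) f : Prop :=
  smooth f /\ if k is k'.+1 then f 0 = 0 /\ forall i, Oh k' (pd i f) else True.

Lemma Oh_smooth k f : Oh k f -> smooth f. Proof. by case: k => [|k] []. Qed.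

Lemma smooth_pd f i : smooth f -> smooth (pd i f).
Proof. by move=> sf k; exact: Ck_pd i (sf k.+1). Qed.

Lemma smooth_diff f x : smooth f -> V x -> differentiable f x.
Proof. by move=> sf; exact: Ck_diff (sf 1%N). Qed.

Lemma Oh_pd k f i : Oh k f -> Oh k.-1 (pd i f).
Proof.
case: k => [|k] /=; first by move=> [sf _]; split => //; exact: smooth_pd.
by move=> [_ [_]]; exact.
Qed.

Lemma OhW k f : Oh k.+1 f -> Oh k f.
Proof.
elim: k f => [|k IH] f [sf [f0 Df]] /=; split => //; split => // i.
exact: IH (Df i).
Qed.

Lemma Oh_le k l f : (k <= l)%N -> Oh l f -> Oh k f.
Proof.
elim: l => [|l IH]; first by rewrite leqn0 => /eqP ->.
by rewrite leq_eqVlt => /predU1P[->//|kl] /OhW; exact: IH.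
Qed.

Lemma Oh_ext k f g : (forall x, V x -> f x = g x) -> Oh k f -> Oh k g.
Proof.
elim: k f g => [|k IH] f g fg [sf Hf]; split; try by move=> k'; exact: Ck_ext oV fg (sf k').
  by [].
have [f0 Df] := Hf; split=> [|i]; first by rewrite -fg.
by apply: IH (Df i) => x Vx; exact: pd_open oV Vx fg.
Qed.

Lemma Oh0 k : Oh k (fun=> 0).
Proof.
elim: k => [|k IH]; split => //; try by move=> k'; exact: Ck_cst.
by split=> // i; apply: Oh_ext IH => x _; rewrite pd_cst.
Qed.

Lemma Oh_add k f g : Oh k f -> Oh k g -> Oh k (fun x => f x + g x).
Proof.
elim: k f g => [|k IH] f g Ff Gg; have sf := Oh_smooth Ff; have sg := Oh_smooth Gg;
  split; try by move=> k'; exact: Ck_add oV (sf k') (sg k').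
  by [].
have [_ [f0 Df]] := Ff; have [_ [g0 Dg]] := Gg; split=> [|i]; first by rewrite f0 g0 addr0.
apply: Oh_ext (IH _ _ (Df i) (Dg i)) => x Vx.
by rewrite (pd_add _ (smooth_diff sf Vx) (smooth_diff sg Vx)).
Qed.

Lemma Oh_mul s k l f g : (s <= k + l)%N -> Oh k f -> Oh l g -> Oh s (fun x => f x * g x).
Proof.
elim: s k l f g => [|s IH] k l f g skl Ff Gg; have sf := Oh_smooth Ff; have sg := Oh_smooth Gg;
  split; try by move=> k'; exact: Ck_mul oV (sf k') (sg k').
  by [].
split=> [|i].
  case: k skl Ff => [|k] skl Ff; last by case: Ff => _ [-> _]; rewrite mul0r.
  by case: l skl Gg => // l _ [_ [-> _]]; rewrite mulr0.
have e1 : (s <= k.-1 + l)%N by rewrite -ltnS (leq_trans skl) // -addSn leq_add2r leqSpred.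
have e2 : (s <= k + l.-1)%N by rewrite -ltnS (leq_trans skl) // -addnS leq_add2l leqSpred.
apply: Oh_ext (Oh_add (IH _ _ _ _ e1 (Oh_pd i Ff) Gg) (IH _ _ _ _ e2 Ff (Oh_pd i Gg))) => x Vx.
by rewrite (pd_mul _ (smooth_diff sf Vx) (smooth_diff sg Vx)).
Qed.

Lemma Oh_cst c : Oh 0 (fun=> c).
Proof. by split => // k; exact: Ck_cst. Qed.

Lemma Oh_scale k c f : Oh k f -> Oh k (fun x => c * f x).
Proof. by move=> Ff; apply: (Oh_mul _ (Oh_cst c) Ff). Qed.

Lemma Oh_sub k f g : Oh k f -> Oh k g -> Oh k (fun x => f x - g x).
Proof.
by move=> Ff Gg; apply: Oh_ext (Oh_add Ff (Oh_scale (-1) Gg)) => x _; rewrite mulN1r.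
Qed.

Lemma Oh_unscale k c f : c != 0 -> Oh k (fun x => c * f x) -> Oh k f.
Proof. by move=> c0 H; apply: Oh_ext (Oh_scale c^-1 H) => x _; rewrite mulKf. Qed.

Lemma Oh_sum k (F : 'I_n -> 'rV[R]_n -> R) : (forall i, Oh k (F i)) ->
  Oh k (fun x => \sum_i F i x).
Proof.
move=> HF; elim: (index_enum _) => [|a r IH].
  by apply: Oh_ext (Oh0 k) => x _; rewrite big_nil.
by apply: Oh_ext (Oh_add (HF a) IH) => x _; rewrite big_cons.
Qed.

Lemma Oh_coord i : Oh 1 (fun x => x 0 i).
Proof.
split; first by move=> k; exact: Ck_coord.
split=> [|j]; first by rewrite mxE.
by split=> // k; exact: Ck_pd j (Ck_coord k.+1 V i).
Qed.

Lemma Oh_sq : Oh 2 (@sq R n).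
Proof. by apply: Oh_sum => i; exact: Oh_mul (Oh_coord i) (Oh_coord i). Qed.

Lemma Oh_lap k f : Oh k f -> Oh k.-2 (lap f).
Proof. by move=> Ff; apply: Oh_sum => i; exact: Oh_pd i (Oh_pd i Ff). Qed.

Lemma Oh_euler k f : Oh k f -> Oh k (euler f).
Proof.
move=> Ff; apply: Oh_sum => i; apply: Oh_mul (Oh_coord i) (Oh_pd i Ff).
by rewrite add1n leqSpred.
Qed.

(** The Euler field multiplies the homogeneous part of degree [k] by [k]. *)
Lemma Oh_euler_homog k f : Oh k f -> Oh k.+1 (fun x => euler f x - k%:R * f x).
Proof.
elim: k f => [|k IH] f Ff; have sf := Oh_smooth Ff.
  have H : Oh 1 (euler f) by apply: Oh_sum => i; exact: Oh_mul (Oh_coord i) (Oh_pd i Ff).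
  by apply: Oh_ext H => x _; rewrite mul0r subr0.
split; first exact: Oh_smooth (Oh_sub (Oh_euler Ff) (Oh_scale k.+1%:R Ff)).
split=> [|i].
  by rewrite euler_at0; case: Ff => _ [-> _]; rewrite mulr0 subr0.
apply: Oh_ext (IH _ (Oh_pd i Ff)) => x Vx.
have sE := Oh_smooth (Oh_euler Ff).
rewrite (pd_sub _ (smooth_diff sE Vx) (diff_mul (diff_c _ _) (smooth_diff sf Vx))).
rewrite (pd_scale _ _ (smooth_diff sf Vx)) (pd_euler i oV Vx (sf 2%N)).
have -> : \sum_j x 0 j * pd i (pd j f) x = euler (pd i f) x.
  by apply: eq_bigr => j _; rewrite (pdC i j oV Vx (sf 2%N)).
by rewrite -natr1; move: (euler _ x) (pd i f x) (k%:R : R) => a b c; ring.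
Qed.

Lemma lap_add f g x : smooth f -> smooth g -> V x ->
  lap (fun y => f y + g y) x = lap f x + lap g x.
Proof.
move=> sf sg Vx; rewrite /lap -big_split; apply: eq_bigr => i _ /=.
rewrite (pd_open i oV Vx (g := fun y => pd i f y + pd i g y)).
  exact: pd_add (smooth_diff (smooth_pd i sf) Vx) (smooth_diff (smooth_pd i sg) Vx).
by move=> y Vy; exact: pd_add (smooth_diff sf Vy) (smooth_diff sg Vy).
Qed.

Lemma lap_scale c f x : smooth f -> V x -> lap (fun y => c * f y) x = c * lap f x.
Proof.
move=> sf Vx; rewrite /lap mulr_sumr; apply: eq_bigr => i _ /=.
rewrite (pd_open i oV Vx (g := fun y => c * pd i f y)).
  exact: pd_scale (smooth_diff (smooth_pd i sf) Vx).
by move=> y Vy; exact: pd_scale (smooth_diff sf Vy).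
Qed.

Lemma lap_sq_mul f x : smooth f -> V x ->
  lap (fun y => sq y * f y) x = 2 * n%:R * f x + 4 * euler f x + sq x * lap f x.
Proof.
move=> sf Vx.
have E i : pd i (pd i (fun y => sq y * f y)) x =
    2 * f x + 4 * (x 0 i * pd i f x) + sq x * pd i (pd i f) x.
  have dpf := smooth_diff (smooth_pd i sf) Vx; have df := smooth_diff sf Vx.
  rewrite (pd_open i oV Vx (g := fun y => 2 * (y 0 i * f y) + sq y * pd i f y)).
    have d1 := diff_mul (diff_coord i x) df; have d2 := diff_mul (diff_sq x) dpf.
    rewrite (pd_add _ (diff_mul (diff_c 2 x) d1) d2) (pd_scale _ _ d1).
    rewrite (pd_mul _ (diff_coord i x) df) (pd_mul _ (diff_sq x) dpf) pd_coord pd_sq eqxx /=.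
    by ring.
  move=> y Vy; rewrite (pd_mul _ (diff_sq y) (smooth_diff sf Vy)) pd_sq; ring.
rewrite [LHS]/lap; under eq_bigr => i _ do rewrite E.
rewrite !big_split /= -!mulr_sumr sumr_const card_ord.
by rewrite -/(euler f x) -/(lap f x) -[_ *+ n]mulr_natl; ring.
Qed.

(** A homogeneous polynomial h of degree k with r^2 Lap h + c h = 0 and c > 0 is 0.
Applying Lap to the equation gives one of the same form for Lap h, of degree k-2,
with the larger constant c + 2 n + 4 (k - 2); by induction Lap h = 0, whence
h = 0. The proof below is this argument modulo terms of higher order. *)
Lemma Oh_improve k c f : 0 < c -> Oh k f ->
  Oh k.+1 (fun x => sq x * lap f x + c * f x) -> Oh k.+1 f.
Proof.
have fin m (c' : R) g : 0 < c' -> Oh m (fun x => sq x * lap g x) ->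
    Oh m (fun x => sq x * lap g x + c' * g x) -> Oh m g.
  move=> c0 H1 H2; apply: (@Oh_unscale _ c'); first by rewrite gt_eqF.
  by apply: Oh_ext (Oh_sub H2 H1) => x _; rewrite addrAC subrr add0r.
have small m (c' : R) g : (m <= 1)%N -> 0 < c' -> Oh m g ->
    Oh m.+1 (fun x => sq x * lap g x + c' * g x) -> Oh m.+1 g.
  move=> m1 c0 Gg; apply: fin => //.
  by apply: (Oh_mul _ Oh_sq (Oh_lap Gg)); rewrite addSn ltnS (leq_trans m1).
elim/ltn_ind: k c f => -[|[|k]] IH c f c0 Ff H; [exact: small H..|].
have sf := Oh_smooth Ff; pose v := lap f; have Fv : Oh k v := Oh_lap Ff.
have sv := Oh_smooth Fv.
have nn : 0 <= n%:R :> R by [].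
have kk : 0 <= k%:R :> R by [].
have Hv : Oh k.+1 (fun x => sq x * lap v x + (c + 2 * n%:R + 4 * k%:R) * v x).
  have Hl := Oh_lap H; have He := Oh_scale 4 (Oh_euler_homog Fv).
  apply: Oh_ext (Oh_sub Hl He) => x Vx.
  have ssv : smooth (fun y => sq y * v y) by exact: Oh_smooth (Oh_mul (leqnn _) Oh_sq Fv).
  rewrite (lap_add ssv (Oh_smooth (Oh_scale c Ff)) Vx) (lap_scale _ sf Vx) lap_sq_mul //.
  by rewrite -/v; ring.
have Iv : Oh k.+1 v by apply: IH Fv Hv => //; lra.
apply: fin c0 _ H.
by apply: (Oh_mul _ Oh_sq Iv).
Qed.

(** The Hessian of [f] evaluated at its gradient. *)
Definition hess3 f x : R := \sum_i \sum_j pd i f x * pd j f x * pd i (pd j f) x.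

(** The Laplacian is multiplied by |x|^2, so for a solution of order k+2 it is of
the same order as the right-hand side, and all nonlinear terms are of higher
order. What remains is r^2 Lap u + alpha (k+1) u = 0 modulo order k+3, where
[alpha > 0] makes [Oh_improve] applicable. *)
Lemma flat_of_pde (alpha : R) u : 0 < alpha -> Oh 2 u ->
  (forall x, V x -> (sq x + u x ^+ 2) * ((1 + grad2 u x) * lap u x - hess3 u x) =
     alpha * ((1 + grad2 u x) * (u x - euler u x))) ->
  forall k, Oh k u.
Proof.
move=> a0 u2 pde; suff H k : Oh k.+2 u.
  by move=> k; exact: Oh_le (leq_trans (leqnSn k) (leqnSn k.+1)) (H k).
elim: k => [|k Fu]; first exact: u2.
have Fg : Oh (k.+1 + k.+1) (grad2 u).
  by apply: Oh_sum => i; exact: Oh_mul (Oh_pd i Fu) (Oh_pd i Fu).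
have Fl : Oh k (lap u) := Oh_lap Fu.
have Fe : Oh k.+2 (fun x => euler u x - u x) := Oh_sub (Oh_euler Fu) Fu.
have Fh : Oh (k.+1 + k.+1 + k) (hess3 u).
  apply: Oh_sum => i; apply: Oh_sum => j; apply: Oh_mul (leqnn _) _ _.
    exact: Oh_mul (leqnn _) (Oh_pd i Fu) (Oh_pd j Fu).
  exact: Oh_pd i (Oh_pd j Fu).
have Fu2 : Oh (k.+2 + k.+2) (fun x => u x * u x) := Oh_mul (leqnn _) Fu Fu.
have Fs : Oh 2 (fun x => sq x + u x * u x).
  by apply: Oh_add Oh_sq (Oh_le _ Fu2).
have T1 : Oh k.+3 (fun x => u x * u x * ((1 + grad2 u x) * lap u x)).
  apply: (Oh_mul (k := k.+2 + k.+2) (l := k) _ Fu2); first by lia.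
  apply: (Oh_mul (k := 0) (l := k) _ _ Fl) => //.
  by apply: Oh_add (Oh_cst 1) (Oh_le _ Fg).
have T2 : Oh k.+3 (fun x => sq x * (grad2 u x * lap u x)).
  by apply: (Oh_mul (k := 2) (l := k.+1 + k.+1 + k) _ Oh_sq (Oh_mul (leqnn _) Fg Fl)); lia.
have T3 : Oh k.+3 (fun x => (sq x + u x * u x) * hess3 u x).
  by apply: Oh_mul Fs Fh; lia.
have T4 : Oh k.+3 (fun x => alpha * (grad2 u x * (euler u x - u x))).
  by apply: Oh_scale; apply: Oh_mul Fg Fe; lia.
have T5 := Oh_scale alpha (Oh_euler_homog Fu).
have c0 : 0 < alpha * k.+1%:R by rewrite mulr_gt0 // ltr0n.
apply: (Oh_improve c0 Fu).
apply: Oh_ext (Oh_sub (Oh_sub (Oh_sub (Oh_sub T3 T1) T2) T4) T5) => x Vx.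
have := pde x Vx; rewrite -[k.+2]addn1 natrD.
move: (sq x) (u x) (grad2 u x) (lap u x) (hess3 u x) (euler u x) (k.+1%:R : R).
move=> s w g l h e q E.
have {}E : (s + w ^+ 2) * ((1 + g) * l - h) - alpha * ((1 + g) * (w - e)) = 0 by rewrite E subrr.
apply/eqP; rewrite -subr_eq0 -oppr_eq0 -E; apply/eqP; ring.
Qed.

Lemma Oh_bound (d : R) k f : (forall x, `|x| <= d -> V x) -> 0 < d -> Oh k f ->
  exists2 C, 0 <= C & forall x, `|x| <= d -> `|f x| <= C * `|x| ^+ k.
Proof.
move=> dV d0; elim: k f => [|k IH] f Ff.
  have [x /dV Vx|M M0 H] := @cont_bounded _ _ f d; first exact: Ck_cont (Oh_smooth Ff 0) Vx.
  by exists M => // x xd; rewrite mulr1; exact: H.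
have [sf [f0 Df]] := Ff.
have /choice[C HC] : forall i, exists C : R, 0 <= C /\
    forall x, `|x| <= d -> `|pd i f x| <= C * `|x| ^+ k.
  by move=> i; have [C C0 H] := IH _ (Df i); exists C.
exists (\sum_i C i) => [|x xd]; first by apply: sumr_ge0 => i _; have [] := HC i.
have tx t : 0 <= t <= 1 -> `|t *: x| <= `|x|.
  by move=> /andP[t0 t1]; rewrite normrZ ger0_norm // ler_piMl.
have [t t01|t /andP[t0 t1]] := @pd_mvt _ _ f 0 x.
  by rewrite add0r; apply: smooth_diff sf (dV _ _); exact: le_trans (tx t t01) xd.
rewrite !add0r f0 subr0 => ->.
have {}tx : `|t *: x| <= `|x| by apply: tx; rewrite !ltW.
apply: le_trans (ler_norm_sum _ _ _) _; rewrite mulr_suml; apply: ler_sum => i _.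
have [C0 H] := HC i; rewrite normrM exprS mulrCA; apply: ler_pM => //.
  exact: norm_coord.
apply: le_trans (H _ (le_trans tx xd)) _; apply: ler_wpM2l => //.
by apply: lerXn2r; rewrite ?nnegrE.
Qed.

(** Taylor expansion with remainder, applied to [u] and to its derivatives. *)
Lemma Oh_Flat u : (forall k, Oh k u) ->
  exists2 r : R, 0 < r & forall r', 0 < r' <= r -> (forall x, sq x < r' -> V x) /\
     Flat 2 [set x | sq x < r'] u.
Proof.
move=> Hu; have [e e0 He] := open_ball oV V0.
pose d := e / 2; have d0 : 0 < d by rewrite divr_gt0.
have dV x : `|x| <= d -> V x.
  by move=> xd; apply: He; rewrite subr0; apply: le_lt_trans xd _; rewrite /d; lra.
exists (d ^+ 2) => [|r' /andP[r0 rd]]; first exact: exprn_gt0.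
have sd x : sq x < r' -> `|x| <= d.
  move=> xr; rewrite -(@ler_pXn2r _ 2) ?nnegrE //; last exact: ltW.
  by apply: le_trans (norm_sq x) _; exact: le_trans (ltW xr) rd.
split=> [x /sd|]; first exact: dV.
have F0 f : (forall k, Oh k f) -> flat0 [set x | sq x < r'] f.
  move=> Hf N; have [C C0 H] := Oh_bound dV d0 (Hf (2 * N)%N).
  exists C => // x /sd xd _; apply: le_trans (H x xd) _; apply: ler_wpM2l => //.
  by rewrite exprM; apply: lerXn2r; rewrite ?nnegrE ?sqr_ge0 ?sq_ge0 // norm_sq.
elim: 2%N u Hu => [|j IH] u Hu; split; try exact: F0.
  by move=> x /sd /dV Vx; exact: Ck_cont (Oh_smooth (Hu 0%N) 0) Vx.
split=> [x /sd /dV|i]; first exact: smooth_diff (Oh_smooth (Hu 0%N)).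
by apply: IH => k; exact: Oh_pd i (Hu k.+1).
Qed.

End vanishing_order.

(** * The inverse function theorem *)

Section matrix_calculus.
Context {R : realType}.

Lemma mulmx_bound m n (M : 'M[R]_(m, n)) :
  exists2 c : R, 0 <= c & forall v : 'rV[R]_m, `|v *m M| <= c * `|v|.
Proof.
have c0 : 0 <= \sum_i \sum_j `|M i j| by apply: sumr_ge0 => i _; exact: sumr_ge0.
exists (\sum_i \sum_j `|M i j|) => // v; apply: norm_rV_le => [|j]; first exact: mulr_ge0.
rewrite mxE; apply: le_trans (ler_norm_sum _ _ _) _; rewrite mulr_suml.
apply: ler_sum => i _; rewrite normrM mulrC; apply: ler_pM => //; last exact: norm_coord.
by rewrite (bigD1 j) //= lerDl sumr_ge0.
Qed.

Lemma continuous_mulmx m n (M : 'M[R]_(m, n)) : continuous (fun v : 'rV[R]_m => v *m M).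
Proof.
move=> x; apply/cont_rV => j.
have -> : (fun v : 'rV[R]_m => (v *m M) 0 j) = (fun v => \sum_i v 0 i * M i j).
  by apply/funext => v; rewrite mxE.
have H : Ck 0 setT (fun v : 'rV[R]_m => \sum_i v 0 i * M i j).
  apply: Ck_sum => [|i _]; first exact: openT.
  by apply: Ck_mul; [exact: openT|exact: Ck_coord|exact: Ck_cst].
exact: H.
Qed.

Context {n : nat}.
Implicit Types (V : set 'rV[R]_n).

Lemma continuous_norm_comp m (G : 'rV[R]_n -> 'rV[R]_m) : continuous G ->
  continuous ((fun v : 'rV[R]_m => `|v|) \o G).
Proof.
by move=> cG x; apply: continuous_comp; [exact: cG|exact: norm_continuous].
Qed.

Lemma open_norm_lt m (G : 'rV[R]_n -> 'rV[R]_m) d : continuous G ->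
  open [set x | `|G x| < d].
Proof.
move=> /continuous_norm_comp cG.
have -> : [set x | `|G x| < d] = ((fun v : 'rV[R]_m => `|v|) \o G) @^-1` [set t | t < d] by [].
by apply: open_comp => [y _|]; [exact: cG|exact: open_lt].
Qed.

Lemma closed_norm_le m (G : 'rV[R]_n -> 'rV[R]_m) d : continuous G ->
  closed [set x | `|G x| <= d].
Proof.
move=> /continuous_norm_comp cG.
have -> : [set x | `|G x| <= d] = ((fun v : 'rV[R]_m => `|v|) \o G) @^-1` [set t | t <= d] by [].
by apply: closed_comp => [y _|]; [exact: cG|exact: closed_le].
Qed.

Lemma continuous_subr (a : 'rV[R]_n) : continuous (fun y : 'rV[R]_n => y - a).
Proof. by move=> y; apply: continuousB; [exact: cvg_id|exact: cst_continuous]. Qed.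

Lemma Ck_det k V m (M : 'rV[R]_n -> 'M[R]_m) : open V ->
  (forall i j, Ck k V (fun x => M x i j)) -> Ck k V (fun x => \det (M x)).
Proof.
move=> oV CM.
have H : Ck k V (fun x => \sum_(s : 'S_m) (-1) ^+ s * \prod_i M x i (s i)).
  apply: Ck_sum => // s _; apply: Ck_mul => //; first exact: Ck_cst.
  by apply: Ck_prod => // i _.
exact: H.
Qed.

Lemma Ck_invmx k V m (M : 'rV[R]_n -> 'M[R]_m) i j : open V ->
  (forall x, V x -> M x \in unitmx) ->
  (forall i j, Ck k V (fun x => M x i j)) -> Ck k V (fun x => invmx (M x) i j).
Proof.
move=> oV uM CM.
have H : Ck k V (fun x => (\det (M x))^-1 * ((-1) ^+ (j + i) * \det (row' j (col' i (M x))))).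
  apply: (Ck_mul oV).
    apply: (Ck_inv oV) => [x Vx|]; last exact: Ck_det.
    by have := uM x Vx; rewrite unitmxE unitfE.
  apply: (Ck_mul oV (Ck_cst _ _ _)); apply: (Ck_det oV) => a b.
  by apply: Ck_ext oV _ (CM (lift j a) (lift i b)) => x _; rewrite !mxE.
by apply: Ck_ext oV _ H => x Vx; rewrite /invmx (uM x Vx) !mxE.
Qed.

Definition jac m (F : 'rV[R]_n -> 'rV[R]_m) x : 'M[R]_(n, m) :=
  \matrix_(i, j) pd i (fun y => F y 0 j) x.

Lemma diff_jac m (F : 'rV[R]_n -> 'rV[R]_m) x h : differentiable F x ->
  'd F x h = h *m jac F x.
Proof.
move=> dF; rewrite {1}(row_sum_delta h) linear_sum; apply/rowP => j.
rewrite summxE mxE; apply: eq_bigr => i _; rewrite linearZ mxE mxE; congr (_ * _).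
by rewrite -deriveE // derive_mx ?mxE //; exact: diff_derivable.
Qed.

Lemma lipschitz_mvt m (F : 'rV[R]_n -> 'rV[R]_m) x y (B : R) : 0 <= B ->
  (forall t, 0 <= t <= 1 -> differentiable F (x + t *: (y - x))) ->
  (forall t i j, 0 <= t <= 1 -> `|jac F (x + t *: (y - x)) i j| <= B) ->
  `|F y - F x| <= n%:R * B * `|y - x|.
Proof.
move=> B0 dF JB; apply: norm_rV_le => [|j]; first by rewrite !mulr_ge0.
rewrite mxE [X in _ + X]mxE.
have [t t01|t /andP[t0 t1]] := @pd_mvt _ _ (fun z => F z 0 j) x (y - x).
  by have /diff_rV := dF t t01.
have e : x + (y - x) = y by rewrite addrC subrK.
rewrite e => ->; apply: le_trans (ler_norm_sum _ _ _) _.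
have -> : n%:R * B * `|y - x| = \sum_(i < n) B * `|y - x|.
  by rewrite sumr_const card_ord -mulrA mulr_natl.
apply: ler_sum => i _; rewrite normrM mulrC; apply: ler_pM => //; last exact: norm_coord.
by have := JB t i j; rewrite mxE; apply; rewrite !ltW.
Qed.

End matrix_calculus.

(* The contraction principle asks for a complete normed module. *)
HB.instance Definition _ (R : realType) (n : nat) := Complete.on 'rV[R]_n.

Section inverse_function.
Context {R : realType} {n : nat}.
Variables (V : set 'rV[R]_n) (F : 'rV[R]_n -> 'rV[R]_n) (x0 : 'rV[R]_n).
Hypotheses (oV : open V) (Vx0 : V x0).
Hypothesis (CF : forall k j, Ck k V (fun x => F x 0 j)).
Hypothesis (uJ : jac F x0 \in unitmx).

Let A := invmx (jac F x0).
Let T x := x - F x *m A.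

Let diffF x : V x -> differentiable F x.
Proof. by move=> Vx; apply/diff_rV => j; exact: Ck_diff (CF 1 j) Vx. Qed.

Let CJ k i j : Ck k V (fun x => jac F x i j).
Proof. by apply: Ck_ext oV _ (Ck_pd i (CF k.+1 j)) => x _; rewrite mxE. Qed.

Let jacT x : V x -> jac T x = 1%:M - jac F x *m A.
Proof.
move=> Vx; apply/matrixP => i j; rewrite !mxE.
have dFj l : differentiable (fun y => F y 0 l * A l j) x.
  by apply: differentiableM; [exact: Ck_diff (CF 1 l) Vx|exact: differentiable_cst].
have -> : (fun y => T y 0 j) = (fun y => y 0 j - \sum_l F y 0 l * A l j).
  by apply/funext => y; rewrite !mxE.
rewrite (pd_sub _ (diff_coord j x)); last exact: diff_sum.
rewrite pd_coord pd_sum //; congr (_ - _); apply: eq_bigr => l _; rewrite !mxE.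
rewrite (pd_mul _ (Ck_diff (CF 1 l) Vx)); last exact: differentiable_cst.
by rewrite pd_cst mulr0 addr0.
Qed.

Let diffT x : V x -> differentiable T x.
Proof.
move=> Vx; apply/diff_rV => j.
have -> : (fun y => T y 0 j) = (fun y => y 0 j - \sum_l F y 0 l * A l j).
  by apply/funext => y; rewrite !mxE.
apply: differentiableB; first exact: diff_coord.
apply: diff_sum => l _.
by apply: differentiableM; [exact: Ck_diff (CF 1 l) Vx|exact: differentiable_cst].
Qed.

(* A map whose Jacobian has entries at most [b] contracts the sup norm by 1/2. *)
Let b : R := (2 * n.+1%:R)^-1.
Let nb : n%:R * b <= 1 / 2.
Proof.
have n0 : 0 < n.+1%:R :> R by rewrite ltr0n.
rewrite /b invfM mulrCA mulrA [_ * 2^-1]mulrC -mulrA; apply: ler_wpM2l => //.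
by rewrite ler_pdivrMr // mul1r ler_nat.
Qed.

Lemma jac_small : exists2 d : R, 0 < d & forall x, `|x - x0| <= d ->
  V x /\ forall i j, `|jac T x i j| <= b.
Proof.
have b0 : 0 < b by rewrite invr_gt0 mulr_gt0 // ltr0n.
have cT i j : {for x0, continuous (fun x => (1%:M - jac F x *m A) i j)}.
  have H : Ck 0 V (fun x => (i == j)%:R - \sum_l jac F x i l * A l j).
    apply: (Ck_sub2 oV (Ck_cst _ _ _)); apply: Ck_sum => // l _.
    by apply: (Ck_mul oV (CJ 0 i l)); exact: Ck_cst.
  have <- : (fun x => (i == j)%:R - \sum_l jac F x i l * A l j) =
      (fun x => (1%:M - jac F x *m A) i j) by apply/funext => y; rewrite !mxE.
  exact: H x0 Vx0.
have z i j : (1%:M - jac F x0 *m A) i j = 0 by rewrite mulmxV // subrr mxE.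
have [e e0 He] := open_ball oV Vx0.
have : \forall x \near x0, forall i j, `|(1%:M - jac F x *m A) i j| < b.
  apply: (@filter_forall _ _ _ (nbhs x0)) => i.
  apply: (@filter_forall _ _ _ (nbhs x0)) => j.
  have h : \forall x \near x0,
      `|(1%:M - jac F x0 *m A) i j - (1%:M - jac F x *m A) i j| < b.
    by have /cvgrPdist_lt := cT i j; apply.
  have zz (p q : R) : p = 0 -> `|p - q| = `|q| by move=> ->; rewrite sub0r normrN.
  by apply: filterS h => x /=; rewrite (zz _ _ (z i j)).
move=> /nbhs_ballP[d1 d10 H1].
exists (Num.min e d1 / 2) => [|x xd]; first by rewrite divr_gt0 // lt_min e0.
have lt2 : Num.min e d1 / 2 < Num.min e d1.
  by have : 0 < Num.min e d1 by [rewrite lt_min e0|]; move=> h; lra.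
have := le_lt_trans xd lt2; rewrite lt_min => /andP[xe xd1].
have Vx := He x xe; split => // i j; rewrite jacT //; apply/ltW/H1.
by rewrite -ball_normE /= distrC.
Qed.

(** With A the inverse of the Jacobian at [x0], the map T x = x - F x A has a small
Jacobian near [x0] and F x = y means that x is a fixed point of T + y A, so the
contraction principle yields the inverse [G]. The Jacobian of [G] is the inverse
of that of [F] at [G y], which gives the regularity of [G] by induction. *)
Theorem inverse_function : exists (N V1 : set 'rV[R]_n) (G : 'rV[R]_n -> 'rV[R]_n),
  [/\ open N /\ open V1, [/\ N (F x0), V1 x0 & V1 `<=` V],
      forall y, N y -> V1 (G y) /\ F (G y) = y,
      forall x, V1 x -> N (F x) -> G (F x) = x &
      forall k j, Ck k N (fun y => G y 0 j)].
Proof.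
have [d d0 Hd] := jac_small.
have b0 : 0 <= b by rewrite invr_ge0 mulr_ge0.
have seg x y t : `|x - x0| <= d -> `|y - x0| <= d -> 0 <= t <= 1 ->
    `|x + t *: (y - x) - x0| <= d.
  move=> xd yd /andP[t0 t1].
  have -> : x + t *: (y - x) - x0 = (1 - t) *: (x - x0) + t *: (y - x0).
    by apply/rowP => i; rewrite !mxE; ring.
  have t1' : 0 <= 1 - t by rewrite subr_ge0.
  apply: le_trans (ler_normD _ _) _; rewrite !normrZ !ger0_norm //.
  have h1 := ler_wpM2l t1' xd; have h2 := ler_wpM2l t0 yd.
  by move: h1 h2; lra.
have TL x y : `|x - x0| <= d -> `|y - x0| <= d -> `|T y - T x| <= 1 / 2 * `|y - x|.
  move=> xd yd; apply: (@le_trans _ _ (n%:R * b * `|y - x|)).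
    apply: lipschitz_mvt b0 _ _ => [t t01|t i j t01].
      by apply: diffT; exact: (Hd _ (seg _ _ _ xd yd t01)).1.
    exact: (Hd _ (seg _ _ _ xd yd t01)).2.
  exact: ler_wpM2r.
have [c c0 Hc] := mulmx_bound A.
(* The identity is [T + F A] and [T] contracts, so distances are bounded by those
   of the images under [F]: [F] is injective and [G] is Lipschitz. *)
have FL x y : `|x - x0| <= d -> `|y - x0| <= d -> `|y - x| <= 2 * c * `|F y - F x|.
  move=> xd yd; have TT := TL x y xd yd.
  have e : y - x = (T y - T x) + (F y - F x) *m A.
    by rewrite mulmxBl /T; apply/rowP => i; rewrite !mxE; ring.
  have h1 := ler_normD (T y - T x) ((F y - F x) *m A); rewrite -e in h1.
  have h2 := Hc (F y - F x).
  rewrite -mulrA; move: TT h1 h2.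
  move: (c * _) `|_ *m A| `|T y - T x| `|y - x|; move=> p q r s; lra.
pose N : set 'rV[R]_n := [set y | `|(y - F x0) *m A| < d / 2].
have oN : open N.
  apply: open_norm_lt => y.
  apply: (@continuous_comp _ _ _ (fun y : 'rV[R]_n => y - F x0) (fun v => v *m A)).
    exact: continuous_subr.
  exact: continuous_mulmx.
pose V1 : set 'rV[R]_n := [set x | `|x - x0| < d].
have oV1 : open V1 by apply: open_norm_lt; exact: continuous_subr.
have V1V : V1 `<=` V by move=> x /ltW /Hd[].
have x0d : `|x0 - x0| <= d by rewrite subrr normr0 ltW.
pose U : set 'rV[R]_n := [set x | `|x - x0| <= d].
have cU : closed U by apply: closed_norm_le; exact: continuous_subr.
have in1 y x : N y -> U x -> `|T x + y *m A - x0| < d.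
  move=> Ny Ux; have := TL _ _ x0d Ux => h.
  have -> : T x + y *m A - x0 = (T x - T x0) + (y - F x0) *m A.
    by rewrite mulmxBl /T; apply/rowP => i; rewrite !mxE; ring.
  apply: le_lt_trans (ler_normD _ _) _.
  have h2 : 1 / 2 * `|x - x0| <= 1 / 2 * d by apply: ler_wpM2l.
  move: h h2 Ny; rewrite /N /=; move: `|T x - T x0| `|x - x0| `|_ *m A|.
  by move=> p q r; lra.
have sol y : N y -> exists x, V1 x /\ F x = y.
  move=> Ny; pose Ty x := T x + y *m A.
  have fT : {homo Ty : x / U x} by move=> x Ux; exact: ltW (in1 y x Ny Ux).
  pose TyF : {fun U >-> U} := HB.pack_for {fun U >-> U} Ty (isFun.Build _ _ U U Ty fT).
  have ctr : is_contraction TyF.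
    have h0 : 0 <= (1 / 2 : R) by rewrite divr_ge0.
    exists (NngNum h0); split; first by rewrite /=; lra.
    move=> [x x'] [/= Ux Ux']; rewrite /Ty opprD addrACA subrr addr0.
    exact: TL.
  have [|p Up pE] := banach_fixed_point ctr cU; first by exists x0.
  exists p; have pd' := in1 y p Ny Up; move: pE; rewrite /= /Ty => pE.
  split; first by rewrite /V1 /= {1}pE.
  have e : (F p - y) *m A = 0.
    rewrite mulmxBl; apply/eqP; rewrite subr_eq0; apply/eqP.
    move: pE; rewrite /T -addrA -{1}[p]addr0 => /addrI /esym/eqP.
    by rewrite addrC subr_eq0 => /eqP ->.
  apply/eqP; rewrite -subr_eq0; apply/eqP.
  by rewrite -[LHS]mulmx1 -(mulVmx uJ) mulmxA e mul0mx.
have /choice[G HG] : forall y, exists x, N y -> V1 x /\ F x = y.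
  move=> y; have [Ny|nNy] := pselect (N y); last by exists x0.
  by have [x Hx] := sol y Ny; exists x.
have Nx0 : N (F x0) by rewrite /N /= subrr mul0mx normr0 divr_gt0.
have GF x : V1 x -> N (F x) -> G (F x) = x.
  move=> V1x NFx; have [V1G FG] := HG _ NFx.
  apply/eqP; rewrite -subr_eq0 -normr_le0.
  by have := FL x (G (F x)) (ltW V1x) (ltW V1G); rewrite FG subrr normr0 mulr0.
have uJx x : V1 x -> jac F x \in unitmx.
  move=> V1x; have [Vx Jx] := Hd x (ltW V1x).
  rewrite -row_free_unit -kermx_eq0; apply/eqP/row_matrixP => i; rewrite row0.
  set v := row i _; have vJ : v *m jac F x = 0.
    by apply/sub_kermxP; exact: row_sub.
  apply/eqP; rewrite -normr_le0.
  have e : v = v *m jac T x by rewrite jacT // mulmxBr mulmx1 mulmxA vJ mul0mx subr0.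
  have : `|v| <= n%:R * b * `|v|.
    rewrite {1}e; apply: norm_rV_le => [|j]; first by rewrite !mulr_ge0.
    rewrite mxE; apply: le_trans (ler_norm_sum _ _ _) _.
    have -> : n%:R * b * `|v| = \sum_(i < n) `|v| * b.
      by rewrite sumr_const card_ord -mulrA mulr_natl mulrC.
    apply: ler_sum => l _; rewrite normrM; apply: ler_pM => //; exact: norm_coord.
  have := ler_wpM2r (normr_ge0 v) nb => h1 h2.
  have := le_trans h2 h1; move: `|v| => q; lra.
have Lip y y' : N y -> N y' -> `|G y - G y'| <= 2 * c * `|y - y'|.
  move=> Ny Ny'; have [V1y Fy] := HG y Ny; have [V1y' Fy'] := HG y' Ny'.
  by have := FL (G y') (G y) (ltW V1y') (ltW V1y); rewrite Fy Fy'.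
have dG y : N y -> differentiable G y /\ 'd G y = mulmxr (invmx (jac F (G y))) :> ('rV[R]_n -> 'rV[R]_n).
  move=> Ny; have [V1y Fy] := HG y Ny; set L := invmx _.
  apply: diff_eps => [|eps e0]; first exact: continuous_mulmx.
  have [cL cL0 HL] := mulmx_bound L.
  pose K := (cL + 1) * (2 * c + 1).
  have K0 : 0 < K by rewrite mulr_gt0 // ltr_wpDl // mulr_ge0.
  have eK : 0 < eps / K by exact: divr_gt0.
  have dF := diffF (V1V _ V1y).
  have /nbhs_ballP[r r0 Hr] := diff_epsP dF eK.
  have [s s0 Hs] := open_ball oN Ny.
  have C1 : 0 < 2 * c + 1 by rewrite ltr_wpDl // mulr_ge0.
  pose t := Num.min s (r / (2 * c + 1)).
  have t0 : 0 < t by rewrite lt_min s0 divr_gt0.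
  apply/nbhs_ballP; exists t => //= h; rewrite -ball_normE /= sub0r normrN lt_min.
  move=> /andP[hs hr].
  have Nh : N (h + y) by apply: Hs; rewrite addrK.
  have [V1h Fh] := HG _ Nh.
  pose g := G (h + y) - G y.
  have gL : `|g| <= 2 * c * `|h| by have := Lip _ _ Nh Ny; rewrite addrK.
  have h0 := normr_ge0 h.
  have gr : `|g| < r.
    apply: le_lt_trans gL _; apply: (@le_lt_trans _ _ (`|h| * (2 * c + 1))).
      by rewrite mulrC; apply: ler_wpM2l => //; lra.
    by rewrite -ltr_pdivlMr.
  have := Hr g; rewrite -ball_normE /= sub0r normrN => /(_ gr).
  rewrite /g subrK Fh Fy addrK diff_jac // -/g => Hg.
  have e : g - h *m L = - ((h - g *m jac F (G y)) *m L).
    by rewrite mulmxBl -mulmxA mulmxV ?uJx // mulmx1 opprB.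
  rewrite e normrN; apply: le_trans (HL _) _.
  apply: (@le_trans _ _ ((cL + 1) * (eps / K * ((2 * c + 1) * `|h|)))).
    apply: ler_pM => //; first by rewrite lerDl.
    apply: le_trans Hg _; apply: ler_wpM2l; first exact: ltW.
    by apply: le_trans gL _; apply: ler_wpM2r => //; rewrite lerDl.
  rewrite le_eqVlt; apply/orP; left; apply/eqP.
  have : K != 0 by rewrite gt_eqF.
  rewrite /K mulf_eq0 negb_or => /andP[k1 k2].
  by field; apply/andP.
exists N, V1, G; split => //.
  by split => //; rewrite /V1 /= subrr normr0.
have pdG i j y : N y -> pd i (fun y => G y 0 j) y = invmx (jac F (G y)) i j.
  move=> Ny; have [dGy E] := dG y Ny.
  have -> : pd i (fun y => G y 0 j) y = ('D_(delta_mx 0 i) G y) 0 j.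
    by rewrite derive_mx ?mxE //; exact: diff_derivable.
  by rewrite deriveE // E /= -rowE mxE.
elim=> [|k IH] j.
  move=> y Ny; have [dGy _] := dG y Ny.
  by have /cont_rV := differentiable_continuous dGy; apply.
split=> [y Ny|i]; first by have [/diff_rV dGy _] := dG y Ny.
have CI : Ck k V1 (fun x => invmx (jac F x) i j).
  by apply: Ck_invmx oV1 uJx _ => i' j'; exact: Ck_sub V1V (CJ k i' j').
have H := Ck_comp oN (fun y Ny => (HG y Ny).1) IH CI.
by apply: Ck_ext oN _ H => y Ny; rewrite pdG.
Qed.

End inverse_function.

(** * Scalar product, frames and regularity of maps *)

Section dot_rules.
Context {R : realType} {m : nat}.
Implicit Types u v w : 'rV[R]_m.

Lemma dotE u v : dot u v = (u *m v^T) 0 0.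
Proof. by rewrite mxE; apply: eq_bigr => i _; rewrite mxE. Qed.

Lemma dotC u v : dot u v = dot v u.
Proof. by apply: eq_bigr => i _; rewrite mulrC. Qed.

Lemma dotDl u v w : dot (u + v) w = dot u w + dot v w.
Proof. by rewrite -big_split; apply: eq_bigr => i _; rewrite mxE mulrDl. Qed.

Lemma dotZl c u w : dot (c *: u) w = c * dot u w.
Proof. by rewrite mulr_sumr; apply: eq_bigr => i _; rewrite mxE mulrA. Qed.

Lemma dotDr u v w : dot w (u + v) = dot w u + dot w v.
Proof. by rewrite !(dotC w) dotDl. Qed.

Lemma dotZr c u w : dot w (c *: u) = c * dot w u.
Proof. by rewrite !(dotC w) dotZl. Qed.

Lemma dotNl u w : dot (- u) w = - dot u w.
Proof. by rewrite -scaleN1r dotZl mulN1r. Qed.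

Lemma dot_suml (I : finType) (F : I -> 'rV[R]_m) w :
  dot (\sum_i F i) w = \sum_i dot (F i) w.
Proof. by rewrite dotE mulmx_suml summxE; apply: eq_bigr => i _; rewrite dotE. Qed.

Lemma mulmx_trE u v : u *m v^T = (dot u v)%:M.
Proof. by apply/matrixP => i j; rewrite !ord1 -dotE mxE eqxx mulr1n. Qed.

Lemma enorm_sq u : enorm u ^+ 2 = dot u u.
Proof. by rewrite sqr_sqrtr // sumr_ge0 // => i _; rewrite -expr2 sqr_ge0. Qed.

End dot_rules.

Section frame.
Context {R : realType} {n : nat}.

(** The rows of [B] form an orthonormal basis of the hyperplane orthogonal to [e]. *)
Definition frame (B : 'M[R]_(n, n.+1)) (e : 'rV[R]_n.+1) : Prop :=
  [/\ B *m B^T = 1%:M, B *m e^T = 0, dot e e = 1 & B^T *m B + e^T *m e = 1%:M].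

(** The reflection that exchanges [e] and the last basis vector. *)
Lemma householder (e : 'rV[R]_n.+1) : dot e e = 1 ->
  exists H : 'M[R]_n.+1, H *m H^T = 1%:M /\ row ord_max H = e.
Proof.
move=> e1; pose l : 'rV[R]_n.+1 := delta_mx 0 ord_max; pose v := l - e.
have l1 : dot l l = 1.
  rewrite /dot (bigD1 ord_max) //= big1 ?addr0 => [|i il].
    by rewrite !mxE !eqxx mulr1.
  by rewrite !mxE (negPf il) andbF mul0r.
have vE : v = l - e by [].
clearbody v.
have vv : dot v v = 2 - 2 * dot l e.
  by rewrite vE !(dotDl, dotDr, dotNl) !(dotC _ (- e)) !dotNl e1 l1 (dotC e l); ring.
have lv : dot l v = 1 - dot l e by rewrite vE dotDr l1 (dotC l (- e)) dotNl (dotC e l).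
have [v0|v0] := eqVneq (dot v v) 0.
  exists 1%:M; split; first by rewrite trmx1 mulmx1.
  have /eqP : v = 0 by apply/eqP; rewrite -sq_eq0 -[sq v]/(dot v v) v0.
  by rewrite vE subr_eq0 => /eqP <-; rewrite rowE mulmx1.
pose c := 2 / dot v v.
pose H : 'M[R]_n.+1 := 1%:M - c *: (v^T *m v).
have Ht : H^T = H by rewrite /H linearB /= trmx1 linearZ /= trmx_mul trmxK.
exists H; split.
  rewrite Ht /H mulmxBl mul1mx mulmxBr mulmx1 -scalemxAl -scalemxAr.
  rewrite -[v^T *m v *m (v^T *m v)]mulmxA [v *m (v^T *m v)]mulmxA mulmx_trE mul_scalar_mx.
  rewrite -scalemxAr !scalerA /c.
  rewrite divfK // mulr_natr; set K := v^T *m v; set a := 2 / _.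
  by rewrite mulr2n scalerDl (opprD (a *: K)) opprK addKr subrK.
rewrite rowE -/l /H mulmxBr mulmx1 -scalemxAr mulmxA mulmx_trE mul_scalar_mx scalerA.
have -> : c * dot l v = 1 by rewrite /c lv; move: v0; rewrite vv => v0; field; lra.
by rewrite scale1r vE opprB addrC subrK.
Qed.

Lemma frame_exists (e : 'rV[R]_n.+1) : dot e e = 1 -> exists B, frame B e.
Proof.
move=> e1; have [H [HH He]] := householder e1.
pose w (i : 'I_n) := widen_ord (leqnSn n) i.
pose B : 'M[R]_(n, n.+1) := \matrix_(i, j) H (w i) j.
have Hij i j : \sum_k H i k * H j k = (i == j)%:R.
  have /matrixP/(_ i j) := HH; rewrite !mxE => <-; apply: eq_bigr => k _.
  by rewrite mxE.
have eE k : e 0 k = H ord_max k by rewrite -He mxE.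
exists B; split => //.
- apply/matrixP => i j; rewrite !mxE -[RHS](_ : (w i == w j)%:R = _); last by [].
  by rewrite -Hij; apply: eq_bigr => k _; rewrite !mxE.
- apply/matrixP => i j; rewrite !ord1 !mxE.
  transitivity ((w i == ord_max)%:R : R).
    by rewrite -Hij; apply: eq_bigr => k _; rewrite !mxE eE.
  by rewrite -(inj_eq val_inj) /= ltn_eqF.
have HtH : H^T *m H = 1%:M by apply: mulmx1C.
rewrite -HtH; apply/matrixP => i j; rewrite !mxE [RHS]big_ord_recr /=; congr (_ + _).
  by apply: eq_bigr => k _; rewrite !mxE.
by rewrite big_ord1 !mxE !eE.
Qed.

End frame.

Section local_param.
Context {R : realType} {n : nat} (Sigma U : set 'rV[R]_n.+1) (V : set 'rV[R]_n).
Context (phi : 'rV[R]_n -> 'rV[R]_n.+1) (lp : local_param Sigma U V phi).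

Lemma param_in x : V x -> Sigma (phi x) /\ U (phi x).
Proof. by have [_ _ im _ _] := lp; move=> Vx; rewrite -[_ /\ _]/((Sigma `&` U) _) -im; exists x. Qed.

Lemma param_onto X : Sigma X -> U X -> exists2 x, V x & phi x = X.
Proof. by have [_ _ im _ _] := lp; move=> SX UX; have : (phi @` V) X by rewrite im. Qed.

End local_param.

Section regularity.
Context {R : realType} {n m : nat}.
Implicit Types (V : set 'rV[R]_n) (f : 'rV[R]_n -> 'rV[R]_m).

Lemma partialE f i x j : differentiable f x ->
  partial i f x 0 j = pd i (fun y => f y 0 j) x.
Proof.
by move=> df; rewrite /partial derive_mx ?mxE //; exact: diff_derivable.
Qed.

Lemma class_CP k V f : open V ->
  class_C k V f <-> forall j, Ck k V (fun x => f x 0 j).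
Proof.
move=> oV; elim: k f => [|k IH] f /=.
  split=> [cf j x Vx|Cf x Vx]; first by have /cont_rV := cf x Vx; apply.
  by apply/cont_rV => j; exact: Cf.
split=> [[df Cf] j|Cf].
  split=> [x Vx|i]; first by have /diff_rV := df x Vx; apply.
  have /IH/(_ j) := Cf i; apply: Ck_ext => // x Vx; rewrite partialE //; exact: df.
have df x : V x -> differentiable f x.
  by move=> Vx; apply/diff_rV => j; have [h _] := Cf j; exact: h.
split=> // i; apply/IH => j; have [_ /(_ i)] := Cf j.
by apply: Ck_ext => // x Vx; rewrite partialE //; exact: df.
Qed.

Lemma jacobianE f x : differentiable f x -> 'J f x = jac f x.
Proof.
move=> df; apply/row_matrixP => i; rewrite !rowE.
by rewrite /jacobian mul_rV_lin1 -diff_jac.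
Qed.

Lemma row_jac f x i : differentiable f x -> row i ('J f x) = partial i f x.
Proof.
move=> df; rewrite jacobianE //; apply/rowP => j; rewrite !mxE partialE //.
Qed.

End regularity.

(** * Graphs and the stationarity equation *)

Section graph.
Context {R : realType} {n : nat}.
Variables (B : 'M[R]_(n, n.+1)) (e : 'rV[R]_n.+1).
Hypothesis fr : frame B e.

Definition graphmap (u : 'rV[R]_n -> R) (y : 'rV[R]_n) : 'rV[R]_n.+1 := y *m B + u y *: e.

Definition hproj (X : 'rV[R]_n.+1) : 'rV[R]_n := X *m B^T.

Lemma frame_split X : X = hproj X *m B + dot X e *: e.
Proof.
have [_ _ _ BB] := fr.
by rewrite -{1}[X]mulmx1 -BB mulmxDr !mulmxA mulmx_trE mul_scalar_mx.
Qed.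

Lemma hproj_graph u y : hproj (graphmap u y) = y.
Proof.
have [b1 b2 _ _] := fr.
by rewrite /hproj /graphmap mulmxDl -mulmxA b1 mulmx1 -scalemxAl -[e]trmxK -trmx_mul b2
  trmx0 scaler0 addr0.
Qed.

Lemma dot_graph u y : dot (graphmap u y) e = u y.
Proof.
have [_ b2 e1 _] := fr.
by rewrite /graphmap dotDl dotZl e1 mulr1 dotE -mulmxA b2 mulmx0 mxE add0r.
Qed.

Lemma dot_mulB v w : dot (v *m B) (w *m B) = dot v w.
Proof.
have [b1 _ _ _] := fr.
by rewrite !dotE trmx_mul mulmxA -[v *m B *m _]mulmxA b1 mulmx1.
Qed.

Lemma dot_mulBe v : dot (v *m B) e = 0.
Proof. by have [_ b2 _ _] := fr; rewrite dotE -mulmxA b2 mulmx0 mxE. Qed.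

Lemma sq_graph u y : dot (graphmap u y) (graphmap u y) = sq y + u y ^+ 2.
Proof.
have [_ _ e1 _] := fr.
rewrite /graphmap !(dotDl, dotDr) !(dotZl, dotZr) dot_mulB (dotC e) !dot_mulBe e1.
rewrite -[dot y y]/(sq y); ring.
Qed.

Definition gradv (u : 'rV[R]_n -> R) (y : 'rV[R]_n) : 'rV[R]_n := \row_i pd i u y.

Lemma graph_comp u j : (fun y => graphmap u y 0 j) = (fun y => (\sum_i y 0 i * B i j) + u y * e 0 j).
Proof. by apply/funext => y; rewrite !mxE. Qed.

Lemma Ck_graph k V u j : open V -> Ck k V u -> Ck k V (fun y => graphmap u y 0 j).
Proof.
move=> oV Cu; rewrite graph_comp; apply: (Ck_add oV).
  by apply: Ck_sum => // i _; apply: Ck_mul => //; [exact: Ck_coord|exact: Ck_cst].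
by apply: (Ck_mul oV Cu); exact: Ck_cst.
Qed.

Lemma diff_graph u y : differentiable u y -> differentiable (graphmap u) y.
Proof.
move=> du; apply: differentiableD; last exact: differentiableZl.
apply/diff_rV => j.
have H : Ck 1 setT (fun y : 'rV[R]_n => \sum_i y 0 i * B i j).
  by apply: Ck_sum => [|i _]; [exact: openT|apply: Ck_mul; [exact: openT|exact: Ck_coord|exact: Ck_cst]].
rewrite (_ : (fun y => _) = (fun y : 'rV[R]_n => \sum_i y 0 i * B i j)).
  exact: Ck_diff H I.
by apply/funext => z; rewrite mxE.
Qed.

Lemma partial_graph u i y : differentiable u y ->
  partial i (graphmap u) y = delta_mx 0 i *m B + pd i u y *: e.
Proof.
move=> du; apply/rowP => j; rewrite partialE; last exact: diff_graph.
rewrite graph_comp.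
have db k : differentiable (fun y : 'rV[R]_n => y 0 k * B k j) y.
  by apply: differentiableM; [exact: diff_coord|exact: differentiable_cst].
rewrite (pd_add _ (diff_sum _ (fun k _ => db k))); last first.
  by apply: differentiableM => //; exact: differentiable_cst.
rewrite pd_sum // [RHS]mxE -rowE !mxE; congr (_ + _).
  rewrite (bigD1 i) //= big1 ?addr0 => [|k ki].
    rewrite (pd_mul _ (diff_coord i y)); last exact: differentiable_cst.
    by rewrite pd_coord eqxx pd_cst mulr0 addr0 mul1r.
  rewrite (pd_mul _ (diff_coord k y)); last exact: differentiable_cst.
  by rewrite pd_coord eq_sym (negPf ki) pd_cst mulr0 addr0 mul0r.
rewrite (pd_mul _ du); last exact: differentiable_cst.
by rewrite pd_cst mulr0 addr0.
Qed.

Lemma partial2_graph V u i j y : open V -> V y -> Ck 2 V u ->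
  partial i (partial j (graphmap u)) y = pd i (pd j u) y *: e.
Proof.
move=> oV Vy Cu.
have dpu : differentiable (pd j u) y by exact: Ck_diff (Ck_pd j Cu) Vy.
rewrite [LHS](near_eq_derive _ (g := fun z => delta_mx 0 j *m B + pd j u z *: e)); last first.
  apply: (open_near oV Vy) => z Vz; apply: partial_graph; exact: Ck_diff Cu Vz.
have dZ : differentiable (fun z => pd j u z *: e) y by exact: differentiableZl.
pose c : 'rV[R]_n.+1 := delta_mx 0 j *m B.
have dc : differentiable (fun z => c + pd j u z *: e) y.
  by apply: differentiableD => //; exact: differentiable_cst.
rewrite -/c -/(partial i _ y); apply/rowP => l; rewrite partialE //.
have -> : (fun z => (c + pd j u z *: e) 0 l) = (fun z => c 0 l + pd j u z * e 0 l).
  by apply/funext => z; rewrite !mxE.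
rewrite (pd_add _ (diff_c (c 0 l) y) (diff_mul dpu (diff_c (e 0 l) y))) pd_cst add0r.
by rewrite (pd_mul _ dpu (diff_c _ y)) pd_cst mulr0 addr0 mxE.
Qed.

Lemma first_ff_graph u y : differentiable u y ->
  first_ff (graphmap u) y = 1%:M + (gradv u y)^T *m gradv u y.
Proof.
move=> du; have [_ _ e1 _] := fr.
apply/matrixP => i j; rewrite mxE !partial_graph // !(dotDl, dotDr) !(dotZl, dotZr).
rewrite dot_mulB (dotC e) !dot_mulBe e1 !mxE big_ord1 !mxE.
rewrite (_ : dot _ _ = (i == j)%:R); first by ring.
rewrite /dot (bigD1 i) //= big1 ?addr0 => [|k ki]; first by rewrite !mxE !eqxx mul1r /=.
by rewrite !mxE (negPf ki) andbF mul0r.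
Qed.

(** The Sherman-Morrison formula, which inverts the first fundamental form. *)
Lemma invmx_rank1 m (a : 'rV[R]_m) :
  invmx (1%:M + a^T *m a) = 1%:M - (1 + dot a a)^-1 *: (a^T *m a).
Proof.
have w0 : 1 + dot a a != 0.
  by rewrite gt_eqF // ltr_wpDr // sumr_ge0 // => i _; rewrite -expr2 sqr_ge0.
set M := 1%:M + _; set L := 1%:M - _.
have ML : M *m L = 1%:M.
  rewrite /M /L mulmxBr mulmx1 -scalemxAr mulmxDl mul1mx.
  rewrite -[a^T *m a *m (a^T *m a)]mulmxA [a *m (a^T *m a)]mulmxA mulmx_trE mul_scalar_mx.
  rewrite -scalemxAr; set K := a^T *m a.
  have -> : K + dot a a *: K = (1 + dot a a) *: K by rewrite scalerDl scale1r.
  by rewrite scalerA mulVf // scale1r addrK.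
have uM : M \in unitmx by have [] := mulmx1_unit ML.
by rewrite -[LHS]mulmx1 -ML mulmxA mulVmx // mul1mx.
Qed.

Lemma dot_gradv u y : dot (gradv u y) (gradv u y) = grad2 u y.
Proof. by apply: eq_bigr => i _; rewrite mxE. Qed.

Lemma row_free_graph u y : differentiable u y -> row_free ('J (graphmap u) y).
Proof.
move=> du; have dg := diff_graph du; have [b1 b2 _ _] := fr.
have JB : 'J (graphmap u) y *m B^T = 1%:M.
  apply/row_matrixP => i; rewrite row_mul row_jac // partial_graph // mulmxDl -mulmxA b1 mulmx1.
  by rewrite -scalemxAl -[e]trmxK -trmx_mul b2 trmx0 scaler0 addr0 row1.
rewrite /row_free eqn_leq rank_leq_row /=.
by have := mxrankM_maxl ('J (graphmap u) y) B^T; rewrite JB mxrank1.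
Qed.

Section pde.
Variables (alpha : R) (Sigma : set 'rV[R]_n.+1) (U : set 'rV[R]_n.+1) (N : set 'rV[R]_n).
Variable u : 'rV[R]_n -> R.
Hypotheses (oN : open N) (Cu : forall k, Ck k N u).
Hypothesis lp : local_param Sigma U N (graphmap u).
Hypothesis st : stationary alpha Sigma.

Let W y : R := Num.sqrt (1 + grad2 u y).
Let nu y : 'rV[R]_n.+1 := (W y)^-1 *: (e - gradv u y *m B).

Let W2 y : W y ^+ 2 = 1 + grad2 u y.
Proof. by rewrite sqr_sqrtr // addr_ge0 // grad2_ge0. Qed.

Let W0 y : W y != 0.
Proof. by rewrite gt_eqF // sqrtr_gt0 ltr_wpDr // grad2_ge0. Qed.

Let dnu X y : dot X (nu y) = (W y)^-1 * (dot X e - dot X (gradv u y *m B)).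
Proof. by rewrite dotZr dotDr -scaleN1r dotZr mulN1r. Qed.

Let nu_unit y : N y -> unit_normal (graphmap u) y (nu y).
Proof.
move=> Ny; have [_ _ e1 _] := fr; have du := Ck_diff (Cu 1) Ny.
have tan i : dot (partial i (graphmap u) y) (nu y) = 0.
  rewrite dnu partial_graph // !dotDl !dotZl dot_mulBe e1 dot_mulB (dotC e) dot_mulBe.
  rewrite (_ : dot _ _ = pd i u y); first by rewrite mulr0 addr0 add0r mulr1 subrr mulr0.
  by rewrite dotE -rowE !mxE.
split=> //; apply/eqP; rewrite -(@eqrXn2 _ 2) ?sqrtr_ge0 // enorm_sq expr1n dnu.
rewrite /nu !dotZl !dotDl !dotNl dot_mulBe (dotC e (_ *m B)) dot_mulBe e1.
rewrite dot_mulB dot_gradv; apply/eqP.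
have -> : grad2 u y = W y ^+ 2 - 1 by rewrite W2 addrAC subrr add0r.
by move: (W y) (W0 y) => w w0; field.
Qed.

(** Stationarity multiplied by |X|^2 W^3, where W^2 = 1 + |grad u|^2. In this form
the equation also holds at the origin, where both sides are 0. *)
Lemma graph_pde y : N y ->
  (sq y + u y ^+ 2) * ((1 + grad2 u y) * lap u y - hess3 u y) =
  alpha * ((1 + grad2 u y) * (u y - euler u y)).
Proof.
move=> Ny; have du := Ck_diff (Cu 1) Ny.
have [g0|g0] := eqVneq (graphmap u y) 0.
  have y0 : y = 0 by rewrite -(hproj_graph u y) g0 /hproj mul0mx.
  have u0 : u y = 0 by rewrite -(dot_graph u y) g0 dotE mul0mx mxE.
  have E0 : euler u y = 0 by rewrite y0 euler_at0.
  have s0 : sq y = 0 by rewrite y0 sq0.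
  by rewrite s0 u0 E0; ring.
have [nu1 tan] := nu_unit Ny.
have := st lp Ny g0 (conj nu1 tan).
have s0 : sq y + u y ^+ 2 != 0.
  by rewrite -sq_graph -[dot _ _]/(sq (graphmap u y)) sq_eq0.
rewrite -exprVn exprVn enorm_sq sq_graph.
have dphi : dot (graphmap u y) (nu y) = (W y)^-1 * (u y - euler u y).
  rewrite dnu dot_graph; congr (_ * (_ - _)).
  rewrite /graphmap dotDl dotZl (dotC e) dot_mulBe mulr0 addr0 dot_mulB.
  by apply: eq_bigr => i _; rewrite mxE.
(* The unit normal is orthogonal to the rows of the Jacobian, so the tangential
   correction in [normal_part] is invisible to it. *)
have dnorm w : dot (normal_part (graphmap u) y w) (nu y) = dot w (nu y).
  rewrite /normal_part dotDl dotNl.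
  rewrite [X in _ - X](_ : _ = 0) ?subr0 // dotE.
  set v := w *m _ *m _; rewrite -mulmxA.
  rewrite (_ : 'J (graphmap u) y *m (nu y)^T = 0) ?mulmx0 ?mxE //.
  apply/row_matrixP => i; rewrite row_mul row_jac ?row0; last exact: diff_graph.
  by rewrite mulmx_trE tan; apply/matrixP => a b; rewrite !mxE mul0rn.
have Hm : mean_curvature (graphmap u) y (nu y) =
   (W y)^-1 * (lap u y - (1 + grad2 u y)^-1 * hess3 u y).
  rewrite /mean_curvature /mean_curvature_vector dot_suml.
  under eq_bigr => i _ do rewrite dot_suml.
  have tm i j : dot (invmx (first_ff (graphmap u) y) i j *: second_ff (graphmap u) y i j) (nu y) =
     (W y)^-1 * ((i == j)%:R * pd i (pd j u) y -
      (1 + grad2 u y)^-1 * (pd i u y * pd j u y * pd i (pd j u) y)).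
    rewrite dotZl dnorm (partial2_graph _ _ oN Ny (Cu 2)) dotZl dnu (dotC e) dot_mulBe subr0.
    have [_ _ -> _] := fr.
    rewrite first_ff_graph // invmx_rank1 dot_gradv !mxE big_ord1 !mxE.
    by ring.
  under eq_bigr => i _ do under eq_bigr => j _ do rewrite tm.
  under eq_bigr => i _ do rewrite -mulr_sumr sumrB -mulr_sumr.
  rewrite -mulr_sumr sumrB -mulr_sumr; congr (_ * (_ - _)).
  apply: eq_bigr => i _; rewrite (bigD1 i) //= eqxx mul1r big1 ?addr0 // => j.
  by rewrite eq_sym => /negPf ->; rewrite mul0r.
rewrite Hm dphi => E.
have g1 : 1 + grad2 u y != 0 by rewrite -W2 expf_neq0.
have w0 := W0 y; have wi : (W y)^-1 != 0 by rewrite invr_eq0.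
move: E; rewrite mulrCA => /(mulfI wi) E.
move: E s0 g1; move: (lap u y) (hess3 u y) (u y - euler u y) (sq y + _) (1 + _) => l h q s g E s0 g1.
have -> : l = alpha * s^-1 * q + g^-1 * h by rewrite -E subrK.
by field; apply/andP.
Qed.

End pde.

End graph.

(** * A hypersurface is locally a graph *)

Section graph_chart.
Context {R : realType} {n : nat}.
Variables (B : 'M[R]_(n, n.+1)) (e : 'rV[R]_n.+1).
Hypothesis fr : frame B e.
Variables (Sigma U : set 'rV[R]_n.+1) (V : set 'rV[R]_n) (phi : 'rV[R]_n -> 'rV[R]_n.+1).
Hypothesis lp : local_param Sigma U V phi.
Variable x0 : 'rV[R]_n.
Hypothesis Vx0 : V x0.
Hypothesis tan : forall i, dot (partial i phi x0) e = 0.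

Definition ball_at (y0 : 'rV[R]_n) (r : R) : set 'rV[R]_n := [set y | sq (y - y0) < r].

Lemma open_ball_at y0 r : open (ball_at y0 r).
Proof.
have -> : ball_at y0 r = (fun y => y - y0) @^-1` [set y | sq y < r] by [].
by apply: open_comp => [y _|]; [exact: continuous_subr|exact: open_sqlt].
Qed.

Lemma height_pd i x : V x -> pd i (fun y => dot (phi y) e) x = dot (partial i phi x) e.
Proof.
have [[oU oV] sphi im rf [psi [cpsi psiK]]] := lp; move=> Vx.
have Cphi k := (class_CP k phi oV).1 (sphi k).
have dc j : differentiable (fun y => phi y 0 j * e 0 j) x.
  by apply: diff_mul (diff_c _ _); exact: Ck_diff (Cphi 1%N j) Vx.
rewrite /dot pd_sum //; apply: eq_bigr => j _.
have dphi : differentiable phi x by apply/diff_rV => j'; exact: Ck_diff (Cphi 1%N j') Vx.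
by rewrite (pd_mul _ (Ck_diff (Cphi 1%N j) Vx) (diff_c _ _)) pd_cst mulr0 addr0 partialE.
Qed.

Lemma Ck_height k : Ck k V (fun y => dot (phi y) e).
Proof.
have [[oU oV] sphi im rf [psi [cpsi psiK]]] := lp.
have Cphi := (class_CP k phi oV).1 (sphi k).
by apply: Ck_sum => // j _; apply: Ck_mul => //; exact: Ck_cst.
Qed.

(** The tangent space at [phi x0] is the hyperplane orthogonal to [e]; hence the
orthogonal projection of [phi] to this hyperplane has an invertible Jacobian at
[x0], and composing [phi] with a local inverse of it gives a graph. *)
Lemma graph_chart : exists (r : R) (U' : set 'rV[R]_n.+1) (u : 'rV[R]_n -> R),
  let N := ball_at (hproj B (phi x0)) r in
  [/\ 0 < r, U' (phi x0), forall k, Ck k N u, local_param Sigma U' N (graphmap B e u) &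
      forall i, pd i u (hproj B (phi x0)) = 0].
Proof.
have [[oU oV] sphi im rf [psi [cpsi psiK]]] := lp.
have Cphi k := (class_CP k phi oV).1 (sphi k).
have dphi x : V x -> differentiable phi x.
  by move=> Vx; apply/diff_rV => j; exact: Ck_diff (Cphi 1%N j) Vx.
pose F x := hproj B (phi x); pose f x := dot (phi x) e.
have CF k j : Ck k V (fun x => F x 0 j).
  rewrite (_ : (fun x => _) = fun x => \sum_l phi x 0 l * B^T l j); last first.
    by apply/funext => x; rewrite mxE.
  by apply: Ck_sum => // l _; apply: Ck_mul => //; exact: Ck_cst.
have [b1 b2 e1 BB] := fr.
have dF : differentiable F x0 by apply/diff_rV => j; exact: Ck_diff (CF 1%N j) Vx0.
have JF : jac F x0 = 'J phi x0 *m B^T.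
  apply/matrixP => i j; rewrite (jacobianE (dphi _ Vx0)) [LHS]mxE [RHS]mxE.
  rewrite (_ : (fun y => F y 0 j) = fun x => \sum_l phi x 0 l * B^T l j); last first.
    by apply/funext => x; rewrite mxE.
  rewrite pd_sum => [|l _]; last first.
    by apply: diff_mul (diff_c _ _); exact: Ck_diff (Cphi 1%N l) Vx0.
  apply: eq_bigr => l _; rewrite (pd_mul _ (Ck_diff (Cphi 1%N l) Vx0) (diff_c _ _)).
  by rewrite pd_cst mulr0 addr0 [in RHS]mxE.
have Je : 'J phi x0 *m e^T = 0.
  apply/row_matrixP => i; rewrite row_mul (row_jac _ (dphi _ Vx0)) mulmx_trE tan row0.
  by apply/matrixP => a b; rewrite !mxE mul0rn.
have uJ : jac F x0 \in unitmx.
  rewrite -row_free_unit JF /row_free eqn_leq rank_leq_row /=.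
  have {1}-> : n = \rank ('J phi x0) by have /eqP := rf x0 Vx0.
  have {1}-> : 'J phi x0 = ('J phi x0 *m B^T) *m B.
    by rewrite -{1}['J phi x0]mulmx1 -BB mulmxDr !mulmxA Je mul0mx addr0.
  exact: mxrankM_maxl.
have [N0 [V1 [G [[oN0 oV1] [N0F V1x V1V] HG GF CG]]]] := inverse_function oV Vx0 CF uJ.
have [d d0 Hd] := open_ball oN0 N0F.
pose y0 := F x0; pose N := ball_at y0 (d ^+ 2).
have oN : open N by exact: open_ball_at.
have NN0 : N `<=` N0.
  move=> y Ny; apply: Hd; rewrite -(@ltr_pXn2r _ 2) ?nnegrE //; last exact: ltW.
  exact: le_lt_trans (norm_sq _) Ny.
have Ny0 : N y0.
  by rewrite /N /ball_at /= subrr sq0 exprn_gt0.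
pose u y := f (G y).
have Cu k : Ck k N u.
  apply: (Ck_comp (V' := V) oN _ _ (Ck_height k)) => [y /NN0 /HG[V1G _]|j].
    exact: V1V.
  exact: Ck_sub NN0 (CG k j).
have gu y : N y -> graphmap B e u y = phi (G y).
  move=> /NN0 /HG[_ FG]; rewrite [RHS](frame_split fr) -[hproj B (phi _)]/(F (G y)) FG //.
pose V' : set 'rV[R]_n := V1 `&` F @^-1` N.
have oV' : forall x, V' x -> nbhs x V'.
  move=> x [V1x' NFx]; apply: filterI; first exact: open_nbhs_nbhs.
  have cF : {for x, continuous F}.
    by apply/cont_rV => j; exact: Ck_cont (CF 0%N j) (V1V _ V1x').
  by apply: cF; exact: open_nbhs_nbhs.
(* [U'] must contain no other points of [Sigma] than those of the graph. It is open
   around them because the inverse [psi] of the chart is continuous. *)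
pose U' : set 'rV[R]_n.+1 := U `&` interior [set X | Sigma X -> U X -> V' (psi X)].
have oU' : open U' by apply: openI => //; exact: open_interior.
have U'phi x : V' x -> U' (phi x).
  move=> V'x; have [V1x' NFx] := V'x; have Vx := V1V _ V1x'.
  have SU := param_in lp Vx; split; first by case: SU.
  have h : nbhs (psi (phi x)) V' by rewrite psiK //; exact: oV'.
  have w : within (Sigma `&` U) (nbhs (phi x)) (psi @^-1` V').
    by have /subspace_continuousP := cpsi; apply.
  have w' : nbhs (phi x) [set X | (Sigma `&` U) X -> V' (psi X)] := w.
  apply: (@filterS _ (nbhs (phi x)) _ _ _ _ w') => X /= H SX UX; exact: H.
have im' : graphmap B e u @` N = Sigma `&` U'.
  apply/seteqP; split => [X [y Ny <-]|X [SX [UX]]].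
    have [V1G FG] := HG y (NN0 _ Ny); rewrite gu //.
    have V'G : V' (G y) by split => //=; rewrite FG.
    split; last exact: U'phi.
    exact: (param_in lp (V1V _ V1G)).1.
  move=> /interior_subset /(_ SX UX) [V1p NFp].
  have [x Vx xX] := param_onto lp SX UX.
  have px : psi X = x by rewrite -xX psiK.
  rewrite px in V1p NFp; exists (F x) => //; rewrite gu // GF //; exact: NN0.
exists (d ^+ 2), U', u => /=; split.
- exact: exprn_gt0.
- by apply: U'phi; split.
- exact: Cu.
- split.
  + by split.
  + by move=> k; apply/(class_CP k _ oN) => j; exact: Ck_graph oN (Cu k).
  + exact: im'.
  + by move=> y Ny; apply: (row_free_graph fr); exact: Ck_diff (Cu 1%N) Ny.
  + exists (hproj B); split; last by move=> y _; exact: hproj_graph.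
    by apply: continuous_subspaceT => X; exact: continuous_mulmx.
- move=> i; have [dG] : differentiable G y0 /\ True.
    split=> //; apply/diff_rV => j; exact: Ck_diff (CG 1%N j) N0F.
  move=> _; have G0 : G y0 = x0 by exact: GF.
  have dfx : differentiable f (G y0) by rewrite G0; exact: Ck_diff (Ck_height 1) Vx0.
  rewrite -[hproj B (phi x0)]/y0 /u (pd_comp _ dG dfx) big1 // => j _.
  by rewrite G0 /f height_pd // tan mulr0.
Qed.

End graph_chart.

(** * Differential inequalities from the stationarity equation *)

Section pde_estimates.
Context {R : realType}.
Implicit Types (s g h l q E w K alpha M c S sz : R).

(** Here and below [s] stands for |x|^2, [g] for |grad u|^2, [h] for the Hessian at the
gradient, [l] for the Laplacian, [w] for u and [E] for x . grad u. *)
Lemma pde_bound alpha s sg g h l w E : 0 < s -> 0 <= g -> E ^+ 2 <= sg * g ->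
  (s + w ^+ 2) * ((1 + g) * l - h) = alpha * ((1 + g) * (w - E)) ->
  l = h / (1 + g) + alpha * (w - E) / (s + w ^+ 2) /\ (w - E) ^+ 2 <= 2 * (w ^+ 2 + sg * g).
Proof.
move=> s0 g0 HE pde; have w0 := sqr_ge0 w; split; last first.
  have : 0 <= (w + E) ^+ 2 by exact: sqr_ge0.
  by move: HE; rewrite !expr2; lra.
have g1 : 1 + g != 0 by rewrite gt_eqF //; lra.
have s1 : s + w ^+ 2 != 0 by rewrite gt_eqF //; lra.
move: pde g1 s1; move: (s + w ^+ 2) (1 + g) (w - E) => a b d pde b0 a0.
have -> : l = (b * l - h) / b + h / b by field.
have -> : b * l - h = alpha * (b * d) / a by rewrite -pde; field.
by field; apply/andP.
Qed.

Lemma hess_quot g h K : 0 <= g -> 0 <= K -> `|h| <= K * g -> (h / (1 + g)) ^+ 2 <= K ^+ 2 * g.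
Proof.
move=> g0 K0 hK; have g1 : 0 < 1 + g by lra.
have h2 : h ^+ 2 <= (K * g) ^+ 2.
  by rewrite -real_normK ?num_real // lerXn2r ?nnegrE // mulr_ge0.
rewrite expr_div_n ler_pdivrMr ?exprn_gt0 //; apply: le_trans h2 _.
have gg : g ^+ 2 <= g * (1 + g) ^+ 2.
  have h3 : 0 <= g * g * g by rewrite !mulr_ge0.
  have h4 : 0 <= g * g by rewrite mulr_ge0.
  by rewrite !expr2; lra.
rewrite (exprMn 2 K g) -(mulrA (K ^+ 2) g); exact: ler_wpM2l (sqr_ge0 K) _ _ gg.
Qed.

Lemma sqrD_le2 (a b : R) : (a + b) ^+ 2 <= 2 * a ^+ 2 + 2 * b ^+ 2.
Proof. by have : 0 <= (a - b) ^+ 2 by [exact: sqr_ge0|]; rewrite !expr2; lra. Qed.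

(** The bound |u|^2 <= M |x|^4 makes the coefficient s / (s + u^2) of the right-hand
side differ from 1 by at most M s, so that the equation is a perturbation of
[model_op alpha] to which [strong_unique_continuation] applies. *)
Lemma pde_bound_singular alpha s g h l w E K M : 0 < s <= 1 -> 0 <= g -> 0 <= K -> 0 <= M ->
  E ^+ 2 <= s * g -> `|h| <= K * g -> w ^+ 2 <= M * s ^+ 2 ->
  (s + w ^+ 2) * ((1 + g) * l - h) = alpha * ((1 + g) * (w - E)) ->
  (s * l + alpha * (E - w)) ^+ 2 <=
    (2 * K ^+ 2 + 4 * alpha ^+ 2 * M ^+ 2) * s * (s * g + w ^+ 2).
Proof.
move=> /andP[s0 s1] g0 K0 M0 HE hK wM pde.
have [-> dE] := pde_bound s0 g0 HE pde.
have hq := hess_quot g0 K0 hK.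
have w0 := sqr_ge0 w.
have sw : 0 < s + w ^+ 2 by lra.
pose t := w ^+ 2 / (s + w ^+ 2).
have tE : s * (h / (1 + g) + alpha * (w - E) / (s + w ^+ 2)) + alpha * (E - w) =
    s * (h / (1 + g)) + (- alpha) * (w - E) * t.
  rewrite /t; have : s + w ^+ 2 != 0 by rewrite gt_eqF.
  have : 1 + g != 0 by rewrite gt_eqF //; lra.
  by move=> a b; field; apply/andP.
have t0 : 0 <= t by rewrite divr_ge0 // ltW.
have tM : t <= M * s.
  rewrite ler_pdivrMr //; apply: le_trans wM _.
  by rewrite mulrDr (expr2 s) mulrA lerDl mulr_ge0 // mulr_ge0 // ltW.
have t2 : t ^+ 2 <= M ^+ 2 * s.
  apply: (@le_trans _ _ ((M * s) ^+ 2)); first by rewrite lerXn2r ?nnegrE // mulr_ge0 // ltW.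
  by rewrite exprMn ler_wpM2l ?sqr_ge0 // expr2 ler_piMr // ltW.
rewrite tE; apply: le_trans (sqrD_le2 _ _) _.
have e1 : (s * (h / (1 + g))) ^+ 2 <= s * (K ^+ 2 * (s * g)).
  have -> : (s * (h / (1 + g))) ^+ 2 = s * (s * (h / (1 + g)) ^+ 2) by ring.
  have -> : s * (K ^+ 2 * (s * g)) = s * (s * (K ^+ 2 * g)) by ring.
  exact: ler_wpM2l (ltW s0) _ _ (ler_wpM2l (ltW s0) hq).
have sg0 : 0 <= s * g by rewrite mulr_ge0 // ltW.
have e2 : (- alpha * (w - E) * t) ^+ 2 <= alpha ^+ 2 * (2 * (w ^+ 2 + s * g)) * (M ^+ 2 * s).
  have -> : (- alpha * (w - E) * t) ^+ 2 = alpha ^+ 2 * (w - E) ^+ 2 * t ^+ 2 by ring.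
  have q0 := mulr_ge0 (sqr_ge0 alpha) (sqr_ge0 (w - E)).
  exact: ler_pM q0 (sqr_ge0 t) (ler_wpM2l (sqr_ge0 alpha) dE) t2.
have k1 : 0 <= s * (K ^+ 2 * w ^+ 2) := mulr_ge0 (ltW s0) (mulr_ge0 (sqr_ge0 K) w0).
move: e1 e2 k1; rewrite (_ : alpha ^+ 2 * (2 * (w ^+ 2 + s * g)) * (M ^+ 2 * s) =
  2 * (alpha ^+ 2 * M ^+ 2 * s * (s * g + w ^+ 2))); last by ring.
rewrite (_ : (2 * K ^+ 2 + 4 * alpha ^+ 2 * M ^+ 2) * s * (s * g + w ^+ 2) =
  2 * (s * (K ^+ 2 * (s * g))) + 2 * (s * (K ^+ 2 * w ^+ 2)) +
  4 * (alpha ^+ 2 * M ^+ 2 * s * (s * g + w ^+ 2))); last by ring.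
move: ((s * _) ^+ 2) ((_ * t) ^+ 2) (s * (K ^+ 2 * (s * g))) (s * (K ^+ 2 * w ^+ 2))
  (alpha ^+ 2 * M ^+ 2 * s * _) => a1 a2 a3 a4 a5; clear; lra.
Qed.

(** When |x|^2 >= c the equation is a regular elliptic one: Lap u is bounded by |u|
and |grad u|. The additional factor [sz] is the squared distance to the point
from which uniqueness is continued. *)
Lemma pde_bound_regular alpha c S sz s g h l w E K : 0 < c <= s -> s <= S -> 0 <= sz <= 1 ->
  0 <= g -> 0 <= K -> E ^+ 2 <= s * g -> `|h| <= K * g ->
  (s + w ^+ 2) * ((1 + g) * l - h) = alpha * ((1 + g) * (w - E)) ->
  (sz * l) ^+ 2 <=
    (2 * K ^+ 2 + 4 * (alpha / c) ^+ 2 * (1 + S)) * sz * (sz * g + w ^+ 2).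
Proof.
move=> /andP[c0 cs] sS /andP[z0 z1] g0 K0 HE hK pde.
have s0 : 0 < s by exact: lt_le_trans c0 cs.
have [-> dE] := pde_bound s0 g0 HE pde.
have hq := hess_quot g0 K0 hK; have w0 := sqr_ge0 w.
have S0 : 0 <= S by apply: le_trans sS; exact: ltW.
have ac : (alpha * (w - E) / (s + w ^+ 2)) ^+ 2 <= (alpha / c) ^+ 2 * (2 * (1 + S) * (w ^+ 2 + g)).
  have -> : alpha * (w - E) / (s + w ^+ 2) = alpha / (s + w ^+ 2) * (w - E) by rewrite mulrAC.
  rewrite exprMn; apply: ler_pM; try exact: sqr_ge0.
    rewrite !expr_div_n; apply: ler_wpM2l; first exact: sqr_ge0.
    rewrite lef_pV2 ?posrE ?exprn_gt0 //; last by lra.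
    by rewrite lerXn2r ?nnegrE //; lra.
  apply: le_trans dE _; rewrite -mulrA; apply: ler_wpM2l => //.
  have h1 : s * g <= S * g by exact: ler_wpM2r.
  have h2 : 0 <= S * w ^+ 2 by exact: mulr_ge0.
  by move: h1 h2 g0; rewrite mulrDl !mulrDr !mul1r; lra.
set l' := h / _ + _.
have l2 : l' ^+ 2 <= (2 * K ^+ 2 + 4 * (alpha / c) ^+ 2 * (1 + S)) * (g + w ^+ 2).
  apply: le_trans (sqrD_le2 _ _) _.
  have k1 : 0 <= K ^+ 2 * w ^+ 2 := mulr_ge0 (sqr_ge0 K) w0.
  move: hq ac k1; move: ((h / _) ^+ 2) ((_ / (s + _)) ^+ 2) => a1 a2 h1 h2 h3.
  rewrite (_ : (2 * K ^+ 2 + 4 * (alpha / c) ^+ 2 * (1 + S)) * (g + w ^+ 2) =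
    2 * (K ^+ 2 * g) + 2 * (K ^+ 2 * w ^+ 2) + 2 * ((alpha / c) ^+ 2 * (2 * (1 + S) * (w ^+ 2 + g))));
    last by ring.
  by move: h1 h2 h3; clear; lra.
have C0 : 0 <= 2 * K ^+ 2 + 4 * (alpha / c) ^+ 2 * (1 + S).
  by apply: addr_ge0 (mulr_ge0 _ (sqr_ge0 K)) (mulr_ge0 (mulr_ge0 _ (sqr_ge0 _)) _); lra.
rewrite (exprMn 2 sz l'); apply: le_trans (ler_wpM2l (sqr_ge0 sz) l2) _.
move: C0; move: (2 * K ^+ 2 + _) => C C0.
have -> : sz ^+ 2 * (C * (g + w ^+ 2)) = C * (sz * (sz * (g + w ^+ 2))) by ring.
have -> : C * sz * (sz * g + w ^+ 2) = C * (sz * (sz * g + w ^+ 2)) by ring.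
apply: (ler_wpM2l C0); apply: (ler_wpM2l z0).
by rewrite mulrDr lerD2l ler_piMl.
Qed.

End pde_estimates.

Section sums.
Context {R : realType} {n : nat}.
Implicit Types (u : 'rV[R]_n -> R) (x y v : 'rV[R]_n).

Lemma cauchy_schwarz (a b : 'I_n -> R) :
  (\sum_i a i * b i) ^+ 2 <= (\sum_i a i * a i) * (\sum_i b i * b i).
Proof.
rewrite expr2 !mulr_suml.
have e : 0 <= \sum_i \sum_j (a i * b j - a j * b i) ^+ 2.
  by apply: sumr_ge0 => i _; apply: sumr_ge0 => j _; exact: sqr_ge0.
have e2 : \sum_i \sum_j (a i * b j - a j * b i) ^+ 2 =
   2 * (\sum_i a i * a i * (\sum_j b j * b j)) - 2 * (\sum_i a i * b i * (\sum_j a j * b j)).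
  transitivity (\sum_i \sum_j ((a i * a i) * (b j * b j)) +
     \sum_i \sum_j ((a j * a j) * (b i * b i)) - 2 * \sum_i \sum_j ((a i * b i) * (a j * b j))).
    rewrite mulr_sumr -big_split -sumrB; apply: eq_bigr => i _.
    rewrite mulr_sumr -big_split -sumrB; apply: eq_bigr => j _ /=; ring.
  rewrite [X in _ + X - _]exchange_big /=.
  have f1 : \sum_i \sum_j a i * a i * (b j * b j) = \sum_i a i * a i * (\sum_j b j * b j).
    by apply: eq_bigr => i _; rewrite mulr_sumr.
  have f2 : \sum_i \sum_j a i * b i * (a j * b j) = \sum_i a i * b i * (\sum_j a j * b j).
    by apply: eq_bigr => i _; rewrite mulr_sumr.
  by rewrite f1 f2; ring.
by rewrite e2 subr_ge0 ler_pM2l // in e.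
Qed.

Lemma euler_cs u x : euler u x ^+ 2 <= sq x * grad2 u x.
Proof. exact: cauchy_schwarz. Qed.

Lemma hess3_bound u x (K : R) : (forall i j, `|pd i (pd j u) x| <= K) ->
  `|hess3 u x| <= (n%:R ^+ 2 * K) * grad2 u x.
Proof.
move=> HK; apply: le_trans (ler_norm_sum _ _ _) _.
have g0 := grad2_ge0 u x.
have pg i : pd i u x * pd i u x <= grad2 u x.
  by rewrite /grad2 (bigD1 i) //= lerDl sumr_ge0 // => j _; rewrite -expr2 sqr_ge0.
have b i j : `|pd i u x * pd j u x * pd i (pd j u) x| <= K * grad2 u x.
  rewrite normrM mulrC; apply: ler_pM => //.
  have := pg i; have := pg j; move: (pd i u x) (pd j u x) (grad2 u x) => p q g h1 h2.
  have a1 : 0 <= (p - q) ^+ 2 by exact: sqr_ge0.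
  have a2 : 0 <= (p + q) ^+ 2 by exact: sqr_ge0.
  by move: a1 a2; rewrite !expr2 ler_norml => a1 a2; apply/andP; split; lra.
apply: (@le_trans _ _ (\sum_(i < n) \sum_(j < n) K * grad2 u x)).
  by apply: ler_sum => i _; apply: le_trans (ler_norm_sum _ _ _) _; apply: ler_sum.
rewrite !sumr_const card_ord le_eqVlt; apply/orP; left; apply/eqP.
by rewrite -[_ *+ n *+ n]mulrnA -[_ *+ _]mulr_natl natrM; ring.
Qed.

Lemma pd_shiftE i u v : pd i (fun y => u (y + v)) = (fun y => pd i u (y + v)).
Proof. by apply/funext => y; exact: pd_shift. Qed.

Lemma grad2_shift u v x : grad2 (fun y => u (y + v)) x = grad2 u (x + v).
Proof. by apply: eq_bigr => i _; rewrite pd_shift. Qed.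

Lemma lap_shift u v x : lap (fun y => u (y + v)) x = lap u (x + v).
Proof. by apply: eq_bigr => i _; rewrite pd_shiftE pd_shift. Qed.

End sums.

(** * The hypersurface near one of its points *)

Lemma half_le_of_close (R : realType) (t a b f : R) :
  f <= t -> t <= a / 2 -> a <= b + f -> a / 2 <= b.
Proof. lra. Qed.

Lemma sum_of_halves (R : realType) (a b t : R) : a < t / 2 -> b <= t / 2 -> b + a <= t.
Proof. lra. Qed.

Section local_uniqueness.
Context {R : realType} {n : nat}.
Variables (alpha : R) (Sigma : set 'rV[R]_n.+1).
Hypotheses (a0 : 0 < alpha) (emb : embedded_hypersurface Sigma) (st : stationary alpha Sigma).

(** Local containment of [Sigma] in the hyperplane orthogonal to [e], which is an open
condition on [p]. *)
Definition in_plane (e : 'rV[R]_n.+1) (p : 'rV[R]_n.+1) : Prop :=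
  Sigma p /\ exists O, [/\ open O, O p & forall X, Sigma X -> O X -> dot X e = 0].

Lemma graph_points (B : 'M[R]_(n, n.+1)) e U' N u X : frame B e ->
  local_param Sigma U' N (graphmap B e u) -> Sigma X -> U' X ->
  [/\ N (hproj B X), X = graphmap B e u (hproj B X) & dot X e = u (hproj B X)].
Proof.
move=> fr lp SX UX; have [y Ny <-] := param_onto lp SX UX.
by rewrite (hproj_graph fr) (dot_graph fr).
Qed.

Lemma in_plane_graph (B : 'M[R]_(n, n.+1)) e U' N u (W : set 'rV[R]_n) p : frame B e ->
  local_param Sigma U' N (graphmap B e u) -> Sigma p -> U' p -> open W -> W (hproj B p) ->
  (forall y, N y -> W y -> u y = 0) -> in_plane e p.
Proof.
move=> fr lp Sp Up oW Wp u0; split=> //.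
exists (U' `&` hproj B @^-1` W); split.
- apply: openI; first by case: lp => -[].
  by apply: open_comp => // X _; exact: continuous_mulmx.
- by split.
move=> X SX [UX WX]; have [NX _ ->] := graph_points fr lp SX UX.
exact: u0.
Qed.

Lemma hess_bounded (V : set 'rV[R]_n) u : Flat 2 V u -> exists2 K : R, 0 <= K &
  forall x, V x -> sq x <= 1 -> forall i j, `|pd i (pd j u) x| <= K.
Proof.
move=> Fu.
have /choice[C HC] : forall ij : 'I_n * 'I_n, exists C : R, 0 <= C /\
    forall x, V x -> sq x <= 1 -> `|pd ij.1 (pd ij.2 u) x| <= C.
  move=> [i j] /=; case: Fu => _ [_ /(_ j) [_ [_ /(_ i) [/(_ 0%N) [C C0 H] _]]]].
  by exists C; split => // x Vx x1; rewrite -[leRHS]mulr1; exact: H.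
have K0 : 0 <= \sum_ij C ij by apply: sumr_ge0 => ij _; have [] := HC ij.
exists (\sum_ij C ij) => // x Vx x1 i j.
have [_ H] := HC (i, j); apply: le_trans (H x Vx x1) _.
by rewrite (bigD1 (i, j)) //= lerDl sumr_ge0 // => ij _; have [] := HC ij.
Qed.

Lemma normal_exists U V phi x0 : local_param Sigma U V phi -> V x0 ->
  exists e, dot e e = 1 /\ forall i, dot (partial i phi x0) e = 0.
Proof.
move=> [[oU oV] sphi im rf _] Vx0.
have dphi : differentiable phi x0.
  by apply/diff_rV => j; exact: Ck_diff ((class_CP 1 phi oV).1 (sphi 1%N) j) Vx0.
pose J := 'J phi x0.
have : kermx J^T != 0.
  rewrite -mxrank_eq0 mxrank_ker mxrank_tr subn_eq0 -ltnNge.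
  by have /eqP -> := rf x0 Vx0.
case/rowV0Pn => v /sub_kermxP vJ v0.
have vv : 0 < dot v v by rewrite -[dot v v]/(sq v) sq_gt0.
have w0 : enorm v != 0 by rewrite gt_eqF // sqrtr_gt0.
exists ((enorm v)^-1 *: v); split.
  by rewrite dotZl dotZr mulrA -expr2 -enorm_sq exprVn mulVf // expf_neq0.
move=> i; rewrite -row_jac // dotZr dotC dotE tr_row colE mulmxA -/J vJ mul0mx mxE.
by rewrite mulr0.
Qed.

(** Over its tangent hyperplane at 0, [Sigma] is the graph of a function that vanishes
to second order, hence to infinite order by [flat_of_pde], hence identically near
0 by [strong_unique_continuation]. *)
Lemma plane_at_origin : Sigma 0 -> exists e, dot e e = 1 /\ in_plane e 0.
Proof.
move=> S0; have [U [V [phi [U0 lp]]]] := emb S0.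
have [x0 Vx0 phi0] := param_onto lp S0 U0.
have [e [e1 tan]] := normal_exists lp Vx0.
have [B fr] := frame_exists e1; exists e; split => //.
have [r [U' [u]]] := graph_chart fr lp Vx0 tan; rewrite phi0 /=.
have p0 : hproj B 0 = 0 by rewrite /hproj mul0mx.
rewrite p0; set N := ball_at 0 r; move=> [r0 U'0 Cu lpu du].
have oN : open N by exact: open_ball_at.
have s0 := @sq0 R n.
have N0 : N 0 by rewrite /N /ball_at /= subr0 s0.
have u0 : u 0 = 0.
  by have [_ _] := graph_points fr lpu S0 U'0; rewrite p0 dotE mul0mx mxE => <-.
have u2 : Oh N 2 u.
  split; first exact: Cu.
  split=> // i; split; first exact: smooth_pd.
  by split=> // j; split=> //; do 2!apply: smooth_pd.
have flat := flat_of_pde oN N0 a0 u2 (graph_pde fr oN Cu lpu st).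
have [r1 r10 Hr1] := Oh_Flat oN N0 flat.
pose r' := Num.min r1 (1 / 2).
have r'0 : 0 < r' by rewrite lt_min r10 divr_gt0.
have r'1 : r' < 1 by rewrite gt_min; apply/orP; right; lra.
have [NV Fu] := Hr1 r' ltac:(by rewrite r'0 ge_min lexx).
have [K K0 HK] := hess_bounded Fu.
have [M M0 HM] := Flat_flat0 Fu 1%N.
have le1 (x : 'rV[R]_n) : sq x < r' -> sq x <= 1 by move=> h; apply/ltW/(lt_trans h).
pose C := 2 * (n%:R ^+ 2 * K) ^+ 2 + 4 * alpha ^+ 2 * (M ^+ 2) ^+ 2.
have C0 : 0 <= C.
  by apply: addr_ge0; apply: mulr_ge0; rewrite ?sqr_ge0 // mulr_ge0 // sqr_ge0.
have ineq x : sq x < r' -> model_op alpha u x ^+ 2 <= C * sq x * (sq x * grad2 u x + u x ^+ 2).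
  move=> xr; have [->|x0'] := eqVneq x 0.
    rewrite /model_op s0 u0.
    by rewrite euler_at0 !(mul0r, mulr0, subr0, addr0, expr0n).
  have sx : 0 < sq x <= 1 by rewrite sq_gt0 x0' le1.
  have nK : 0 <= n%:R ^+ 2 * K by rewrite mulr_ge0 // exprn_ge0.
  have hK := hess3_bound (HK x xr (le1 x xr)).
  have uM : u x ^+ 2 <= M ^+ 2 * sq x ^+ 2.
    rewrite -exprMn -real_normK ?num_real // lerXn2r ?nnegrE //.
      by rewrite mulr_ge0 // sq_ge0.
    by have := HM x xr (le1 x xr); rewrite expr1.
  exact: pde_bound_singular sx (grad2_ge0 u x) nK (sqr_ge0 M) (euler_cs u x) hK uM
    (graph_pde fr oN Cu lpu st (NV x xr)).
have rr : 0 < r' < 1 by rewrite r'0 r'1.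
have uz := strong_unique_continuation rr (ltW a0) C0 Fu ineq.
apply: (in_plane_graph fr lpu S0 U'0 (@open_sqlt R n (r' / 4))).
  by rewrite p0 /= s0 divr_gt0.
by move=> y _; exact: uz.
Qed.

(** Let [p] be a limit of points near which [Sigma] lies in the hyperplane orthogonal
to [e]. By continuity the tangent space at [p] is that hyperplane, over which
[Sigma] is the graph of some [u] near [p]. This [u] vanishes near points y1 as
close as desired to the projection y0 of [p]. The equation is regular near y0, so
unique continuation from y1 gives a ball of fixed radius on which [u] vanishes, and
which contains y0 if y1 was chosen close enough. *)
Lemma propagate e p : dot e e = 1 -> Sigma p -> p != 0 ->
  (forall O, open O -> O p -> exists X, in_plane e X /\ O X) -> in_plane e p.
Proof.
move=> e1 Sp p0 acc.
have [U [V [phi [Up lp]]]] := emb Sp.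
have [x0 Vx0 phip] := param_onto lp Sp Up.
have [[oU oV] sphi im rf [psi [cpsi psiK]]] := lp.
have cphi x : V x -> {for x, continuous phi} by exact: (sphi 0%N).
(* [acc] pulled back to the chart, by continuity of its inverse [psi]. *)
have near_pts (W : set 'rV[R]_n) : open W -> W x0 ->
    exists x, [/\ W x, V x & in_plane e (phi x)].
  move=> oW Wx0.
  have h : nbhs (psi p) W by rewrite -phip psiK //; exact: open_nbhs_nbhs.
  have w : within (Sigma `&` U) (nbhs p) (psi @^-1` W).
    by have /subspace_continuousP := cpsi; apply.
  have w' : nbhs p [set X | (Sigma `&` U) X -> W (psi X)] := w.
  have [||X [PX [UX intX]]] := acc (U `&` interior [set X | (Sigma `&` U) X -> W (psi X)]).
  - by apply: openI => //; exact: open_interior.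
  - by split.
  have SX := PX.1; have /interior_subset WX := intX.
  have [x Vx xX] := param_onto lp SX UX.
  have px : psi X = x by rewrite -xX psiK.
  exists x; split => //; last by rewrite xX.
  by rewrite -px; exact: WX.
have height0 x : V x -> in_plane e (phi x) ->
    exists W : set 'rV[R]_n, [/\ open W, W x & forall y, W y -> V y /\ dot (phi y) e = 0].
  move=> Vx [_ [Q [oO Ox HO]]].
  have : nbhs x (V `&` phi @^-1` Q).
    apply: filterI; first exact: open_nbhs_nbhs.
    by apply: cphi => //; exact: open_nbhs_nbhs.
  rewrite nbhsE => -[W [oW Wx] WV]; exists W; split => // y /WV[Vy Oy]; split => //.
  exact: HO (param_in lp Vy).1 Oy.
have tan i : dot (partial i phi x0) e = 0.
  rewrite -(height_pd e lp i Vx0); apply/eqP/negP => /negP nz.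
  pose f := pd i (fun y => dot (phi y) e).
  have cf : {for x0, continuous f} by exact: Ck_cont (Ck_pd i (Ck_height e lp 1)) Vx0.
  have : nbhs x0 (V `&` f @^-1` [set t | t != 0]).
    apply: filterI; first exact: open_nbhs_nbhs.
    by apply: cf; apply: open_nbhs_nbhs; split => //; exact: open_neq.
  rewrite nbhsE => -[W [oW Wx] WV].
  have [x [Wx' Vx Px]] := near_pts W oW Wx.
  have [W' [oW' W'x HW']] := height0 x Vx Px.
  have [_ /=] := WV x Wx'; apply/negP; rewrite negbK; apply/eqP.
  by rewrite /f (eq0_pd oW' _ i W'x) // => y /HW'[].
have [B fr] := frame_exists e1.
have [r [U' [u]]] := graph_chart fr lp Vx0 tan; rewrite phip /=.
set y0 := hproj B p; set N := ball_at y0 r; move=> [r0 U'p Cu lpu du].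
have oN : open N by exact: open_ball_at.
have [Ny0 pE pe] := graph_points fr lpu Sp U'p.
have pe0 : dot p e = 0.
  apply/eqP/negP => /negP nz.
  have [|X [[SX [Q [oO OX HO]]] /=]] := acc [set X | dot X e != 0] _ nz.
    have -> : [set X : 'rV[R]_n.+1 | dot X e != 0] = (fun X => dot X e) @^-1` [set t | t != 0] by [].
    apply: open_comp; last exact: open_neq.
    move=> X _; have H : Ck 0 setT (fun X : 'rV[R]_n.+1 => dot X e).
      by apply: Ck_sum => [|j _]; [exact: openT|apply: Ck_mul; [exact: openT|exact: Ck_coord|exact: Ck_cst]].
    exact: H.
  by rewrite HO // eqxx.
have y00 : y0 != 0.
  apply: contra p0 => /eqP y00; apply/eqP.
  by rewrite (frame_split fr p) -/y0 y00 pe0 mul0mx scale0r addr0.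
have [d1 d10 Hd1] := open_ball oN Ny0.
pose d := Num.min (d1 / 2) (`|y0| / 2).
have ny0 : 0 < `|y0| by rewrite normr_gt0.
have d0 : 0 < d by rewrite lt_min !divr_gt0.
have dN y : `|y - y0| <= d -> N y.
  move=> yd; apply: Hd1; apply: le_lt_trans yd _.
  by rewrite gt_min; apply/orP; left; lra.
have dlow y : `|y - y0| <= d -> `|y0| / 2 <= `|y|.
  move=> yd; have h1 : d <= `|y0| / 2 by rewrite ge_min lexx orbT.
  have := ler_normD y (y0 - y); rewrite addrC subrK [in X in _ <= X]distrC => h2.
  exact: half_le_of_close yd h1 h2.
(* The ball |y - y1|^2 < r' is within distance d of y0 as soon as y1 is within
   d / 2, and there |y| stays away from 0. *)
pose r' := Num.min (1 / 2) ((d / 2) ^+ 2).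
have r'0 : 0 < r' by rewrite lt_min exprn_gt0 divr_gt0.
have r'1 : r' < 1 by rewrite gt_min; apply/orP; left; lra.
have r'd : r' <= (d / 2) ^+ 2 by rewrite ge_min lexx orbT.
have [y1 [y1d y1s [ep ep0 Hep]]] : exists y1 : 'rV[R]_n, [/\ `|y1 - y0| < d / 2, sq (y0 - y1) < r' / 4 &
    exists2 ep : R, 0 < ep & forall y, `|y - y1| < ep -> u y = 0].
  have [||X [PX [UX [Xd Xs]]]] := acc (U' `&` (hproj B @^-1` [set y : 'rV[R]_n | `|y - y0| < d / 2] `&`
     hproj B @^-1` [set y : 'rV[R]_n | sq (y0 - y) < r' / 4])).
  - apply: openI; first by case: lpu => -[].
    apply: openI; apply: open_comp => [X _|]; try exact: continuous_mulmx.
      exact: (open_norm_lt (@continuous_subr R n y0)).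
    have -> : [set y : 'rV[R]_n | sq (y0 - y) < r' / 4] = ball_at y0 (r' / 4).
      by apply/seteqP; split => y; rewrite /ball_at /= -opprB -[sq (- _)]/(dot _ _) -scaleN1r
        dotZl dotZr !mulN1r opprK.
    exact: open_ball_at.
  - split=> //; split => /=; first by rewrite subrr normr0 divr_gt0.
    by rewrite subrr sq0 divr_gt0.
  exists (hproj B X); split => //.
  have [SX [Q [oO OX HO]]] := PX.
  have [NX XE _] := graph_points fr lpu SX UX.
  have cg : {for hproj B X, continuous (graphmap B e u)}.
    by apply: differentiable_continuous; apply: diff_graph; exact: Ck_diff (Cu 1%N) NX.
  have : nbhs (hproj B X) (N `&` graphmap B e u @^-1` Q).
    apply: filterI; first exact: open_nbhs_nbhs.
    by apply: cg; rewrite -XE; exact: open_nbhs_nbhs.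
  move=> /nbhs_ballP[ep ep0 Hep]; exists ep => // y yX.
  have [Ny Oy] : (N `&` graphmap B e u @^-1` Q) y.
    by apply: Hep; rewrite -ball_normE /= distrC.
  rewrite -(dot_graph fr u y); exact: HO (param_in lpu Ny).1 Oy.
pose v z := u (z + y1).
pose D : set 'rV[R]_n := [set z | sq z < r'].
have oD : open D by exact: open_sqlt.
have Dd z : D z -> `|z + y1 - y0| <= d.
  move=> Dz; rewrite -addrA; apply: le_trans (ler_normD _ _) _.
  have : `|z| <= d / 2.
    rewrite -(@ler_pXn2r _ 2) ?nnegrE //; last by rewrite divr_ge0 // ltW.
    by apply: le_trans (norm_sq z) _; apply: le_trans r'd; exact: ltW.
  exact: sum_of_halves.
have DN z : D z -> N (z + y1) by move=> /Dd /dN.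
have CvD k (g : 'rV[R]_n -> R) : Ck k N g -> Ck k D (fun z => g (z + y1)).
  move=> Cg; apply: (Ck_comp oD DN _ Cg) => j.
  have -> : (fun y : 'rV[R]_n => (y + y1) 0 j) = (fun y => y 0 j + y1 0 j).
    by apply/funext => y; rewrite mxE.
  by apply: Ck_add => //; [exact: Ck_coord|exact: Ck_cst].
(* A function that vanishes near the centre of the ball is flat there. *)
have F0 (g : 'rV[R]_n -> R) : Ck 0 N g -> (forall y, `|y - y1| < ep -> g y = 0) ->
    flat0 D (fun z => g (z + y1)).
  move=> Cg g0 m.
  have [x xd|M M0 H] := @cont_bounded _ _ (fun x => g (x + y0)) d.
    apply: (@continuous_comp _ _ _ (fun x : 'rV[R]_n => x + y0) g).
      by apply: continuousD; [exact: cvg_id|exact: cst_continuous].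
    by apply: Cg; apply: dN; rewrite addrK.
  have em : 0 < (ep ^+ 2) ^+ m by rewrite !exprn_gt0.
  exists (M / (ep ^+ 2) ^+ m) => [|z Dz z1]; first by rewrite divr_ge0 // ltW.
  have [ze|ze] := ltP `|z| ep.
    rewrite g0 ?addrK // normr0 mulr_ge0 ?exprn_ge0 ?sq_ge0 // divr_ge0 //; exact: ltW.
  rewrite mulrAC ler_pdivlMr //; apply: ler_pM => //; first exact: ltW.
    by have := H _ (Dd z Dz); rewrite subrK.
  apply: lerXn2r; rewrite ?nnegrE ?sqr_ge0 ?sq_ge0 //.
  by apply: le_trans (norm_sq z); rewrite lerXn2r ?nnegrE // ltW.
have oep : open [set y : 'rV[R]_n | `|y - y1| < ep].
  exact: (open_norm_lt (@continuous_subr R n y1)).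
have Fv : Flat 2 D v.
  have gen j (g : 'rV[R]_n -> R) : (forall k, Ck k N g) -> (forall y, `|y - y1| < ep -> g y = 0) ->
      Flat j D (fun z => g (z + y1)).
    elim: j g => [|j IH] g Cg g0; split; try exact: F0.
      exact: CvD (Cg 0%N).
    split=> [z Dz|i]; first exact: Ck_diff (CvD 1%N g (Cg 1%N)) Dz.
    rewrite pd_shiftE; apply: IH => [k|y yep]; first exact: Ck_pd i (Cg k.+1).
    exact: (eq0_pd oep g0).
  exact: gen.
have [K K0 HK] := hess_bounded Fv.
pose c := (`|y0| / 2) ^+ 2.
have c0 : 0 < c by rewrite exprn_gt0 // divr_gt0.
pose S := n%:R * (`|y0| + d) ^+ 2.
have yS y : `|y - y0| <= d -> c <= sq y <= S.
  move=> yd; apply/andP; split.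
    apply: le_trans (norm_sq y); rewrite lerXn2r ?nnegrE ?dlow // divr_ge0 //.
  apply: le_trans (sq_norm y) _; apply: ler_wpM2l => //.
  rewrite lerXn2r ?nnegrE ?addr_ge0 //; first exact: ltW.
  have := ler_normD y0 (y - y0); rewrite addrC subrK => h; apply: le_trans h _.
  by rewrite lerD2l.
pose C := 2 * (n%:R ^+ 2 * K) ^+ 2 + 4 * (alpha / c) ^+ 2 * (1 + S).
have S0 : 0 <= S by rewrite mulr_ge0 // sqr_ge0.
have C0 : 0 <= C.
  apply: addr_ge0; first by rewrite mulr_ge0 // sqr_ge0.
  by apply: mulr_ge0; [rewrite mulr_ge0 // sqr_ge0|rewrite addr_ge0].
have ineq z : D z -> model_op 0 v z ^+ 2 <= C * sq z * (sq z * grad2 v z + v z ^+ 2).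
  move=> Dz; have z1 : sq z <= 1 by apply/ltW/(lt_trans Dz).
  rewrite /model_op mul0r addr0 /v grad2_shift lap_shift.
  have /andP[yc yS'] := yS _ (Dd z Dz).
  have hb : forall i j, `|pd i (pd j u) (z + y1)| <= K.
    by move=> i j; have := HK z Dz z1 i j; rewrite /v !pd_shiftE.
  have nK : 0 <= n%:R ^+ 2 * K by rewrite mulr_ge0 // exprn_ge0.
  have cc : 0 < c <= sq (z + y1) by rewrite c0.
  have zz : 0 <= sq z <= 1 by rewrite sq_ge0.
  exact: pde_bound_regular cc yS' zz (grad2_ge0 u _) nK (euler_cs u _) (hess3_bound hb)
    (graph_pde fr oN Cu lpu st (DN z Dz)).
have rr : 0 < r' < 1 by rewrite r'0 r'1.
have vz := strong_unique_continuation rr (lexx 0) C0 Fv ineq.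
apply: (in_plane_graph fr lpu Sp U'p (@open_ball_at R n y1 (r' / 4))).
  by [].
move=> y _ Wy; have := vz (y - y1) Wy; rewrite /v subrK; exact.
Qed.

End local_uniqueness.

(** * Curves, length and completeness *)

Section curves.
Context {R : realType} {m : nat}.
Variable Sigma : set 'rV[R]_m.

Let mu := @lebesgue_measure R.

Lemma continuous_enorm : continuous (fun v : 'rV[R]_m => enorm v).
Proof.
move=> v; apply: (@continuous_comp _ _ _ (fun v : 'rV[R]_m => sq v) Num.sqrt).
  exact: (Ck_sq 0 openT v I).
exact: sqrt_continuous.
Qed.

Lemma coord_le_enorm (v : 'rV[R]_m) j : `|v 0 j| <= enorm v.
Proof.
rewrite -(@ler_pXn2r _ 2) ?nnegrE ?sqrtr_ge0 // enorm_sq.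
by apply: le_trans (norm_sq v); rewrite lerXn2r ?nnegrE // norm_coord.
Qed.

Lemma integrable_unit (f : R -> R) : continuous f ->
  mu.-integrable `[0%R, 1%R] (EFin \o f).
Proof.
move=> cf; apply: (@continuous_compact_integrable R f); first exact: segment_compact.
exact: continuous_subspaceT.
Qed.

(** Fundamental theorem of calculus for the coordinate [j]. It makes convergence for
the intrinsic distance imply convergence of the coordinates. *)
Lemma displacement_le_length a b (gamma : R -> 'rV[R]_m) j :
  C1_curve_in Sigma a b gamma -> (`|b 0 j - a 0 j|%:E <= curve_length gamma)%E.
Proof.
move=> [dg cg _ <- <-].
pose g (t : R) : R := gamma t 0 j.
have dg' t : derivable g t 1 by exact: (derivable_mxP gamma t 1).1 (dg t) 0 j.
have gE t : derive1 g t = (derive1 gamma t) 0 j.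
  by rewrite !derive1E (derive_mx (dg t)) mxE.
have cg' : continuous (derive1 g).
  move=> t; rewrite (_ : derive1 g = fun t => derive1 gamma t 0 j); last by apply/funext.
  by apply: (cont_rV _ _).2; exact: cg.
have cont t : {for t, continuous g}.
  by apply: differentiable_continuous; apply/derivable1_diffP; exact: dg'.
have FTC : (\int[mu]_(x in `[0%R, 1%R]) (derive1 g x)%:E = (g 1)%:E - (g 0)%:E)%E.
  apply: continuous_FTC2 ltr01 (continuous_subspaceT cg') _ (fun _ _ => erefl).
  by split=> [t _| |]; [exact: dg'|exact: cvg_at_right_filter (cont 0)|exact: cvg_at_left_filter (cont 1)].
rewrite -[X in `|X|]/(g 1 - g 0) -abse_EFin EFinB -FTC.
have mg := measurable_int mu (integrable_unit cg').
have H := le_abse_integral mu _ mg.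
apply: le_trans (H _) _ => //.
apply: ge0_le_integral => //.
- apply: (measurable_int mu (integrable_unit (f := fun t => `|derive1 g t|) _)) => t.
  by apply: (continuous_comp (cg' t)); exact: norm_continuous.
- apply: (measurable_int mu (integrable_unit (f := fun t => enorm (derive1 gamma t)) _)) => t.
  by apply: (continuous_comp (cg t)); exact: continuous_enorm.
- by move=> t _; rewrite abse_EFin lee_fin gE coord_le_enorm.
Qed.

Lemma displacement_le_dist (a b : 'rV[R]_m) j :
  (`|b 0 j - a 0 j|%:E <= intrinsic_dist Sigma a b)%E.
Proof.
by apply: le_ereal_inf_tmp => _ [gamma /displacement_le_length H <-]; exact: H.
Qed.

Lemma segment_dist (q : 'rV[R]_m) (s t : R) :
  (forall w, 0 <= w <= 1 -> Sigma ((s + w * (t - s)) *: q)) ->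
  (intrinsic_dist Sigma (s *: q) (t *: q) <= (`|t - s| * enorm q)%:E)%E.
Proof.
move=> seg; apply: ge_ereal_inf.
pose gamma w : 'rV[R]_m := (s + w * (t - s)) *: q.
have D (w : R) j : is_derive w (1 : R) (fun w : R => gamma w 0 j : R) ((t - s) * q 0 j).
  rewrite (_ : (fun w : R => gamma w 0 j : R) = (fun w => (s + w * (t - s)) * q 0 j)); last first.
    by apply/funext => x; rewrite mxE.
  by apply: is_derive_eq; rewrite !(scaler0, add0r, addr0) mul1r /GRing.scale /= mulr1 mulrC.
have dg w : derivable gamma w 1.
  by apply/derivable_mxP => i j; rewrite ord1; have [] := D w j.
have gE : derive1 gamma = fun=> (t - s) *: q.
  apply/funext => w; rewrite derive1E (derive_mx (dg w)); apply/rowP => j.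
  by rewrite !mxE; have [_ ->] := D w j.
exists (curve_length gamma); last first.
  rewrite /curve_length gE.
  rewrite integral_cst //= lebesgue_measure_itv /= lte_fin ltr01 oppr0 adde0 mule1 lee_fin.
  by rewrite /enorm dotZl dotZr mulrA -expr2 sqrtrM ?sqr_ge0 // sqrtr_sqr lexx.
exists gamma; last by [].
split; first exact: dg.
- by rewrite gE; exact: cst_continuous.
- exact: seg.
- by rewrite /gamma mul0r addr0.
- by rewrite /gamma mul1r addrC subrK.
Qed.

Lemma small_fraction (a e : R) : 0 <= a -> 0 < e -> exists N, forall k, (N <= k)%N -> a / k.+1%:R < e.
Proof.
move=> a0 e0; exists (Num.bound (a / e)) => k Nk.
have h := archi_boundP (divr_ge0 a0 (ltW e0)).
rewrite ltr_pdivrMr // mulrC -ltr_pdivrMr //; apply: lt_trans h _.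
by rewrite ltr_nat ltnS.
Qed.

(** The points of the ray approaching the parameter [T] form a Cauchy sequence for the
intrinsic distance, because the segments between them stay in [Sigma]; its limit
in [Sigma] can only be [T *: q]. *)
Lemma ray_limit (q : 'rV[R]_m) (T : R) : complete_hypersurface Sigma -> 0 < T ->
  (forall s, 0 <= s < T -> Sigma (s *: q)) -> Sigma (T *: q).
Proof.
move=> cS T0 ray.
pose s k : R := T - T / k.+1%:R.
have sT k : 0 <= s k < T.
  apply/andP; split; last by rewrite gtrBl divr_gt0.
  by rewrite subr_ge0 ler_pdivrMr // ler_peMr ?(ltW T0) // ler1n.
have sd k l N : (N <= k)%N -> (N <= l)%N -> `|s l - s k| <= T / N.+1%:R.
  have b i : (N <= i)%N -> 0 <= T / i.+1%:R <= T / N.+1%:R.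
    move=> Ni; apply/andP; split; first by rewrite divr_ge0 // ltW.
    by apply: ler_wpM2l; [exact: ltW|rewrite lef_pV2 ?posrE ?ltr0Sn // ler_nat ltnS].
  move=> /b /andP[k1 k2] /b /andP[l1 l2]; rewrite /s.
  move: (T / k.+1%:R) (T / l.+1%:R) (T / N.+1%:R) k1 k2 l1 l2 => a c d k1 k2 l1 l2.
  by rewrite ler_norml; apply/andP; split; lra.
have [||p [Sp cvp]] := cS (fun k => s k *: q).
- by move=> k; exact: ray.
- move=> e e0; have q0 : 0 <= enorm q by exact: sqrtr_ge0.
  have [N HN] := small_fraction (mulr_ge0 (ltW T0) q0) e0.
  exists N => k l Nk Nl; apply: (@le_lt_trans _ _ (`|s l - s k| * enorm q)%:E).
    apply: segment_dist => w /andP[w0 w1]; apply: ray.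
    have /andP[k0 k1] := sT k; have /andP[l0 l1] := sT l.
    have -> : s k + w * (s l - s k) = (1 - w) * s k + w * s l by ring.
    have w1' : 0 <= 1 - w by rewrite subr_ge0.
    apply/andP; split; first by rewrite addr_ge0 ?mulr_ge0.
    have [w1E|wn1] := eqVneq w 1; first by rewrite w1E subrr mul0r add0r mul1r.
    have w1'' : 0 < 1 - w by rewrite subr_gt0 lt_neqAle wn1.
    have -> : T = (1 - w) * T + w * T by ring.
    by apply: ltr_leD; [rewrite ltr_pM2l|rewrite ler_wpM2l // ltW].
  rewrite lte_fin; apply: le_lt_trans (HN N (leqnn N)).
  by rewrite mulrAC; apply: ler_wpM2r => //; exact: sd.
suff -> : T *: q = p by [].
apply/rowP => j; rewrite mxE; apply/eqP; rewrite -subr_eq0 -normr_le0 leNgt; apply/negP => d0.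
have d2 : 0 < `|T * q 0 j - p 0 j| / 2 by rewrite divr_gt0.
have [N1 H1] := cvp _ d2.
have [N2 H2] := small_fraction (mulr_ge0 (ltW T0) (normr_ge0 (q 0 j))) d2.
have {H1} := H1 _ (leq_maxl N1 N2); have {H2} := H2 _ (leq_maxr N1 N2).
set k := maxn N1 N2 => h2 /(le_lt_trans (displacement_le_dist _ _ j)).
rewrite lte_fin mxE => h1.
have := ler_distD (s k * q 0 j) (T * q 0 j) (p 0 j).
rewrite -mulrBl normrM {1}/s subKr.
rewrite (ger0_norm (divr_ge0 (ltW T0) (ler0n _ k.+1))) mulrAC [X in _ <= _ + X]distrC => h3.
by have := le_lt_trans h3 (ltrD h2 h1); rewrite -splitr ltxx.
Qed.

(** The parameters up to which the ray stays in [Sigma] form a set that is open by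
hypothesis and closed by [ray_limit]. *)
Lemma ray_fill (q : 'rV[R]_m) : complete_hypersurface Sigma -> Sigma 0 ->
  (forall t, Sigma (t *: q) -> exists2 d : R, 0 < d & forall s, `|s - t| < d -> Sigma (s *: q)) ->
  Sigma q.
Proof.
move=> cS S0 op.
pose E : set R := [set t | 0 <= t <= 1 /\ forall s, 0 <= s <= t -> Sigma (s *: q)].
have E0 : E 0.
  split=> [|s s0]; first by rewrite lexx ler01.
  by have /eqP -> : s == 0; [rewrite eq_le andbC | rewrite scale0r].
have ub : has_ubound E by exists 1 => t [/andP[]].
have sE : has_sup E by split=> //; exists 0.
pose T := sup E.
have T0 : 0 <= T by exact: ub_le_sup.
have T1 : T <= 1 by apply: ge_sup => [|t [/andP[]]] //; exists 0.
have low s : 0 <= s < T -> Sigma (s *: q).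
  move=> /andP[s0 sT]; have Ts : 0 < T - s by rewrite subr_gt0.
  have [t [_ Et]] := sup_adherent Ts sE; rewrite subKr => st.
  by apply: Et; rewrite s0 ltW.
have ST : Sigma (T *: q).
  have [T00|Tn] := eqVneq T 0; first by rewrite T00 scale0r.
  by apply: ray_limit => //; rewrite lt_neqAle eq_sym Tn.
have [T1'|Tlt] := eqVneq T 1; first by rewrite -[q]scale1r -T1'.
have {}Tlt : T < 1 by rewrite lt_neqAle Tlt.
have [d d0 Hd] := op T ST.
pose T' := Num.min 1 (T + d / 2).
have TT' : T < T' by rewrite lt_min Tlt ltrDl divr_gt0.
suff /(ub_le_sup ub) : E T' by rewrite leNgt TT'.
split; first by rewrite ge_min lexx (le_trans T0 (ltW TT')).
move=> s /andP[s0]; rewrite le_min => /andP[_ sd].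
have [sT|Ts] := ltP s T; first by apply: low; rewrite s0.
apply: Hd; rewrite ger0_norm ?subr_ge0 // ltrBlDl; apply: le_lt_trans sd _.
by rewrite ltrD2l ltr_pdivrMr // ltr_pMr // ltr1n.
Qed.

End curves.

(** * From local to global *)

Section global.
Context {R : realType} {n : nat}.
Variables (alpha : R) (Sigma : set 'rV[R]_n.+1).
Hypotheses (a0 : 0 < alpha) (emb : embedded_hypersurface Sigma) (st : stationary alpha Sigma).

(** The points satisfying [in_plane] form an open and closed part of [Sigma]:
closedness is [propagate], except at the origin, which belongs to it. *)
Lemma contained_in_plane e : dot e e = 1 -> connected Sigma -> in_plane Sigma e 0 ->
  forall X, Sigma X -> dot X e = 0.
Proof.
move=> e1 con ip0.
pose A := [set p | in_plane Sigma e p].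
have AE : A = Sigma.
  apply: con; first by exists 0.
  - pose C := \bigcup_(O in [set O | open O /\ forall X, Sigma X -> O X -> dot X e = 0]) O.
    exists C; first by apply: bigcup_open => O [].
    apply/seteqP; split=> [p [Sp [Q [oO Op HO]]]|p [Sp [Q [oO HO] Op]]].
      by split=> //; exists Q.
    by split=> //; exists Q; split.
  exists (closure A); first exact: closed_closure.
  apply/seteqP; split=> [p Ap|p [Sp clp]]; first by split; [case: Ap|exact: subset_closure].
  have [->//|p0] := eqVneq p 0.
  apply: (propagate emb st e1 Sp p0) => O oO Op.
  by have [X [AX OX]] := clp O (open_nbhs_nbhs (conj oO Op)); exists X.
move=> X; rewrite -AE => -[SX [Q [oO OX HO]]]; exact: HO.
Qed.

(** Graphs over the hyperplane orthogonal to [e] that lie in it are open in it. *)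
Lemma open_in_plane e p : dot e e = 1 -> (forall X, Sigma X -> dot X e = 0) -> Sigma p ->
  exists O, [/\ open O, O p & forall X, O X -> dot X e = 0 -> Sigma X].
Proof.
move=> e1 pl Sp.
have [U [V [phi [Up lp]]]] := emb Sp.
have [x0 Vx0 phip] := param_onto lp Sp Up.
have oV : open V by case: lp => -[].
have tan i : dot (partial i phi x0) e = 0.
  rewrite -(height_pd e lp i Vx0); apply: (eq0_pd oV _ i Vx0) => y Vy.
  exact: pl (param_in lp Vy).1.
have [B fr] := frame_exists e1.
have [r [U' [u]]] := graph_chart fr lp Vx0 tan; rewrite phip /=.
move=> [r0 U'p Cu lpu _].
exists (hproj B @^-1` ball_at (hproj B p) r); split.
- by apply: open_comp => [X _|]; [exact: continuous_mulmx|exact: open_ball_at].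
- by rewrite /= /ball_at /= subrr sq0.
move=> X NX Xe.
have SX := (param_in lpu NX).1.
by rewrite (frame_split fr X) Xe -(pl _ SX) (dot_graph fr).
Qed.

Lemma fills_plane e : dot e e = 1 -> (forall X, Sigma X -> dot X e = 0) ->
  complete_hypersurface Sigma -> Sigma 0 -> forall q, dot q e = 0 -> Sigma q.
Proof.
move=> e1 pl cS S0 q qe; apply: ray_fill => // t St.
have [Q [oO Ot HO]] := open_in_plane e1 pl St.
have c : {for t, continuous (fun s : R => s *: q)}.
  exact: scalel_continuous.
have : nbhs t ((fun s : R => s *: q) @^-1` Q) by apply: c; exact: open_nbhs_nbhs.
move=> /nbhs_ballP[d d0 Hd]; exists d => // s sd.
apply: HO; last by rewrite dotZl qe mulr0.
by apply: Hd; rewrite -ball_normE /= distrC.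
Qed.

End global.

Lemma hyperplane_of_normal (R : realType) (n : nat) (e : 'rV[R]_n.+1) : dot e e = 1 ->
  linear_hyperplane [set X | dot X e = 0].
Proof.
move=> e1; have [B fr] := frame_exists e1.
pose f := linfun (mulmxr B : 'rV[R]_n -> 'rV[R]_n.+1).
exists (limg f); split.
  rewrite limg_dim_eq; first by rewrite dimvf dim_matrix mul1r.
  apply/eqP; rewrite -subv0; apply/subvP => y; rewrite memv_cap memv_ker lfunE /= => /andP[_ /eqP y0].
  have [b1 _ _ _] := fr.
  by rewrite memv0 -[y]mulmx1 -b1 mulmxA y0 mul0mx.
apply/seteqP; split=> X /=.
  move=> Xe; have -> : X = f (hproj B X).
    by rewrite lfunE /= {1}(frame_split fr X) Xe scale0r addr0.
  exact: memv_img (memvf _).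
by move=> /memv_imgP[y _ ->]; rewrite lfunE /= (dot_mulBe fr).
Qed.

Theorem theorem1p1 (R : realType) (n : nat) (hn : (1 <= n)%N)
    (alpha : R) (halpha : 0 < alpha) (Sigma : set 'rV[R]_n.+1)
    (hSigma : embedded_hypersurface Sigma)
    (hcomplete : complete_hypersurface Sigma)
    (hconnected : connected Sigma)
    (h0 : Sigma 0)
    (hstat : stationary alpha Sigma) :
  linear_hyperplane Sigma.
Proof.
have [e [e1 ip0]] := plane_at_origin halpha hSigma hstat h0.
have pl := contained_in_plane hSigma hstat e1 hconnected ip0.
have -> : Sigma = [set X | dot X e = 0].
  apply/seteqP; split=> X; first exact: pl.
  exact: (fills_plane hSigma e1 pl hcomplete h0).
exact: hyperplane_of_normal.
Qed.
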